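(* Let $M$ be a Riemann surface, let $r=2s$ where $s\in\mathbb N$, and let $\Phi:M\to\Omega_r\mathrm U(n)^{\mathbb R}$ be an extended solution. Then $\Phi$ has a uniton factorization $\Phi=\eta_1\cdots\eta_r$ with $\eta_i=\pi_{\alpha_i}+\lambda\pi_{\alpha_i}^\perp$, where (i) each quadratic factor $\eta_{2\ell-1}\eta_{2\ell}$ has values in $\Omega_2\mathrm U(n)^{\mathbb R}$ $(\ell=1,\dots,s)$; (ii) each ''even'' partial product $\eta_1\cdots\eta_{2j}$ has values in $\Omega_{2j}\mathrm U(n)^{\mathbb R}$ $(j=1,\dots,s)$. Further, each $\alpha_i$ is given explicitly in terms of $W=\Phi\mathcal H_+$ by the formula for the alternating factorization: if $X$ is a holomorphic subbundle generating $W$ and $\{L^j\}$ is a meromorphic spanning set for $X$, with $L^j$ of order $o(j)$, then $$\alpha_i=\mathrm{span}\Bigl\{\sum_{p=0}^{i-1}S^{i-1}_p(L^j_{p-k+u})^{(k)}\ :\ 0\le o(j)+k-u\le i-1\Bigr\}+\mathrm{span}\Bigl\{\sum_{p=0}^{i-1}S^{i-1}_p(\widehat L^j_p)^{(k)}\ :\ o(j)+k-u<0\Bigr\},$$ where $u=[(r-i+1)/2]$ if the alternate steps start with an Uhlenbeck step, or $u=[(r-i)/2]$ if they start with a Segal step.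
   Context: $\mathbb N=\{0,1,2,\dots\}$. $\mathcal H_+$ is the closed span in $L^2(S^1,\mathbb C^n)$ of $\{\lambda^ie_j:i\ge0,\ 1\le j\le n\}$. $\Omega\mathrm U(n)$ is the group of smooth loops $\gamma:S^1\to\mathrm U(n)$ with $\gamma(1)=I$; $\Omega_i\mathrm U(n)$ is the set of those of the form $\sum_{k=0}^i\lambda^kT_k$; $\Omega_i\mathrm U(n)^{\mathbb R}$ is the set of $\Phi\in\Omega_i\mathrm U(n)$ with $\overline\Phi=\lambda^{-i}\Phi$. $\pi_\alpha,\pi_\alpha^\perp$ are orthogonal projections onto $\alpha,\alpha^\perp$. An extended solution is a smooth map $\Phi:M\to\Omega\mathrm U(n)$ such that, for every local holomorphic coordinate $z$, $\Phi^{-1}\Phi_z=(1-\lambda^{-1})A$ for some $\lambda$-independent matrix-valued map $A$. A subbundle $\alpha$ of $M\times\mathbb C^n$ is a uniton for $\Phi$ if $\Phi(\pi_\alpha+\lambda\pi_\alpha^\perp)$ is again an extended solution. A uniton factorization of $\Phi$ is a product $\Phi=(\pi_{\alpha_1}+\lambda\pi_{\alpha_1}^\perp)\cdots(\pi_{\alpha_r}+\lambda\pi_{\alpha_r}^\perp)$ in which each $\alpha_i$ is a uniton for the product $\Phi_{i-1}$ of the first $i-1$ factors ($\Phi_0=I$). The alternating factorization is the one corresponding to the filtration $W_i=\Phi_i\mathcal H_+$ obtained from $W_r=W$ by performing alternately Uhlenbeck steps $W_i\mapsto W_{i-1}=(\lambda^{-1}W_i)\cap\mathcal H_+$ and Segal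 steps $W_i\mapsto W_{i-1}=W_i+\lambda^{i-1}\mathcal H_+$. A holomorphic subbundle $X$ of the trivial bundle over $M$ with fibre $\mathcal H_+/\lambda^r\mathcal H_+\cong\mathbb C^{rn}$ generates $W$ if $W=X+\lambda X_{(1)}+\dots+\lambda^{r-1}X_{(r-1)}+\lambda^r\mathcal H_+$, where $X_{(i)}$ is the subbundle spanned by local holomorphic sections of $X$ and their derivatives of order up to $i$. A meromorphic spanning set for $X$ is a collection of meromorphic sections spanning its fibres off a discrete set. Write $L^j=\sum_i\lambda^iL^j_i$ (with $L^j_i=0$ for $i<0$ and $i\ge r$); $o(j)$ is the least $i$ with $L^j_i\not\equiv0$, and $\widehat L^j=\lambda^{-o(j)}L^j=\sum_{i\ge0}\lambda^i\widehat L^j_i$. Here $k\ge0$ is an integer and $(\cdot)^{(k)}$ is the $k$-th derivative with respect to a local complex coordinate. The $S^{i-1}_p$ are defined by $\Phi_{i-1}^{-1}=(\eta_1\cdots\eta_{i-1})^{-1}=\sum_{p=0}^{i-1}\lambda^{-p}S^{i-1}_p$. Spans are taken off a discrete set and extended over it as subbundles; $[\cdot]$ denotes integer part.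
   Formalization: The formula for α_i is false for some meromorphic spanning sets; it is stated for those whose orders o(j) detect W∩λ^u H_+: off a discrete set, mod λ^r H_+, that space lies in the span of the λ^{k+l}(L^j)^{(k)} with o(j)+k+l≥u. Existence, (i) and (ii) are unconditional. *)

(* Defs.v *)
From HB Require Import structures.
From mathcomp Require Import all_boot all_order all_algebra.
From mathcomp Require Import all_classical all_reals all_analysis.
From mathcomp Require Import spectral complex.

Set Implicit Arguments.
Unset Strict Implicit.
Unset Printing Implicit Defensive.

Import Order.TTheory GRing.Theory Num.Theory.
Import numFieldNormedType.Exports.

Local Open Scope classical_set_scope.
Local Open Scope ring_scope.
Local Open Scope sesquilinear_scope.

(* Coercing R[i] to numClosedFieldType makes the norm topology of C, and hence
   complex derivatives (derivable, derive1n), available on it. *)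
Definition Cplx (R : realType) : numClosedFieldType := R[i]%C.

Definition mkC (R : realType) (x y : R) : Cplx R := Complex x y.
Definition reC (R : realType) (z : Cplx R) : R := complex.Re z.
Definition imC (R : realType) (z : Cplx R) : R := complex.Im z.

Section LinearSpan.
Context {K : fieldType} {V : lmodType K}.

Definition lin_span (A : set V) : set V :=
  [set v | exists (m : nat) (a : 'I_m -> K) (w : 'I_m -> V),
     (forall i, A (w i)) /\ v = \sum_(i < m) a i *: w i].

Definition lin_indep (m : nat) (w : 'I_m -> V) : Prop :=
  forall a : 'I_m -> K, \sum_(i < m) a i *: w i = 0 -> forall i, a i = 0.

Definition set_add (A B : set V) : set V := [set v + w | v in A & w in B].

End LinearSpan.

(* A function on an open subset of a finite-dimensional space is C^(k+1) iff
   all its directional derivatives exist and are C^k. *)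
Fixpoint Ck (R : realType) (E : normedModType R) (k : nat) (U : set E)
    (f : E -> R) : Prop :=
  (forall x, U x -> {for x, continuous f}) /\
  (if k is k'.+1 then
     forall v : E, (forall x, U x -> derivable f x v) /\
                   Ck k' U (fun x => 'D_v f x)
   else True).

Definition smooth_on (R : realType) (E : normedModType R) (U : set E)
    (f : E -> Cplx R) : Prop :=
  forall k, Ck k U (fun x => reC (f x)) /\ Ck k U (fun x => imC (f x)).

Definition holo_on (R : realType) (U : set (Cplx R)) (f : Cplx R -> Cplx R) :
    Prop :=
  forall z, U z -> derivable f z 1.

(* chart_inv is only meaningful on the image of chart_dom. *)
Record chart (R : realType) (T : Type) := Chart {
  chart_dom : set T;
  chart_map : T -> Cplx R;
  chart_inv : Cplx R -> T }.

Definition chart_im (R : realType) (T : Type) (c : chart R T) (U : set T) :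
    set (Cplx R) :=
  chart_map c @` (chart_dom c `&` U).

Definition topological_chart (R : realType) (T : topologicalType)
    (c : chart R T) : Prop :=
  [/\ open (chart_dom c),
      open (chart_im c setT),
      forall p, chart_dom c p -> chart_inv c (chart_map c p) = p,
      forall p, chart_dom c p -> {for p, continuous (chart_map c)} &
      forall z, chart_im c setT z -> {for z, continuous (chart_inv c)}].

Definition holo_transition (R : realType) (T : Type) (c c' : chart R T) :
    Prop :=
  holo_on (chart_im c (chart_dom c')) (fun z => chart_map c' (chart_inv c z)).

(* Second countability is automatic, by Rado's theorem. *)
Record riemannSurface (R : realType) := RiemannSurface {
  rs_space :> topologicalType;
  rs_atlas : set (chart R rs_space);
  rs_chart : forall c, rs_atlas c -> topological_chart c;
  rs_transition :
    forall c c', rs_atlas c -> rs_atlas c' -> holo_transition c c';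
  rs_cover : forall p, exists2 c, rs_atlas c & chart_dom c p;
  rs_hausdorff : hausdorff_space rs_space;
  rs_connected : connected [set: rs_space];
  rs_nonempty : [set: rs_space] !=set0 }.

Section RiemannSurface.
Context {R : realType} (M : riemannSurface R).
Local Notation C := (Cplx R).

Definition coordinate (c : chart R M) : Prop :=
  topological_chart c /\
  forall c', rs_atlas c' -> holo_transition c c' /\ holo_transition c' c.

(* P holds on the open set U off a set without accumulation points in U. *)
Definition off_discrete (U : set M) (P : M -> Prop) : Prop :=
  forall p, U p -> \forall q \near p^', P q.

Definition chart_fun (c : chart R M) (f : M -> C) (xy : R * R) : C :=
  f (chart_inv c (mkC xy.1 xy.2)).

Definition smooth_fun (U : set M) (f : M -> C) : Prop :=
  forall c, coordinate c ->
    smooth_on [set xy : R * R | chart_im c U (mkC xy.1 xy.2)] (chart_fun c f).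

Definition holo_fun (U : set M) (f : M -> C) : Prop :=
  forall c, coordinate c ->
    holo_on (chart_im c U) (fun z => f (chart_inv c z)).

(* The values of a meromorphic function at its poles, and more generally on any
   discrete set, are arbitrary. *)
Definition meromorphic (f : M -> C) : Prop :=
  forall p : M, exists (c : chart R M) (U : set M) (m : nat) (g : M -> C),
    [/\ coordinate c, chart_dom c p, open U /\ U p, holo_fun U g &
        forall q, chart_dom c q -> U q -> q <> p ->
          (chart_map c q - chart_map c p) ^+ m * f q = g q].

Definition mero_zero (V : zmodType) (f : M -> V) : Prop :=
  off_discrete setT (fun q => f q = 0).

Definition dx (v : R * R) (c : chart R M) (f : M -> C) (p : M) : C :=
  let x := (reC (chart_map c p), imC (chart_map c p)) in
  mkC ('D_v (fun y => reC (chart_fun c f y)) x)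
      ('D_v (fun y => imC (chart_fun c f y)) x).

(* d/dz = (d/dx - i d/dy) / 2 *)
Definition dz (c : chart R M) (f : M -> C) (p : M) : C :=
  (dx (1, 0) c f p - mkC 0 1 * dx (0, 1) c f p) / 2%:R.

Definition mx_dz (m k : nat) (c : chart R M) (F : M -> 'M[C]_(m, k)) (p : M) :
    'M[C]_(m, k) :=
  \matrix_(a, b) dz c (fun q => F q a b) p.

Definition mx_deriv (m k : nat) (c : chart R M) (d : nat)
    (F : M -> 'M[C]_(m, k)) (p : M) : 'M[C]_(m, k) :=
  \matrix_(a, b)
    (derive1n d (fun z : C => F (chart_inv c z) a b : C^o) (chart_map c p)).

Definition subbundle (reg : set M -> (M -> C) -> Prop) (m k : nat)
    (X : M -> set 'M[C]_(m, k)) : Prop :=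
  forall p, exists (U : set M) (d : nat) (w : 'I_d -> M -> 'M[C]_(m, k)),
    [/\ open U /\ U p,
        forall j a b, reg U (fun q => w j q a b) &
        forall q, U q ->
          lin_indep (w ^~ q) /\ X q = lin_span (range (w ^~ q))].

Definition smooth_subbundle := subbundle smooth_fun.
Definition holo_subbundle := subbundle holo_fun.

(* X_(i), off the discrete set where the dimension of this span drops *)
Definition derived_bundle (m k : nat) (X : M -> set 'M[C]_(m, k)) (i : nat)
    (p : M) : set 'M[C]_(m, k) :=
  lin_span [set v | exists (c : chart R M) (U : set M)
                           (w : M -> 'M[C]_(m, k)) (d : nat),
    [/\ coordinate c /\ chart_dom c p, open U /\ U p,
        (forall a b, holo_fun U (fun q => w q a b)) /\
        (forall q, U q -> X q (w q)),
        (d <= i)%N & v = mx_deriv c d w p]].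

Definition mero_spanning_set (m k d : nat) (X : M -> set 'M[C]_(m, k))
    (L : 'I_d -> M -> 'M[C]_(m, k)) : Prop :=
  (forall j a b, meromorphic (fun q => L j q a b)) /\
  off_discrete setT (fun q => X q = lin_span (range (L ^~ q))).

End RiemannSurface.

Section Loops.
Context {R : realType} (n : nat).
Local Notation C := (Cplx R).

Definition circle := {z : C | `|z| == 1}.

Lemma cis_subproof (t : R) : `|mkC (cos t) (sin t)| == 1 :> C.
Proof.
by rewrite normc_def /= cos2Dsin2 sqrtr1.
Qed.

Definition cis (t : R) : circle := exist _ (mkC (cos t) (sin t)) (cis_subproof t).

Lemma one_subproof : `|1 : C| == 1. Proof. by rewrite normr1. Qed.

Definition circle1 : circle := exist _ 1 one_subproof.

Definition loop := circle -> 'M[C]_n.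

Definition OmegaU : set loop :=
  [set g : loop | [/\ forall a b, smooth_on setT (fun t : R => g (cis t) a b),
               forall l, g l \is unitarymx & g circle1 = 1%:M]].

Definition OmegaPoly (i : nat) : set loop :=
  [set g : loop | OmegaU g /\ exists T : nat -> 'M[C]_n,
     forall l, g l = \sum_(k < i.+1) val l ^+ k *: T k].

Definition OmegaReal (i : nat) : set loop :=
  [set g : loop | OmegaPoly i g /\
     forall l, map_mx Num.conj (g l) = val l ^- i *: g l].

(* L^2(S^1, C^n); an element is given by any of its representatives, so that a
   subspace is a set of functions closed under a.e. equality. *)
Definition circle_fun := circle -> 'cV[C]_n.

Definition sqnorm (v : 'cV[C]_n) : R :=
  \sum_(j < n) (reC (v j 0) ^+ 2 + imC (v j 0) ^+ 2).

Definition L2sqnorm (f : circle_fun) : \bar R :=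
  (\int[lebesgue_measure]_(t in `[0%R, (2 * pi)%R]) (sqnorm (f (cis t)))%:E)%E.

Definition L2 : set circle_fun :=
  [set f : circle_fun | (forall j,
     measurable_fun `[0, 2 * pi] (fun t : R => reC (f (cis t) j 0)) /\
     measurable_fun `[0, 2 * pi] (fun t : R => imC (f (cis t) j 0))) /\
     (L2sqnorm f < +oo)%E].

Definition Hplus_gen : set circle_fun :=
  [set f : circle_fun | exists (i : nat) (j : 'I_n),
     f = fun l => val l ^+ i *: delta_mx j 0].

Definition Hplus : set circle_fun :=
  [set f : circle_fun | L2 f /\ forall e : R, 0 < e ->
     exists2 P, lin_span Hplus_gen P & (L2sqnorm (f - P)%R < e%:E)%E].

Definition lam_mul (k : int) (f : circle_fun) : circle_fun :=
  fun l => val l ^ k *: f l.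

Definition lam_image (k : int) (A : set circle_fun) : set circle_fun :=
  lam_mul k @` A.

Definition loop_image (g : loop) (A : set circle_fun) : set circle_fun :=
  (fun f l => g l *m f l) @` A.

Definition uhlenbeck_step (W : set circle_fun) : set circle_fun :=
  lam_image (- 1) W `&` Hplus.

(* The Segal step with parameter i sends W_i to W_(i-1). *)
Definition segal_step (i : nat) (W : set circle_fun) : set circle_fun :=
  set_add W (lam_image (i%:Z - 1) Hplus).

Definition is_orthproj (A : set 'cV[C]_n) (P : 'M[C]_n) : Prop :=
  [/\ P ^t* = P, P *m P = P & A = range (fun v : 'cV[C]_n => P *m v)].

Definition orthproj (A : set 'cV[C]_n) : 'M[C]_n := xget 0 (is_orthproj A).

Definition uniton_factor (A : set 'cV[C]_n) : loop :=
  fun l => orthproj A + val l *: (1%:M - orthproj A).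

End Loops.
Arguments circle R : clear implicits.
Arguments loop R n : clear implicits.
Arguments circle_fun R n : clear implicits.
Arguments Hplus {R n}.

(* An element of H_+ / lambda^r H_+ is given by its representative
   sum_(i < r) lambda^i A_i, where A_i is the i-th column of A : 'M_(n, r). *)
Definition poly_rep (R : realType) (n r : nat) (A : 'M[Cplx R]_(n, r)) :
    circle_fun R n :=
  fun l => \sum_(i < r) val l ^+ i *: col i A.

Definition coefL (R : realType) (n r : nat) (A : 'M[Cplx R]_(n, r)) (i : int) :
    'cV[Cplx R]_n :=
  \sum_(k < r | k%:Z == i) col k A.

Inductive step := Uhlenbeck | Segal.

Definition other_step (b : step) : step :=
  match b with Uhlenbeck => Segal | Segal => Uhlenbeck end.

(* the step W_i |-> W_(i-1), when the step W_r |-> W_(r-1) is b *)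
Definition step_at (b : step) (r i : nat) : step :=
  if odd (r - i) then other_step b else b.

Definition num_uhlenbeck (b : step) (r i : nat) : nat :=
  match b with
  | Uhlenbeck => ((r - i + 1) %/ 2)%N
  | Segal => ((r - i) %/ 2)%N
  end.

Section ExtendedSolutions.
Context {R : realType} {M : riemannSurface R} {n : nat}.
Local Notation C := (Cplx R).

(* smoothness of a map M -> Omega U(n), as joint smoothness on M x S^1 *)
Definition smooth_loop_map (Phi : M -> loop R n) : Prop :=
  forall c : chart R M, coordinate c -> forall a b,
    smooth_on
      [set x : (R * R) * R | chart_im c setT (mkC x.1.1 x.1.2)]
      (fun x : (R * R) * R =>
         Phi (chart_inv c (mkC x.1.1 x.1.2)) (cis x.2) a b).

Definition extended_solution (Phi : M -> loop R n) : Prop :=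
  [/\ forall p, OmegaU (Phi p),
      smooth_loop_map Phi &
      forall c : chart R M, coordinate c -> exists A : M -> 'M[C]_n,
        forall p, chart_dom c p -> forall l : circle R,
          invmx (Phi p l) *m mx_dz c (fun q => Phi q l) p
          = (1 - (val l)^-1) *: A p].

Definition uniton (Phi : M -> loop R n) (alpha : M -> set 'cV[C]_n) : Prop :=
  smooth_subbundle alpha /\
  extended_solution (fun p l => Phi p l *m uniton_factor (alpha p) l).

(* alpha is indexed from 1; this is eta_a ... eta_b, in this order. *)
Definition factor_prod (alpha : nat -> M -> set 'cV[C]_n) (a b : nat) (p : M) :
    loop R n :=
  fun l => \big[mulmx/1%:M]_(a <= j < b.+1) uniton_factor (alpha j p) l.

Definition partial_prod (alpha : nat -> M -> set 'cV[C]_n) (i : nat) :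
    M -> loop R n :=
  factor_prod alpha 1 i.

Definition uniton_factorization (r : nat) (Phi : M -> loop R n)
    (alpha : nat -> M -> set 'cV[C]_n) : Prop :=
  (forall p l, Phi p l = partial_prod alpha r p l) /\
  (forall i, (1 <= i <= r)%N -> uniton (partial_prod alpha i.-1) (alpha i)).

Definition alternating_factorization (b : step) (r : nat)
    (alpha : nat -> M -> set 'cV[C]_n) : Prop :=
  let W i p := loop_image (partial_prod alpha i p) Hplus in
  forall i, (1 <= i <= r)%N -> off_discrete setT (fun p =>
    W i.-1 p = match step_at b r i with
               | Uhlenbeck => uhlenbeck_step (W i p)
               | Segal => segal_step i (W i p)
               end).

Definition inverse_coefs (r : nat) (alpha : nat -> M -> set 'cV[C]_n)
    (S : nat -> nat -> M -> 'M[C]_n) : Prop :=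
  forall i, (i < r)%N -> forall p l,
    invmx (partial_prod alpha i p l) =
    \sum_(q < i.+1) val l ^- q *: S i q p.

Definition generates (r : nat) (X : M -> set 'M[C]_(n, r))
    (W : M -> set (circle_fun R n)) : Prop :=
  off_discrete setT (fun p =>
    W p = set_add
      (lin_span [set f | exists (i : nat) (v : 'M[C]_(n, r)),
         [/\ (i < r)%N, derived_bundle X i p v &
             f = lam_mul i%:Z (poly_rep v)]])
      (lam_image r%:Z Hplus)).

Definition has_order (r : nat) (L : M -> 'M[C]_(n, r)) (o : nat) : Prop :=
  ~ mero_zero (fun p => coefL (L p) o%:Z) /\
  forall i, (i < o)%N -> mero_zero (fun p => coefL (L p) i%:Z).

(* The orders o(j) detect the part of W of order at least u: no combination of
   the generators lambda^(k+l) (L^j)^(k) of W has higher order through a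
   cancellation of leading terms. For u = 0 this holds as soon as X generates W.

   Without it the Uhlenbeck steps are not computed by a termwise formula: for
   n = 3, r = 2, the constant map Phi = pi_a + lambda pi_e3 + lambda^2 pi_(conj a)
   with a = (1, i, 0), and the spanning set {a, a + lambda e3} of
   X = span {a, lambda e3}, one has alpha_1 = span {a, e3} if the first step is
   an Uhlenbeck step, whereas both L^j have order 0 and the formula for alpha_1
   only gives span {a}. *)
Definition order_adapted (r d : nat) (W : M -> set (circle_fun R n))
    (L : 'I_d -> M -> 'M[C]_(n, r)) (o : 'I_d -> nat) (u : nat) : Prop :=
  forall c : chart R M, coordinate c -> off_discrete (chart_dom c) (fun p =>
    W p `&` lam_image u%:Z Hplus `<=`
    set_add
      (lin_span [set f | exists (j : 'I_d) (k l : nat),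
         (u <= o j + k + l)%N /\
         f = lam_mul (k + l)%N%:Z (poly_rep (mx_deriv c k (L j) p))])
      (lam_image r%:Z Hplus)).

Definition alpha_gen (r d : nat) (S : nat -> nat -> M -> 'M[C]_n)
    (L : 'I_d -> M -> 'M[C]_(n, r)) (o : 'I_d -> nat) (i u : nat)
    (c : chart R M) (p : M) : set 'cV[C]_n :=
  [set v | exists (j : 'I_d) (k : nat),
     (0 <= (o j)%:Z + k%:Z - u%:Z <= i%:Z - 1) /\
     v = \sum_(q < i) S i.-1 q p *m
           mx_deriv c k (fun x => coefL (L j x) (q%:Z - k%:Z + u%:Z)) p].

Definition alpha_gen_hat (r d : nat) (S : nat -> nat -> M -> 'M[C]_n)
    (L : 'I_d -> M -> 'M[C]_(n, r)) (o : 'I_d -> nat) (i u : nat)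
    (c : chart R M) (p : M) : set 'cV[C]_n :=
  [set v | exists (j : 'I_d) (k : nat),
     ((o j)%:Z + k%:Z - u%:Z < 0) /\
     v = \sum_(q < i) S i.-1 q p *m
           mx_deriv c k (fun x => coefL (L j x) (q%:Z + (o j)%:Z)) p].

End ExtendedSolutions.

(* Main.v *)
(** Write [Phi = sum_k lambda^k T_k]. The uniton of an Uhlenbeck step is the
    range of the adjoint of [T_0], which must be extended over the points
    where its rank drops. Unitarity makes the truncated block Toeplitz matrix
    of the [T_k] a partial isometry, so its range, which is [W] modulo a power
    of lambda, has constant rank; the extended solution equation makes that
    range holomorphic. A local holomorphic frame yields [T_0 h = K] with [K]
    holomorphic and [h] smooth and invertible; dividing out zeros saturates
    the rows of [K] across the bad point, and the orthogonal projections onto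
    the saturations glue.

    Segal steps follow from Uhlenbeck steps: [Phi |-> lambda^i conj(Phi)]
    preserves extended solutions and exchanges the two kinds of step.  The two
    kinds commute, so when [Phi] is real two alternate steps reach the same [W]
    in either order; hence the loop reached equals its own conjugate and is
    again real.

    After the steps, [W_i = (lambda^-u W /\ H_+) + lambda^i H_+], and [alpha_i]
    consists of the constant terms of [Phi_{i-1}^{-1} W_i].  Evaluating that
    constant term on the generators [lambda^k (L^j)^(k)] of [W] gives the
    formula: a generator whose order [o(j) + k] is at least [u] is divided by
    [lambda^u]; one of smaller order is first multiplied by the power of lambda
    that raises its order to [u]. *)
Require Import Defs.
From HB Require Import structures.
From mathcomp Require Import all_boot all_order all_algebra.
From mathcomp Require Import all_classical all_reals all_analysis.
From mathcomp Require Import spectral complex measurable_realfun ring lra zify.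

Set Implicit Arguments.
Unset Strict Implicit.
Unset Printing Implicit Defensive.

Import Order.TTheory GRing.Theory Num.Theory.
Import numFieldNormedType.Exports.

Local Open Scope classical_set_scope.
Local Open Scope ring_scope.
Local Open Scope sesquilinear_scope.

(** * Calculus of smooth functions *)

(** The obstacle is that [T 0] is merely smooth: the rank of a smooth matrix may drop on any closed
    set, and its range need not extend. Hence the detour through the block Toeplitz matrix. The
    complex analysis required is local: a holomorphic function is zero near a point, or a power of
    the coordinate times a function not vanishing there. As the functions concerned are smooth
    beforehand, Taylor quotients and the maximum principle take the place of Cauchy integrals and
    power series.

    Loops are handled through their coefficients. Of the Hardy space only algebra remains in the
    end: stability under polynomial loops, the splitting f = v + lambda g with v constant, and the
    fact that it contains lambda^-1 v only for v = 0.

    Identities between smooth maps are checked where a projection spans the expected row space, and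
    extend by continuity. Row spaces stand for ranges: for a Hermitian projection [pi],
    [(pi :=: T 0)%MS] says that the columns of [pi] span the range of the adjoint of [T 0]. *)

Lemma open_near (T : topologicalType) (U : set T) x : open U -> U x ->
  \forall y \near x, U y.
Proof. by move=> oU Ux; exact: open_nbhs_nbhs. Qed.

Section CkCalculus.
Context {R : realType} {E : normedModType R}.
Implicit Types (U V : set E) (f g : E -> R) (v : E).

Lemma Ck_sub k U V f : V `<=` U -> Ck k U f -> Ck k V f.
Proof.
move=> VU; elim: k f => [|k IH] f /= [cf df].
  by split=> // x /VU/cf.
split=> [x /VU/cf //|v].
have [dfv Cf] := df v; split; first by move=> x /VU /dfv.
exact: IH.
Qed.

Lemma Ck_S k U f : Ck k.+1 U f -> Ck k U f.
Proof.
elim: k f => [|k IH] f /= [cf df]; first by split.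
split=> // v; have [dfv Cf] := df v; split => //; exact: IH.
Qed.

(** Continuity and derivatives are taken in the ambient space, so [U] only lists the points where
    they are tested. Smoothness can therefore be checked point by point, even on a set that is not
    open. *)
Lemma Ck_pt k U f : (forall x, U x -> Ck k [set x] f) -> Ck k U f.
Proof.
elim: k f => [|k IH] f H /=.
  by split=> // x Ux; have [/(_ x erefl)] := H x Ux.
split=> [x Ux|v]; first by have [/(_ x erefl)] := H x Ux.
split.
- by move=> x Ux; have [_ /(_ v)[/(_ x erefl)]] := H x Ux.
by apply: IH => x Ux; have [_ /(_ v)[]] := H x Ux.
Qed.

Lemma near_eq_at (T : topologicalType) (S : Type) (f g : T -> S) x :
  {near x, f =1 g} -> f x = g x.
Proof. by move=> /nbhs_singleton. Qed.

Lemma Ck_near k x f g : {near x, f =1 g} -> Ck k [set x] f -> Ck k [set x] g.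
Proof.
have cg f' g' : {near x, f' =1 g'} -> {for x, continuous f'} ->
    {for x, continuous g'}.
  move=> fg; rewrite /prop_for /continuous_at -(near_eq_at fg).
  by apply: cvg_trans; apply: near_eq_cvg.
elim: k f g => [|k IH] f g fg /= [cf df].
  by split=> // y ->; apply: (cg f) => //; exact: cf.
split=> [y ->|v]; first by apply: (cg f) => //; exact: cf.
split=> [y ->|].
  by have [/(_ x erefl) dfx _] := df v; exact: (near_eq_derivable fg).
apply: (IH ('D_v f)); last by have [] := df v.
by have /= := near_join fg; apply: filterS => y fgy; exact: near_eq_derive.
Qed.

Lemma Ck_ext k U f g : open U -> (forall x, U x -> f x = g x) ->
  Ck k U f -> Ck k U g.
Proof.
move=> oU fg Cf; apply: Ck_pt => x Ux.
apply: (@Ck_near _ _ f); last by apply: Ck_sub Cf => y ->.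
by have := open_near oU Ux; apply: filterS => y; exact: fg.
Qed.

Lemma Ck_cont k U f x : Ck k U f -> U x -> {for x, continuous f}.
Proof. by case: k => [|k] [H _]; exact: H. Qed.

Lemma Ck_derivable k U f x v : Ck k.+1 U f -> U x -> derivable f x v.
Proof. by move=> [_ /(_ v)[H _]]; exact: H. Qed.

Lemma Ck_D k U f v : Ck k.+1 U f -> Ck k U ('D_v f).
Proof. by move=> [_ /(_ v)[]]. Qed.

Lemma Ck_cst k U (c : R) : Ck k U (fun=> c).
Proof.
elim: k c => [|k IH] c /=; first by split=> // x _; exact: cvg_cst.
split=> [x _|v]; first exact: cvg_cst.
split; first by move=> x _; exact: derivable_cst.
have -> : 'D_v (fun=> c) = fun=> 0 by apply/funext => x; exact: derive_cst.
exact: IH.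
Qed.

Lemma Ck_add k U f g : open U -> Ck k U f -> Ck k U g ->
  Ck k U (fun x => f x + g x).
Proof.
move=> oU; elim: k f g => [|k IH] f g Cf Cg /=.
  by split=> // x Ux; apply: cvgD; [exact: (Ck_cont Cf)|exact: (Ck_cont Cg)].
split=> [x Ux|v].
  by apply: cvgD; [exact: (Ck_cont Cf)|exact: (Ck_cont Cg)].
split=> [x Ux|].
  by apply: derivableD; [exact: (Ck_derivable Cf)|exact: (Ck_derivable Cg)].
apply: (@Ck_ext _ _ (fun x => 'D_v f x + 'D_v g x)) => //.
  by move=> x Ux; rewrite deriveD //; [exact: (Ck_derivable Cf)|exact: (Ck_derivable Cg)].
by apply: IH; exact: Ck_D.
Qed.

Lemma Ck_mul k U f g : open U -> Ck k U f -> Ck k U g ->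
  Ck k U (fun x => f x * g x).
Proof.
move=> oU; elim: k f g => [|k IH] f g Cf Cg /=.
  by split=> // x Ux; apply: cvgM; [exact: (Ck_cont Cf)|exact: (Ck_cont Cg)].
split=> [x Ux|v].
  by apply: cvgM; [exact: (Ck_cont Cf)|exact: (Ck_cont Cg)].
split=> [x Ux|].
  by apply: derivableM; [exact: (Ck_derivable Cf)|exact: (Ck_derivable Cg)].
apply: (@Ck_ext _ _ (fun x => f x * 'D_v g x + g x * 'D_v f x)) => //.
  by move=> x Ux; rewrite deriveM //; [exact: (Ck_derivable Cf)|exact: (Ck_derivable Cg)].
by apply: Ck_add => //; apply: IH; first [exact: Ck_D | exact: Ck_S].
Qed.

Lemma Ck_opp k U f : open U -> Ck k U f -> Ck k U (fun x => - f x).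
Proof.
move=> oU Cf; apply: (@Ck_ext _ _ (fun x => (-1) * f x)) => //.
  by move=> x _; rewrite mulN1r.
by apply: Ck_mul => //; exact: Ck_cst.
Qed.

Lemma Ck_inv k U f : open U -> (forall x, U x -> f x != 0) -> Ck k U f ->
  Ck k U (fun x => (f x)^-1).
Proof.
move=> oU f0; elim: k => [|k IH] Cf /=.
  by split=> // x Ux; apply: cvgV; [exact: f0|exact: (Ck_cont Cf)].
split=> [x Ux|v]; first by apply: cvgV; [exact: f0|exact: (Ck_cont Cf)].
split=> [x Ux|].
  by apply: derivableV; [exact: f0|exact: (Ck_derivable Cf)].
apply: (@Ck_ext _ _ (fun x => - (((f x)^-1 * (f x)^-1) * 'D_v f x))) => //.
  move=> x Ux; rewrite [RHS]deriveV //; [|exact: f0|exact: (Ck_derivable Cf)].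
  by rewrite expr2 invfM scaleNr.
apply: Ck_opp => //; apply: Ck_mul => //; last exact: Ck_D.
by apply: Ck_mul => //; apply: IH; exact: Ck_S.
Qed.

Lemma is_derive_line f x v (t : R) : derivable f (x + t *: v) v ->
  is_derive t 1 (fun s : R => f (x + s *: v)) ('D_v f (x + t *: v)).
Proof.
have e : (fun h : R => h^-1 *: ((f \o shift (x + t *: v)) (h *: v) -
      f (x + t *: v))) =
    (fun h : R => h^-1 *: (((fun s : R => f (x + s *: v)) \o shift t) h%:A -
      f (x + t *: v))).
  by apply/funext => h /=; rewrite addrCA -scalerDl [h%:A]mulr1.
by move=> df; apply: DeriveDef; move: df; rewrite /derivable /derive e.
Qed.

Lemma MVT_line f x v (t : R) : 0 < t ->
  (forall s, 0 <= s <= t -> derivable f (x + s *: v) v) ->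
  exists2 s, 0 < s < t & f (x + t *: v) - f x = t * 'D_v f (x + s *: v).
Proof.
move=> t0 df.
have dl s : 0 <= s <= t ->
    is_derive s 1 (fun s : R => f (x + s *: v)) ('D_v f (x + s *: v)).
  by move=> st; apply: is_derive_line; exact: df.
have [||c cin] := @MVT _ (fun s : R => f (x + s *: v)) (fun s : R => 'D_v f (x + s *: v)) _ _ t0.
- by move=> s; rewrite in_itv /= => /andP[s0 st]; apply: dl; rewrite !ltW.
- apply: derivable_within_continuous => s; rewrite in_itv /= => s0t.
  by have [] := dl s s0t.
rewrite scale0r addr0 subr0 => ->; exists c; first by move: cin; rewrite in_itv.
by rewrite mulrC.
Qed.

Lemma near_line2 (P : set E) x u v : nbhs x P ->
  \forall t \near (0 : R)^'+, forall s s' : R, 0 <= s <= t -> 0 <= s' <= t ->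
    P (x + s *: u + s' *: v).
Proof.
move=> /nbhs_ballP[e /= e0 xP].
have M0 : 0 < `|u| + `|v| + 1 by rewrite ltr_wpDl ?addr_ge0.
near=> t => s s' /andP[s0 st] /andP[s'0 s't].
apply: xP; rewrite -ball_normE /ball_ /= -addrA opprD addNKr normrN.
apply: (@le_lt_trans _ _ (t * (`|u| + `|v|))).
  rewrite (le_trans (ler_normD _ _)) // !normrZ mulrDr !ger0_norm //.
  by rewrite lerD // ler_wpM2r.
have t0 : 0 < t by near: t; exact: nbhs_right_gt.
rewrite (@lt_le_trans _ _ (t * (`|u| + `|v| + 1))) ?ltr_pM2l ?ltrDl //.
rewrite -ler_pdivlMr //; near: t; apply: nbhs_right_le; exact: divr_gt0.
Unshelve. all: by end_near. Qed.

Lemma derive_right f x v : derivable f x v ->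
  t^-1 * (f (x + t *: v) - f x) @[t --> (0 : R)^'+] --> 'D_v f x.
Proof.
move=> df; have : h^-1 *: ((f \o shift x) (h *: v) - f x) @[h --> (0 : R)^'] --> 'D_v f x.
  exact: df.
move=> /cvg_dnbhs_at_right H; apply: cvg_trans H.
by apply: near_eq_cvg; near=> t; rewrite /= [_ *: _ + x]addrC.
Unshelve. all: by end_near. Qed.

Lemma continuous_dist_le (g : E -> R) x (e : R) : {for x, continuous g} ->
  0 < e -> \forall y \near x, `|g x - g y| <= e.
Proof. by move=> /cvgrPdist_le H; exact: H. Qed.

(** [Ck] asks for directional derivatives only, so additivity in the direction needs an argument:
    move along [u], then along [v]; the second increment is [t] times a value of ['D_v f] near [x],
    and ['D_v f] is continuous. *)
Lemma Ck_derive_add U f x u v : open U -> Ck 1 U f -> U x ->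
  'D_(u + v) f x = 'D_u f x + 'D_v f x.
Proof.
move=> oU Cf Ux.
have cv : {for x, continuous ('D_v f)} by exact: Ck_cont (Ck_D v Cf) Ux.
have H : t^-1 * (f (x + t *: u + t *: v) - f (x + t *: u)) @[t --> (0 : R)^'+]
    --> 'D_v f x.
  apply/cvgrPdist_le => e e0.
  have NL := near_line2 u v (filterI (open_near oU Ux) (continuous_dist_le cv e0)).
  near=> t.
  have t0 : 0 < t by near: t; exact: nbhs_right_gt.
  have Q' s s' : 0 <= s <= t -> 0 <= s' <= t -> U (x + s *: u + s' *: v) /\
      `|'D_v f x - 'D_v f (x + s *: u + s' *: v)| <= e.
    by move: s s'; near: t; exact: NL.
  have Q s' : 0 <= s' <= t ->
      U (x + t *: u + s' *: v) /\ `|'D_v f x - 'D_v f (x + t *: u + s' *: v)| <= e.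
    by apply: Q'; rewrite lexx ltW.
  have [s st|s /andP[s0 st] ->] := @MVT_line f (x + t *: u) v t t0.
    exact: (Ck_derivable Cf (Q s st).1).
  by rewrite mulKf ?gt_eqF //; apply: (Q s _).2; rewrite !ltW.
have H1 := derive_right (Ck_derivable Cf Ux : derivable f x (u + v)).
have H2 := derive_right (Ck_derivable Cf Ux : derivable f x u).
apply: (cvg_unique _ H1) => //.
apply: (cvg_trans _ (cvgD H2 H)); apply: near_eq_cvg; near=> t.
transitivity (t^-1 * (f (x + t *: u) - f x) +
  t^-1 * (f (x + t *: u + t *: v) - f (x + t *: u))); first by [].
by rewrite -mulrDr scalerDr [x + (_ + _)]addrA; congr (_ * _); ring.
Unshelve. all: by end_near. Qed.

Lemma Ck_derive_scale U f x v (k : R) : Ck 1 U f -> U x ->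
  'D_(k *: v) f x = k * 'D_v f x.
Proof.
move=> Cf Ux.
have d1 w : is_derive (0 : R) 1 (fun s : R => f (x + s *: w)) ('D_w f x).
  have := @is_derive_line f x w 0; rewrite scale0r addr0; apply.
  exact: Ck_derivable Cf Ux.
have d2 : is_derive (0 : R) 1 (fun s : R => s * k) k.
  by apply: is_derive_eq; rewrite /GRing.scale /=; ring.
have d3 : is_derive (0 * k : R) 1 (fun s : R => f (x + s *: v)) ('D_v f x).
  by rewrite mul0r.
have := @is_derive1_comp _ _ (fun s : R => s * k) _ _ _ d3 d2.
rewrite (_ : _ \o _ = (fun s : R => f (x + s *: (k *: v)))); last first.
  by apply/funext => s /=; rewrite scalerA.
by move=> d4; have [_ <-] := d1 (k *: v); have [_ ->] := d4; rewrite mulrC.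
Qed.

Lemma is_derive_translate f y c v d : is_derive (y + c) v f d ->
  is_derive y v (fun z => f (z + c)) d.
Proof.
have e : (fun h : R => h^-1 *: ((f \o shift (y + c)) (h *: v) - f (y + c))) =
    (fun h : R => h^-1 *: (((fun z => f (z + c)) \o shift y) (h *: v) -
      f (y + c))).
  by apply/funext => h /=; rewrite addrA.
by move=> [df <-]; apply: DeriveDef; move: df; rewrite /derivable /derive e.
Qed.

(** Two uses of the mean value theorem turn the second difference into [t ^+ 2] times a value of
    ['D_v ('D_u f)] near [x]. The difference is symmetric in [u] and [v], whence the symmetry of
    second derivatives. *)
Lemma derive_second_diff U f x u v : open U -> Ck 2 U f -> U x ->
  t^-1 ^+ 2 * (f (x + t *: u + t *: v) - f (x + t *: u) - f (x + t *: v) + f x)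
    @[t --> (0 : R)^'+] --> 'D_v ('D_u f) x.
Proof.
move=> oU Cf Ux.
have cv : {for x, continuous ('D_v ('D_u f))}.
  exact: Ck_cont (Ck_D v (Ck_D u Cf)) Ux.
apply/cvgrPdist_le => e e0.
have NL := near_line2 u v (filterI (open_near oU Ux) (continuous_dist_le cv e0)).
near=> t.
have t0 : 0 < t by near: t; exact: nbhs_right_gt.
have Q s s' : 0 <= s <= t -> 0 <= s' <= t -> U (x + s *: u + s' *: v) /\
    `|'D_v ('D_u f) x - 'D_v ('D_u f) (x + s *: u + s' *: v)| <= e.
  by move: s s'; near: t; exact: NL.
have tt : 0 <= t <= t by rewrite lexx ltW.
have d1 s s' : 0 <= s <= t -> 0 <= s' <= t -> derivable f (x + s *: u + s' *: v) u.
  by move=> st s't; apply: (Ck_derivable (Ck_S Cf) (Q _ _ st s't).1).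
have o0 : (0 : R) <= 0 <= t by apply/andP; split; [|exact: ltW].
have sh s : 0 <= s <= t -> is_derive (x + s *: u) u
    (fun y => f (y + t *: v) - f y)
    ('D_u f (x + s *: u + t *: v) - 'D_u f (x + s *: u)).
  move=> st; have d0 := d1 s 0 st o0; rewrite scale0r addr0 in d0.
  apply: is_deriveB; last exact: derivableP.
  by apply: is_derive_translate; apply: derivableP; exact: d1.
have [s st|s /andP[s0 st] E1] :=
    @MVT_line (fun y => f (y + t *: v) - f y) x u t t0.
  by have [] := sh s st.
have st' : 0 <= s <= t by rewrite !ltW.
have [s' s't|s' /andP[s'0 s't] E2] := @MVT_line ('D_u f) (x + s *: u) v t t0.
  by apply: (Ck_derivable (Ck_D u Cf) (Q _ _ st' s't).1).
have st2 : 0 <= s' <= t by rewrite !ltW.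
rewrite [X in _ * X](_ : _ = t ^+ 2 * 'D_v ('D_u f) (x + s *: u + s' *: v)).
  rewrite mulrA -exprMn mulVf ?gt_eqF // expr1n mul1r; exact: (Q _ _ st' st2).2.
rewrite expr2 -mulrA -E2.
rewrite [X in _ = t * X](_ : _ = 'D_u (fun y => f (y + t *: v) - f y) (x + s *: u)).
  by rewrite -E1; ring.
by have [_ ->] := sh s st'.
Unshelve. all: by end_near. Qed.

Lemma Ck_deriveC U f x u v : open U -> Ck 2 U f -> U x ->
  'D_u ('D_v f) x = 'D_v ('D_u f) x.
Proof.
move=> oU Cf Ux; apply: (cvg_unique _ (@derive_second_diff U f x v u oU Cf Ux)) => //.
apply: (cvg_trans _ (@derive_second_diff U f x u v oU Cf Ux)); apply: near_eq_cvg; near=> t.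
by rewrite /= [x + _ + _]addrAC; congr (_ * _); ring.
Unshelve. all: by end_near. Qed.

End CkCalculus.

(** * Real and imaginary parts *)

Section Cplx.
Context {R : realType}.
Local Notation C := (Cplx R).
Implicit Types z w : C.

Lemma reCD z w : reC (z + w) = reC z + reC w. Proof. by case: z; case: w. Qed.
Lemma imCD z w : imC (z + w) = imC z + imC w. Proof. by case: z; case: w. Qed.
Lemma reCN z : reC (- z) = - reC z. Proof. by case: z. Qed.
Lemma imCN z : imC (- z) = - imC z. Proof. by case: z. Qed.
Lemma reCM z w : reC (z * w) = reC z * reC w - imC z * imC w.
Proof. by case: z; case: w. Qed.
Lemma imCM z w : imC (z * w) = reC z * imC w + imC z * reC w.
Proof. by case: z => a b; case: w => c d. Qed.
Lemma reC_conj z : reC (Num.conj z) = reC z. Proof. by case: z. Qed.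
Lemma imC_conj z : imC (Num.conj z) = - imC z. Proof. by case: z. Qed.
Lemma Cplx_ext z w : reC z = reC w -> imC z = imC w -> z = w.
Proof. by case: z => a b; case: w => c d /= -> ->. Qed.
Lemma mkCE z : mkC (reC z) (imC z) = z. Proof. by case: z. Qed.
Lemma sqnormC_eq0 z : (reC z ^+ 2 + imC z ^+ 2 == 0) = (z == 0).
Proof.
case: z => a b /=; rewrite eq_complex /= paddr_eq0 ?sqr_ge0 //.
by rewrite !sqrf_eq0.
Qed.
Lemma reCV z : reC z^-1 = reC z / (reC z ^+ 2 + imC z ^+ 2).
Proof. by case: z. Qed.
Lemma imCV z : imC z^-1 = - imC z / (reC z ^+ 2 + imC z ^+ 2).
Proof. by case: z => a b; rewrite mulNr. Qed.
End Cplx.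

Section RealDerive.
Context {R : realType} {E : normedModType R}.
Implicit Types (f g : E -> R) (v : E).

Lemma derive_addE f g v x : derivable f x v -> derivable g x v ->
  'D_v (fun y => f y + g y) x = 'D_v f x + 'D_v g x.
Proof. exact: deriveD. Qed.

Lemma derive_oppE f v x : derivable f x v -> 'D_v (fun y => - f y) x = - 'D_v f x.
Proof. exact: deriveN. Qed.

Lemma derive_mulE f g v x : derivable f x v -> derivable g x v ->
  'D_v (fun y => f y * g y) x = f x * 'D_v g x + g x * 'D_v f x.
Proof. exact: deriveM. Qed.

Lemma derivable_mulE f g v x : derivable f x v -> derivable g x v ->
  derivable (fun y => f y * g y) x v.
Proof. exact: derivableM. Qed.

Lemma derivable_oppE f v x : derivable f x v -> derivable (fun y => - f y) x v.
Proof. exact: derivableN. Qed.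

Lemma eq_derive f g v x : f =1 g -> 'D_v f x = 'D_v g x.
Proof. by move=> /funext ->. Qed.

End RealDerive.

(** * Smooth complex-valued functions *)

Section SmoothC.
Context {R : realType} {E : normedModType R}.
Local Notation C := (Cplx R).
Implicit Types (U V : set E) (f g : E -> C) (v : E).

(** [C] is normed over itself, not over [R], so a derivative along a real direction is taken on the
    two parts separately. *)
Definition Dc v f x : C :=
  mkC ('D_v (fun y => reC (f y)) x) ('D_v (fun y => imC (f y)) x).

Lemma reC_Dc v f x : reC (Dc v f x) = 'D_v (fun y => reC (f y)) x.
Proof. by []. Qed.

Lemma imC_Dc v f x : imC (Dc v f x) = 'D_v (fun y => imC (f y)) x.
Proof. by []. Qed.

Lemma smooth_sub U V f : V `<=` U -> smooth_on U f -> smooth_on V f.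
Proof. by move=> VU sf k; have [a b] := sf k; split; apply: Ck_sub VU _. Qed.

Lemma smooth_pt U f : (forall x, U x -> smooth_on [set x] f) -> smooth_on U f.
Proof. by move=> H k; split; apply: Ck_pt => x /H /(_ k)[]. Qed.

Lemma smooth_near x f g : {near x, f =1 g} -> smooth_on [set x] f ->
  smooth_on [set x] g.
Proof.
move=> fg sf k; have [a b] := sf k; split; [apply: Ck_near a|apply: Ck_near b];
  by apply: filterS fg => y ->.
Qed.

Lemma smooth_ext U f g : open U -> (forall x, U x -> f x = g x) ->
  smooth_on U f -> smooth_on U g.
Proof.
move=> oU fg sf k; have [a b] := sf k.
by split; [apply: Ck_ext oU _ a|apply: Ck_ext oU _ b] => x Ux; rewrite fg.
Qed.

Lemma smooth_eq U f g : f =1 g -> smooth_on U f -> smooth_on U g.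
Proof. by move=> /funext ->. Qed.

Lemma smooth_cst U (c : C) : smooth_on U (fun=> c).
Proof. by move=> k; split; exact: Ck_cst. Qed.

Lemma smooth_add U f g : open U -> smooth_on U f -> smooth_on U g ->
  smooth_on U (fun x => f x + g x).
Proof.
move=> oU sf sg k; have [a b] := sf k; have [c d] := sg k; split.
  by apply: Ck_ext oU _ (Ck_add oU a c) => x _; rewrite reCD.
by apply: Ck_ext oU _ (Ck_add oU b d) => x _; rewrite imCD.
Qed.

Lemma smooth_mul U f g : open U -> smooth_on U f -> smooth_on U g ->
  smooth_on U (fun x => f x * g x).
Proof.
move=> oU sf sg k; have [a b] := sf k; have [c d] := sg k; split.
  apply: Ck_ext oU _ (Ck_add oU (Ck_mul oU a c) (Ck_opp oU (Ck_mul oU b d))).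
  by move=> x _; rewrite reCM.
apply: Ck_ext oU _ (Ck_add oU (Ck_mul oU a d) (Ck_mul oU b c)).
by move=> x _; rewrite imCM.
Qed.

Lemma smooth_opp U f : open U -> smooth_on U f -> smooth_on U (fun x => - f x).
Proof.
move=> oU sf k; have [a b] := sf k; split.
  by apply: Ck_ext oU _ (Ck_opp oU a) => x _; rewrite reCN.
by apply: Ck_ext oU _ (Ck_opp oU b) => x _; rewrite imCN.
Qed.

Lemma smooth_conj U f : open U -> smooth_on U f ->
  smooth_on U (fun x => Num.conj (f x)).
Proof.
move=> oU sf k; have [a b] := sf k; split.
  by apply: Ck_ext oU _ a => x _; rewrite reC_conj.
by apply: Ck_ext oU _ (Ck_opp oU b) => x _; rewrite imC_conj.
Qed.

Lemma smooth_inv U f : open U -> (forall x, U x -> f x != 0) ->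
  smooth_on U f -> smooth_on U (fun x => (f x)^-1).
Proof.
move=> oU f0 sf k; have [a b] := sf k.
have n k' : Ck k' U (fun x => (reC (f x) ^+ 2 + imC (f x) ^+ 2)^-1).
  have [a' b'] := sf k'; apply: Ck_inv => //.
    by move=> x Ux; rewrite sqnormC_eq0 f0.
  by apply: Ck_add => //; apply: Ck_mul.
split.
  by apply: Ck_ext oU _ (Ck_mul oU a (n k)) => x _; rewrite reCV.
by apply: Ck_ext oU _ (Ck_mul oU (Ck_opp oU b) (n k)) => x _; rewrite imCV.
Qed.

Lemma smooth_sum U (I : Type) (r : seq I) (P : pred I) (F : I -> E -> C) :
  open U -> (forall i, P i -> smooth_on U (F i)) ->
  smooth_on U (fun x => \sum_(i <- r | P i) F i x).
Proof.
move=> oU sF; elim: r => [|i r IH].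
  by apply: smooth_eq (smooth_cst U _) => x; rewrite big_nil.
have [Pi|Pi] := boolP (P i).
  by apply: smooth_eq (smooth_add oU (sF i Pi) IH) => x; rewrite big_cons Pi.
by apply: smooth_eq IH => x; rewrite big_cons (negPf Pi).
Qed.

Lemma smooth_prod U (I : Type) (r : seq I) (P : pred I) (F : I -> E -> C) :
  open U -> (forall i, P i -> smooth_on U (F i)) ->
  smooth_on U (fun x => \prod_(i <- r | P i) F i x).
Proof.
move=> oU sF; elim: r => [|i r IH].
  by apply: smooth_eq (smooth_cst U _) => x; rewrite big_nil.
have [Pi|Pi] := boolP (P i).
  by apply: smooth_eq (smooth_mul oU (sF i Pi) IH) => x; rewrite big_cons Pi.
by apply: smooth_eq IH => x; rewrite big_cons (negPf Pi).
Qed.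

Lemma smooth_Dc U f v : smooth_on U f -> smooth_on U (Dc v f).
Proof. by move=> sf k; have [a b] := sf k.+1; split; exact: Ck_D. Qed.

Lemma smooth_derivable U f v x : smooth_on U f -> U x ->
  derivable (fun y => reC (f y)) x v /\ derivable (fun y => imC (f y)) x v.
Proof. by move=> /(_ 1)[a b] Ux; split; [exact: (Ck_derivable a Ux)|exact: (Ck_derivable b Ux)]. Qed.

Lemma Dc_ext x f g v : {near x, f =1 g} -> Dc v f x = Dc v g x.
Proof.
by move=> fg; rewrite /Dc; congr mkC; apply: near_eq_derive;
  apply: filterS fg => y ->.
Qed.

Lemma eq_Dc f g v x : f =1 g -> Dc v f x = Dc v g x.
Proof. by move=> /funext ->. Qed.

Lemma Dc_cst (c : C) v x : Dc v (fun=> c) x = 0.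
Proof. by rewrite /Dc !derive_cst. Qed.

Lemma Dc_add U f g v x : smooth_on U f -> smooth_on U g -> U x ->
  Dc v (fun y => f y + g y) x = Dc v f x + Dc v g x.
Proof.
move=> sf sg Ux; have [a b] := smooth_derivable v sf Ux.
have [c d] := smooth_derivable v sg Ux.
apply: Cplx_ext; rewrite ?reCD ?imCD [LHS]/=.
  by rewrite (eq_derive _ _ (fun y => reCD _ _)); exact: derive_addE.
by rewrite (eq_derive _ _ (fun y => imCD _ _)); exact: derive_addE.
Qed.

Lemma Dc_mul U f g v x : smooth_on U f -> smooth_on U g -> U x ->
  Dc v (fun y => f y * g y) x = Dc v f x * g x + f x * Dc v g x.
Proof.
move=> sf sg Ux; have [a b] := smooth_derivable v sf Ux.
have [c d] := smooth_derivable v sg Ux.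
have ac := derivable_mulE a c; have bd := derivable_mulE b d.
have ad := derivable_mulE a d; have bc := derivable_mulE b c.
apply: Cplx_ext; rewrite ?(reCD, reCM, imCD, imCM) [LHS]/=.
  rewrite (eq_derive _ _ (fun y => reCM _ _)).
  rewrite (derive_addE ac (derivable_oppE bd)) (derive_oppE bd).
  by rewrite (derive_mulE a c) (derive_mulE b d) !reC_Dc !imC_Dc; ring.
rewrite (eq_derive _ _ (fun y => imCM _ _)).
by rewrite (derive_addE ad bc) (derive_mulE a d) (derive_mulE b c) !reC_Dc !imC_Dc; ring.
Qed.

Lemma Dc_conj f v x : (exists2 U, smooth_on U f & U x) ->
  Dc v (fun y => Num.conj (f y)) x = Num.conj (Dc v f x).
Proof.
move=> [U sf Ux]; have [a b] := smooth_derivable v sf Ux.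
apply: Cplx_ext; rewrite ?reC_conj ?imC_conj.
  exact: (eq_derive _ _ (fun y => reC_conj _)).
rewrite [LHS](eq_derive _ _ (fun y => imC_conj _)); exact: derive_oppE.
Qed.

Lemma Dc_linear U f u v (a b : R) x : open U -> smooth_on U f -> U x ->
  Dc (a *: u + b *: v) f x = mkC a 0 * Dc u f x + mkC b 0 * Dc v f x.
Proof.
move=> oU /(_ 1)[c d] Ux.
apply: Cplx_ext.
  by rewrite reCD !reCM !reC_Dc (Ck_derive_add _ _ oU c Ux) !(Ck_derive_scale _ _ c Ux) /=; ring.
by rewrite imCD !imCM !imC_Dc (Ck_derive_add _ _ oU d Ux) !(Ck_derive_scale _ _ d Ux) /=; ring.
Qed.

Lemma DcC U f u v x : open U -> smooth_on U f -> U x ->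
  Dc u (Dc v f) x = Dc v (Dc u f) x.
Proof.
move=> oU /(_ 2)[c d] Ux; apply: Cplx_ext.
  exact: (Ck_deriveC u v oU c Ux).
exact: (Ck_deriveC u v oU d Ux).
Qed.

End SmoothC.

(** * Smooth matrix-valued functions *)

Section SmoothMx.
Context {R : realType} {E : normedModType R}.
Local Notation C := (Cplx R).
Implicit Types (U : set E).

Definition smooth_mx m k U (F : E -> 'M[C]_(m, k)) :=
  forall a b, smooth_on U (fun x => F x a b).

Definition Dmx m k v (F : E -> 'M[C]_(m, k)) x : 'M[C]_(m, k) :=
  \matrix_(a, b) Dc v (fun y => F y a b) x.

Lemma smooth_mx_cst m k U (A : 'M[C]_(m, k)) : smooth_mx U (fun=> A).
Proof. by move=> a b; exact: smooth_cst. Qed.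

Lemma smooth_mx_sub m k U V (F : E -> 'M[C]_(m, k)) : V `<=` U ->
  smooth_mx U F -> smooth_mx V F.
Proof. by move=> VU sF a b; apply: smooth_sub VU _. Qed.

Lemma smooth_mx_ext m k U (F G : E -> 'M[C]_(m, k)) : open U ->
  (forall x, U x -> F x = G x) -> smooth_mx U F -> smooth_mx U G.
Proof. by move=> oU FG sF a b; apply: smooth_ext (sF a b) => // x /FG ->. Qed.

Lemma smooth_mx_mul m k l U (F : E -> 'M[C]_(m, k)) (G : E -> 'M[C]_(k, l)) :
  open U -> smooth_mx U F -> smooth_mx U G -> smooth_mx U (fun x => F x *m G x).
Proof.
move=> oU sF sG a b.
apply: (@smooth_eq _ _ _ (fun x => \sum_j F x a j * G x j b)) => [x|].
  by rewrite mxE.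
by apply: smooth_sum => // i _; exact: smooth_mul.
Qed.

Lemma smooth_mx_add m k U (F G : E -> 'M[C]_(m, k)) :
  open U -> smooth_mx U F -> smooth_mx U G -> smooth_mx U (fun x => F x + G x).
Proof.
by move=> oU sF sG a b; apply: smooth_eq (smooth_add oU (sF a b) (sG a b)) => x; rewrite mxE.
Qed.

Lemma smooth_mx_opp m k U (F : E -> 'M[C]_(m, k)) :
  open U -> smooth_mx U F -> smooth_mx U (fun x => - F x).
Proof. by move=> oU sF a b; apply: smooth_eq (smooth_opp oU (sF a b)) => x; rewrite mxE. Qed.

Lemma smooth_mx_scale m k U (f : E -> C) (F : E -> 'M[C]_(m, k)) :
  open U -> smooth_on U f -> smooth_mx U F -> smooth_mx U (fun x => f x *: F x).
Proof. by move=> oU sf sF a b; apply: smooth_eq (smooth_mul oU sf (sF a b)) => x; rewrite mxE. Qed.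

Lemma smooth_mx_sum m k U (I : Type) (r : seq I) (P : pred I)
    (F : I -> E -> 'M[C]_(m, k)) :
  open U -> (forall i, P i -> smooth_mx U (F i)) ->
  smooth_mx U (fun x => \sum_(i <- r | P i) F i x).
Proof.
move=> oU sF a b.
apply: (@smooth_eq _ _ _ (fun x => \sum_(i <- r | P i) F i x a b)) => [x|].
  by rewrite summxE.
by apply: smooth_sum => // i Pi; exact: sF.
Qed.

Lemma smooth_mx_conj m k U (F : E -> 'M[C]_(m, k)) :
  open U -> smooth_mx U F -> smooth_mx U (fun x => map_mx Num.conj (F x)).
Proof. by move=> oU sF a b; apply: smooth_eq (smooth_conj oU (sF a b)) => x; rewrite mxE. Qed.

Lemma smooth_mx_tr m k U (F : E -> 'M[C]_(m, k)) :
  smooth_mx U F -> smooth_mx U (fun x => (F x)^T).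
Proof. by move=> sF a b; apply: smooth_eq (sF b a) => x; rewrite mxE. Qed.

Lemma smooth_mx_adj m k U (F : E -> 'M[C]_(m, k)) :
  open U -> smooth_mx U F -> smooth_mx U (fun x => (F x)^t* ).
Proof. by move=> oU sF; apply: smooth_mx_conj => //; exact: smooth_mx_tr. Qed.

Lemma smooth_det m U (F : E -> 'M[C]_m) :
  open U -> smooth_mx U F -> smooth_on U (fun x => \det (F x)).
Proof.
move=> oU sF; rewrite /determinant; apply: smooth_sum => // s _.
by apply: smooth_mul => //; [exact: smooth_cst|exact: smooth_prod].
Qed.

Lemma smooth_invmx m U (F : E -> 'M[C]_m) : open U ->
  (forall x, U x -> F x \in unitmx) -> smooth_mx U F ->
  smooth_mx U (fun x => invmx (F x)).
Proof.
move=> oU uF sF; apply: (@smooth_mx_ext _ _ _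
    (fun x => (\det (F x))^-1 *: \adj (F x))) => //.
  by move=> x Ux; rewrite /invmx uF.
apply: smooth_mx_scale => //.
  by apply: smooth_inv => //; exact: smooth_det.
move=> a b; apply: (@smooth_eq _ _ _ (fun x => (-1) ^+ (b + a) *
    \det (row' b (col' a (F x))))) => [x|]; first by rewrite mxE.
apply: smooth_mul => //; first exact: smooth_cst.
apply: smooth_det => // i j.
by apply: smooth_eq (sF (lift b i) (lift a j)) => x; rewrite !mxE.
Qed.

Lemma Dmx_ext m k x (F G : E -> 'M[C]_(m, k)) v : {near x, F =1 G} ->
  Dmx v F x = Dmx v G x.
Proof.
move=> FG; apply/matrixP => a b; rewrite !mxE; apply: Dc_ext.
by apply: filterS FG => y ->.
Qed.

Lemma Dmx_add m k U (F G : E -> 'M[C]_(m, k)) v x : smooth_mx U F ->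
  smooth_mx U G -> U x -> Dmx v (fun y => F y + G y) x = Dmx v F x + Dmx v G x.
Proof.
move=> sF sG Ux; apply/matrixP => a b; rewrite !mxE -(Dc_add _ _ _ Ux) //.
by apply: eq_Dc => y; rewrite mxE.
Qed.

Lemma Dmx_cst m k (A : 'M[C]_(m, k)) v x : Dmx v (fun=> A) x = 0.
Proof. by apply/matrixP => a b; rewrite !mxE Dc_cst. Qed.

Lemma Dc_sum U (I : Type) (r : seq I) (F : I -> E -> C) v x : open U ->
  (forall i, smooth_on U (F i)) -> U x ->
  Dc v (fun y => \sum_(i <- r) F i y) x = \sum_(i <- r) Dc v (F i) x.
Proof.
move=> oU sF Ux; elim: r => [|i r IH].
  by rewrite big_nil (eq_Dc _ _ (fun y => big_nil _ _ _ _)) Dc_cst.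
rewrite big_cons -IH -(Dc_add _ (sF i) _ Ux); last exact: smooth_sum.
by apply: eq_Dc => y; rewrite big_cons.
Qed.

Lemma Dmx_mul m k l U (F : E -> 'M[C]_(m, k)) (G : E -> 'M[C]_(k, l)) v x :
  open U -> smooth_mx U F -> smooth_mx U G -> U x ->
  Dmx v (fun y => F y *m G y) x = Dmx v F x *m G x + F x *m Dmx v G x.
Proof.
move=> oU sF sG Ux; apply/matrixP => a b; rewrite !mxE -big_split /=.
under [RHS]eq_bigr => i _ do rewrite !mxE -(Dc_mul _ (sF a i) (sG i b) Ux).
rewrite -(Dc_sum _ _ oU _ Ux); last by move=> i; exact: smooth_mul.
by apply: eq_Dc => y; rewrite mxE.
Qed.

Lemma Dmx_tr m k (F : E -> 'M[C]_(m, k)) v x :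
  Dmx v (fun y => (F y)^T) x = (Dmx v F x)^T.
Proof.
by apply/matrixP => a b; rewrite !mxE; apply: eq_Dc => y; rewrite mxE.
Qed.

Lemma Dmx_conj m k U (F : E -> 'M[C]_(m, k)) v x : smooth_mx U F -> U x ->
  Dmx v (fun y => map_mx Num.conj (F y)) x = map_mx Num.conj (Dmx v F x).
Proof.
move=> sF Ux; apply/matrixP => a b; rewrite !mxE -Dc_conj; last by exists U.
by apply: eq_Dc => y; rewrite mxE.
Qed.

End SmoothMx.

Section Affine.
Context {R : realType} {E : normedModType R}.
Implicit Types (U : set E) (f : E -> R) (x v : E).

Lemma is_derive_affine f x v (l : R) :
  (forall h : R, f (h *: v + x) - f x = h * l) -> is_derive x v f l.
Proof.
move=> fl; have H : h^-1 *: ((f \o shift x) (h *: v) - f x) @[h --> 0^'] --> l.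
  apply: cvg_near_cst; near=> h.
  by rewrite /= fl /GRing.scale /= mulKf //; near: h; exact: nbhs_dnbhs_neq.
by apply: DeriveDef; [apply/cvg_ex; exists l|exact: cvg_lim].
Unshelve. all: by end_near. Qed.

Lemma Ck_affine k U f (l : E -> R) :
  continuous f -> (forall x v (h : R), f (h *: v + x) - f x = h * l v) -> Ck k U f.
Proof.
move=> cf fl; case: k => [|k] /=; first by split=> // x _; exact: cf.
split=> [x _|v]; first exact: cf.
have D x : is_derive x v f (l v) by exact: is_derive_affine.
split; first by move=> x _; have [] := D x.
have -> : 'D_v f = fun=> l v by apply/funext => x; have [_ ->] := D x.
exact: Ck_cst.
Qed.

End Affine.

(** * Holomorphic functions of one variable *)

Section Holomorphic.
Context {R : realType}.
Local Notation C := (Cplx R).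
Local Notation P := (R * R)%type.
Implicit Types (U V : set P) (f g : P -> C) (x a v : P).

(** The norm of [C] takes its values in [C]; estimates over [R] need a real-valued modulus. *)
Definition cabs (z : C) : R := Num.sqrt (reC z ^+ 2 + imC z ^+ 2).

Lemma cabs_ge0 z : 0 <= cabs z. Proof. exact: sqrtr_ge0. Qed.
Lemma cabsE z : cabs z = Normc.normc z. Proof. by case: z. Qed.
Lemma cabs0 : cabs 0 = 0. Proof. by rewrite cabsE Normc.normc0. Qed.
Lemma cabs1 : cabs 1 = 1. Proof. by rewrite cabsE Normc.normc1. Qed.
Lemma cabsM z w : cabs (z * w) = cabs z * cabs w.
Proof. by rewrite !cabsE Normc.normcM. Qed.
Lemma cabsV z : cabs z^-1 = (cabs z)^-1. Proof. by rewrite !cabsE Normc.normcV. Qed.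
Lemma cabsX z n : cabs (z ^+ n) = cabs z ^+ n.
Proof. by elim: n => [|n IH]; rewrite ?cabs1 // !exprS cabsM IH. Qed.
Lemma cabsN z : cabs (- z) = cabs z. Proof. by rewrite /cabs reCN imCN !sqrrN. Qed.
Lemma cabsD z w : cabs (z + w) <= cabs z + cabs w. Proof. by rewrite !cabsE le_normcD. Qed.
Lemma cabs_eq0 z : (cabs z == 0) = (z == 0).
Proof. by rewrite sqrtr_eq0 le_eqVlt ltNge addr_ge0 ?sqr_ge0 // orbF sqnormC_eq0. Qed.
Lemma cabs_re z : `|reC z| <= cabs z.
Proof. by rewrite -sqrtr_sqr ler_wsqrtr // lerDl sqr_ge0. Qed.
Lemma cabs_im z : `|imC z| <= cabs z.
Proof. by rewrite -sqrtr_sqr ler_wsqrtr // lerDr sqr_ge0. Qed.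
Lemma cabs_le z : cabs z <= `|reC z| + `|imC z|.
Proof.
rewrite -(ler_pXn2r (n := 2)) ?nnegrE ?cabs_ge0 ?addr_ge0 //.
rewrite sqr_sqrtr ?addr_ge0 ?sqr_ge0 // sqrrD !real_normK ?num_real //.
by rewrite lerD2r lerDl mulrn_wge0 // mulr_ge0.
Qed.
Lemma cabs_sqr z : cabs z ^+ 2 = reC z ^+ 2 + imC z ^+ 2.
Proof. by rewrite sqr_sqrtr // addr_ge0 ?sqr_ge0. Qed.

Definition ex : P := (1, 0).
Definition ey : P := (0, 1).
Definition iC : C := mkC 0 1.

(** Smoothness is part of the definition, since the functions to which it is applied are known to be
    smooth. The complex differentiability of [holo_fun] concerns only generating subbundles and
    their spanning sets, and the two notions never meet. *)
Definition holR U f := smooth_on U f /\ forall x, U x -> Dc ey f x = iC * Dc ex f x.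

Definition zeta a x : C := mkC (x.1 - a.1) (x.2 - a.2).

Lemma iC2 : iC * iC = -1.
Proof. by apply: Cplx_ext; rewrite ?reCM ?imCM /=; ring. Qed.

Lemma holR_sub U V f : V `<=` U -> holR U f -> holR V f.
Proof. by move=> VU [sf cf]; split; [exact: smooth_sub sf|move=> x /VU/cf]. Qed.

Lemma holR_ext U f g : open U -> (forall x, U x -> f x = g x) -> holR U f -> holR U g.
Proof.
move=> oU fg [sf cf]; split; first exact: smooth_ext sf.
move=> x Ux; have n : {near x, f =1 g}.
  by have := open_near oU Ux; apply: filterS => y; exact: fg.
by rewrite -!(Dc_ext _ n) cf.
Qed.

Lemma holR_cst U c : holR U (fun=> c).
Proof. by split; [exact: smooth_cst|move=> x _; rewrite !Dc_cst mulr0]. Qed.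

Lemma holR_add U f g : open U -> holR U f -> holR U g -> holR U (fun x => f x + g x).
Proof.
move=> oU [sf cf] [sg cg]; split; first exact: smooth_add.
by move=> x Ux; rewrite !(Dc_add _ sf sg Ux) cf // cg // mulrDr.
Qed.

Lemma holR_mul U f g : open U -> holR U f -> holR U g -> holR U (fun x => f x * g x).
Proof.
move=> oU [sf cf] [sg cg]; split; first exact: smooth_mul.
move=> x Ux; rewrite !(Dc_mul _ sf sg Ux) cf // cg // mulrDr; congr (_ + _).
  by rewrite mulrA.
by rewrite mulrCA.
Qed.

Lemma holR_sum U (I : Type) (r : seq I) (F : I -> P -> C) : open U ->
  (forall i, holR U (F i)) -> holR U (fun x => \sum_(i <- r) F i x).
Proof.
move=> oU hF; split; first by apply: smooth_sum => // i _; have [] := hF i.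
move=> x Ux; rewrite !(Dc_sum _ _ oU _ Ux) ?mulr_sumr; try by move=> i; have [] := hF i.
by apply: eq_bigr => i _; have [_ ->] := hF i.
Qed.

Lemma holR_exp U f n : open U -> holR U f -> holR U (fun x => f x ^+ n).
Proof.
move=> oU hf; elim: n => [|n IH]; first exact: holR_cst.
by apply: holR_ext oU _ (holR_mul oU hf IH) => x _; rewrite exprS.
Qed.

Lemma holR_opp U f : open U -> holR U f -> holR U (fun x => - f x).
Proof.
move=> oU hf; apply: holR_ext oU _ (holR_mul oU (holR_cst U (-1)) hf) => x _.
by rewrite mulN1r.
Qed.

Lemma holR_inv U f : open U -> (forall x, U x -> f x != 0) -> holR U f ->
  holR U (fun x => (f x)^-1).
Proof.
move=> oU f0 [sf cf]; have si := smooth_inv oU f0 sf; split => // x Ux.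
have D v : Dc v (fun x => (f x)^-1) x = - (f x)^-1 * (Dc v f x * (f x)^-1).
  have : Dc v (fun y => f y * (f y)^-1) x = 0.
    rewrite -(Dc_cst 1 v x); apply: Dc_ext; have := open_near oU Ux.
    by apply: filterS => y /f0 fy; rewrite divff.
  rewrite (Dc_mul _ sf si Ux) => /eqP; rewrite addrC addr_eq0 => /eqP E.
  by rewrite mulNr -mulrN -E mulKf // f0.
by rewrite !D cf // -!mulrA mulrCA.
Qed.

(** The Cauchy-Riemann equation makes the real differential complex linear, so the derivative along
    [ex] plays the part of the complex derivative. *)
Lemma holR_D U f x v : open U -> holR U f -> U x ->
  Dc v f x = mkC v.1 v.2 * Dc ex f x.
Proof.
move=> oU [sf cf] Ux; have {1}-> : v = v.1 *: ex + v.2 *: ey.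
  case: v => v1 v2; apply/pair_eqP => /=.
  by rewrite /GRing.scale /= !mulr1 !mulr0 addr0 add0r !eqxx.
rewrite (Dc_linear _ _ _ _ oU sf Ux) cf // mulrA -mulrDl; congr (_ * _).
by apply: Cplx_ext; rewrite ?(reCD, reCM, imCD, imCM) /=; ring.
Qed.

Lemma holR_Dc U f : open U -> holR U f -> holR U (Dc ex f).
Proof.
move=> oU hf; have [sf cf] := hf; split; first exact: smooth_Dc.
move=> x Ux; rewrite (DcC _ _ oU sf Ux) -[in RHS](mul1r (Dc ex _ x)).
have s1 := smooth_Dc ex sf.
rewrite (@Dc_ext _ _ x (Dc ey f) (fun y => iC * Dc ex f y)); last first.
  by have := open_near oU Ux; apply: filterS => y /cf.
by rewrite (Dc_mul _ (smooth_cst U _) s1 Ux) Dc_cst mul0r add0r mul1r.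
Qed.

Lemma Dc_zeta a v x : Dc v (zeta a) x = mkC v.1 v.2.
Proof.
apply: Cplx_ext; rewrite ?reC_Dc ?imC_Dc.
  have [_ ->//] : is_derive x v (fun y : P => reC (zeta a y)) v.1.
  by apply: is_derive_affine => h /=; rewrite /GRing.scale /=; ring.
have [_ ->//] : is_derive x v (fun y : P => imC (zeta a y)) v.2.
by apply: is_derive_affine => h /=; rewrite /GRing.scale /=; ring.
Qed.

Lemma holR_zeta U a : holR U (zeta a).
Proof.
split; last first.
  by move=> x _; rewrite !Dc_zeta; apply: Cplx_ext; rewrite ?reCM ?imCM /=; ring.
move=> k; split.
  apply: (@Ck_affine _ _ _ _ _ (fun v => v.1)) => [x|x v h] /=; last by rewrite /GRing.scale /=; ring.
  by apply: cvgB; [exact: cvg_fst|exact: cvg_cst].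
apply: (@Ck_affine _ _ _ _ _ (fun v => v.2)) => [x|x v h] /=; last by rewrite /GRing.scale /=; ring.
by apply: cvgB; [exact: cvg_snd|exact: cvg_cst].
Qed.

Lemma Dc_zetaX a n v x : Dc v (fun y => zeta a y ^+ n) x =
  n%:R * zeta a x ^+ n.-1 * mkC v.1 v.2.
Proof.
elim: n => [|n IH]; first by rewrite (Dc_cst 1) !mul0r.
have [sz _] := holR_zeta setT a; have [sn _] := holR_exp n openT (holR_zeta setT a).
rewrite (eq_Dc _ _ (fun y => exprS _ _)) (Dc_mul _ sz sn (I : setT x)) Dc_zeta IH.
case: n {IH sn} => [|n] /=; first by rewrite !expr0 !mul0r mulr0 addr0 !mul1r mulr1.
by rewrite -(natr1 n.+1) exprS; ring.
Qed.

Lemma cabs_zeta a x : cabs (zeta a x) <= `|x - a| *+ 2.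
Proof.
apply: (le_trans (cabs_le _)); rewrite mulr2n /=.
by apply: lerD; rewrite /Num.norm /= le_max lexx ?orbT.
Qed.

Lemma zeta_eq0 a x : (zeta a x == 0) = (x == a).
Proof.
case: a x => a1 a2 [x1 x2]; rewrite /zeta eq_complex /= !subr_eq0.
by rewrite xpair_eqE.
Qed.

End Holomorphic.

Section Quadratic.
Context {R : realType} {E : normedModType R}.
Implicit Types (f : E -> R) (a v : E).

(** Serves at a point where a quotient is defined by its limit value, so that no rule of
    differentiation applies. *)
Lemma is_derive_quad f a v (l C : R) :
  (\forall t \near (0 : R), `|f (t *: v + a) - f a - t * l| <= C * t ^+ 2) ->
  is_derive a v f l.
Proof.
move=> fl; have H : h^-1 *: ((f \o shift a) (h *: v) - f a) @[h --> 0^'] --> l.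
  apply/cvgrPdist_le => e e0; near=> h.
  have h0 : h != 0 by near: h; exact: nbhs_dnbhs_neq.
  have -> : l - h^-1 *: ((f \o shift a) (h *: v) - f a) =
      - (h^-1 * (f (h *: v + a) - f a - h * l)).
    by rewrite [_ * (_ - h * l)]mulrBr mulKf // opprB.
  rewrite normrN normrM normfV ler_pdivrMl ?normr_gt0 //.
  apply: (@le_trans _ _ (C * h ^+ 2)); first by near: h; exact: cvg_within fl.
  rewrite -real_normK ?num_real // expr2 mulrCA ler_wpM2l //.
  apply: (@le_trans _ _ ((`|C| + 1) * `|h|)).
    by rewrite ler_wpM2r // (le_trans (ler_norm _)) // lerDl.
  rewrite -ler_pdivlMl ?ltr_wpDl //; near: h; apply: dnbhs0_le.
  by rewrite mulr_gt0 ?invr_gt0 ?ltr_wpDl.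
by apply: DeriveDef; [apply/cvg_ex; exists l|exact: cvg_lim].
Unshelve. all: by end_near. Qed.

Lemma continuous_lip f a (C : R) : (\forall x \near a, `|f x - f a| <= C * `|x - a|) ->
  {for a, continuous f}.
Proof.
move=> fl; apply/cvgrPdist_le => e e0; near=> x.
rewrite distrC; apply: (@le_trans _ _ (C * `|x - a|)); first by near: x.
apply: (@le_trans _ _ ((`|C| + 1) * `|x - a|)).
  by rewrite ler_wpM2r // (le_trans (ler_norm _)) // lerDl.
rewrite -ler_pdivlMl ?ltr_wpDl // distrC; near: x; apply: cvgr_dist_le => //.
by rewrite mulr_gt0 ?invr_gt0 ?ltr_wpDl.
Unshelve. all: by end_near. Qed.

Lemma near_star (Q : set E) a : nbhs a Q ->
  \forall x \near a, forall s : R, 0 <= s <= 1 -> Q (a + s *: (x - a)).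
Proof.
move=> /nbhs_ballP[e /= e0 aQ]; apply/nbhs_ballP; exists e => // x ax s /andP[s0 s1].
apply: aQ; move: ax; rewrite -!ball_normE /ball_ /= opprD addNKr normrN normrZ distrC.
apply: le_lt_trans; rewrite ger0_norm //; exact: ler_piMl.
Qed.

End Quadratic.

Lemma reC_natr (R : realType) n : reC (n%:R : Cplx R) = n%:R.
Proof. by elim: n => [|n IH] //; rewrite -!natr1 reCD IH. Qed.

Lemma imC_natr (R : realType) n : imC (n%:R : Cplx R) = 0.
Proof. by elim: n => [|n IH] //; rewrite -!natr1 imCD IH addr0. Qed.

(** * Taylor quotients at a point *)

Section Taylor.
Context {R : realType}.
Local Notation C := (Cplx R).
Local Notation P := (R * R)%type.
Variables (U : set P) (a : P).
Hypotheses (oU : open U) (Ua : U a).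
Implicit Types (f : P -> C) (x v : P).
Local Notation z := (zeta a).
Local Notation D := (Dc ex).

(** The factor 2 comes from applying the mean value theorem to the real and to the imaginary part
    separately. *)
Lemma holR_mv f x (M : R) : holR U f ->
  (forall s : R, 0 <= s <= 1 -> U (a + s *: (x - a)) /\
     cabs (D f (a + s *: (x - a))) <= M) ->
  cabs (f x - f a) <= M * cabs (z x) *+ 2.
Proof.
move=> hf H.
have E y : U y -> cabs (D f y) <= M -> cabs (Dc (x - a) f y) <= M * cabs (z x).
  by move=> Uy yM; rewrite (holR_D _ oU hf Uy) cabsM mulrC ler_wpM2r ?cabs_ge0.
have [sf _] := hf.
have e : a + 1 *: (x - a) = x by rewrite scale1r addrC subrK.
apply: (le_trans (cabs_le _)); rewrite mulr2n; apply: lerD.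
  have [s /H[Us _]|s /andP[s0 s1]] := @MVT_line _ _ (fun y => reC (f y)) a (x - a) 1 ltr01.
    exact: (smooth_derivable _ sf Us).1.
  have /H[Us Ms] : 0 <= s <= 1 by rewrite !ltW.
  rewrite e mul1r reCD reCN => ->; rewrite -reC_Dc.
  exact: le_trans (cabs_re _) (E _ Us Ms).
have [s /H[Us _]|s /andP[s0 s1]] := @MVT_line _ _ (fun y => imC (f y)) a (x - a) 1 ltr01.
  exact: (smooth_derivable _ sf Us).2.
have /H[Us Ms] : 0 <= s <= 1 by rewrite !ltW.
rewrite e mul1r imCD imCN => ->; rewrite -imC_Dc.
exact: le_trans (cabs_im _) (E _ Us Ms).
Qed.

Definition tc f k : C := iter k D f a / k`!%:R.

Definition tpoly m f x : C := \sum_(k < m) tc f k * z x ^+ k.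

Lemma tc_D f k : tc (D f) k = k.+1%:R * tc f k.+1.
Proof.
rewrite /tc -iterSr factS natrM invfM mulrCA; congr (_ * _).
by rewrite mulrA divff ?mul1r // pnatr_eq0.
Qed.

Lemma tpolyS m f x : tpoly m.+1 f x = tpoly m f x + tc f m * z x ^+ m.
Proof. by rewrite /tpoly big_ord_recr. Qed.

Lemma holR_tpoly m f : holR U (tpoly m f).
Proof.
apply: holR_sum => // k; apply: holR_mul => //; first exact: holR_cst.
by apply: holR_exp => //; exact: holR_zeta.
Qed.

Lemma D_tpoly m f v x : Dc v (tpoly m f) x = mkC v.1 v.2 * tpoly m.-1 (D f) x.
Proof.
have hz k : smooth_on setT (fun y => z y ^+ k).
  by have [] := holR_exp k openT (holR_zeta setT a).
elim: m => [|m IH].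
  rewrite (eq_Dc (g := fun=> 0)) ?Dc_cst.
    by rewrite /tpoly big_ord0 mulr0.
  by move=> y; rewrite /tpoly big_ord0.
rewrite (eq_Dc _ _ (tpolyS m f)).
have st : smooth_on setT (tpoly m f).
  apply: smooth_sum; first exact: openT.
  by move=> k _; apply: smooth_mul (smooth_cst _ _) (hz _); exact: openT.
have sm : smooth_on setT (fun y => tc f m * z y ^+ m).
  by apply: smooth_mul (smooth_cst _ _) (hz _); exact: openT.
rewrite (Dc_add _ st sm (I : setT x)) IH.
rewrite (Dc_mul _ (smooth_cst _ _) (hz _) (I : setT x)) Dc_cst mul0r add0r Dc_zetaX.
case: m {IH st sm} => [|m]; first by rewrite !mul0r mulr0 addr0.
by rewrite [m.+2.-1]/= tpolyS tc_D /=; ring.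
Qed.

Lemma near_bounded f : holR U f -> exists2 K : R, 0 <= K & \forall x \near a, cabs (f x) <= K.
Proof.
move=> [/(_ 0)[cr ci] _].
have c1 := continuous_dist_le (Ck_cont cr Ua) ltr01.
have c2 := continuous_dist_le (Ck_cont ci Ua) ltr01.
exists (`|reC (f a)| + 1 + (`|imC (f a)| + 1)); first by rewrite !addr_ge0.
apply: filterS2 c1 c2 => x h1 h2; apply: (le_trans (cabs_le _)); apply: lerD.
  by rewrite -lerBlDl (le_trans (lerB_dist _ _)) // distrC.
by rewrite -lerBlDl (le_trans (lerB_dist _ _)) // distrC.
Qed.

(** The derivative of the remainder of order [m.+1] is the remainder of order [m] of the derivative;
    the mean value inequality on the segment from [a] integrates the bound. *)
Lemma taylor_bound m f : holR U f -> exists2 K : R, 0 <= K &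
  \forall x \near a, cabs (f x - tpoly m f x) <= K * cabs (z x) ^+ m.
Proof.
elim: m f => [|m IH] f hf.
  have [K K0 HK] := near_bounded hf; exists K => //.
  by apply: filterS HK => x; rewrite /tpoly big_ord0 subr0 mulr1.
have [K K0 HK] := IH _ (holR_Dc oU hf).
have [sf _] := hf; have [st _] := holR_tpoly m.+1 f.
have hg : holR U (fun x => f x - tpoly m.+1 f x).
  by apply: holR_add => //; apply: holR_opp => //; exact: holR_tpoly.
have Dg y : U y -> D (fun x => f x - tpoly m.+1 f x) y = D f y - tpoly m (D f) y.
  move=> Uy; rewrite (Dc_add _ sf (smooth_opp oU st) Uy); congr (_ + _).
  rewrite (eq_Dc _ _ (fun y => esym (mulN1r _))).
  rewrite (Dc_mul _ (smooth_cst _ _) st Uy) Dc_cst mul0r add0r mulN1r D_tpoly.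
  by congr (- _); rewrite (_ : mkC _ _ = 1) // mul1r.
exists (K *+ 2); first by rewrite mulrn_wge0.
have QN : \forall y \near a, U y /\ cabs (D f y - tpoly m (D f) y) <= K * cabs (z y) ^+ m.
  exact: filterI (open_near oU Ua) HK.
have N := near_star QN.
apply: filterS N => x Hx.
have -> : f x - tpoly m.+1 f x = f x - tpoly m.+1 f x - (f a - tpoly m.+1 f a).
  have -> : tpoly m.+1 f a = f a.
    rewrite /tpoly big_ord_recl big1 => [|i _].
      by rewrite /tc /= fact0 invr1 !mulr1 addr0.
    by rewrite /z !subrr exprS mul0r mulr0.
  by rewrite subrr subr0.
rewrite (_ : K *+ 2 * _ = (K * cabs (z x) ^+ m) * cabs (z x) *+ 2); last first.
  by rewrite mulrnAl exprSr mulrA.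
apply: (holR_mv hg) => s s01; have [Us Ks] := Hx s s01; split => //.
rewrite Dg //; apply: (le_trans Ks); rewrite ler_wpM2l // lerXn2r ?nnegrE ?cabs_ge0 //.
have -> : z (a + s *: (x - a)) = mkC s 0 * z x.
  by apply: Cplx_ext; rewrite ?reCM ?imCM /= /GRing.scale /=; ring.
rewrite cabsM; case/andP: s01 => s0 s1; rewrite ler_piMl ?cabs_ge0 //.
by rewrite /cabs /= expr0n addr0 sqrtr_sqr ger0_norm.
Qed.

(** The Taylor remainder divided by [z ^+ m], with its limit value at [a]. When the first [m]
    coefficients vanish it is [f] divided by [z ^+ m]. *)
Definition tquot m f x : C := if x == a then tc f m else (f x - tpoly m f x) / z x ^+ m.

Lemma tquot_mul m f x : tquot m f x * z x ^+ m = f x - tpoly m f x \/ x = a.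
Proof.
rewrite /tquot; case: eqP => [->|/eqP xa]; [by right|left].
by rewrite mulfVK // expf_neq0 // zeta_eq0.
Qed.

(** The Taylor estimate is used two orders further, so that the error is quadratic and yields the
    derivative of the quotient at [a]. *)
Lemma tquot_bound m f : holR U f -> exists2 K : R, 0 <= K & \forall x \near a,
  cabs (tquot m f x - tc f m - tc f m.+1 * z x) <= K * cabs (z x) ^+ 2.
Proof.
move=> hf; have [K K0 HK] := taylor_bound m.+2 hf; exists K => //.
apply: filterS HK => x; rewrite /tquot; case: eqP => [->|/eqP xa].
  by rewrite (_ : z a = 0) ?mulr0 ?subrr ?cabs0 ?expr0n ?mulr0 // /zeta !subrr.
have z0 : z x != 0 by rewrite zeta_eq0.
have zm0 : z x ^+ m != 0 by rewrite expf_neq0.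
rewrite !tpolyS => H.
have -> : (f x - tpoly m f x) / z x ^+ m - tc f m - tc f m.+1 * z x =
    (f x - (tpoly m f x + tc f m * z x ^+ m + tc f m.+1 * z x ^+ m.+1)) / z x ^+ m.
  by rewrite exprS; field.
rewrite cabsM cabsV cabsX ler_pdivrMr ?exprn_gt0 //.
  by apply: (le_trans H); rewrite -mulrA !exprS expr0 mulr1 !mulrA.
by rewrite lt0r cabs_ge0 cabs_eq0 z0.
Qed.

Let V := U `&` ~` [set a].

Let oV : open V.
Proof.
apply: openI => //; apply: closed_openC; apply: compact_closed => //.
exact: compact_set1.
Qed.

Let VU : V `<=` U. Proof. by move=> x []. Qed.

Let zV x : V x -> z x != 0.
Proof. by move=> [_ /= xa]; rewrite zeta_eq0; apply/eqP. Qed.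

Lemma holR_tquotV m f : holR U f -> holR V (tquot m f).
Proof.
move=> hf; have hV := holR_sub VU hf.
apply: (@holR_ext _ _ (fun x => (f x - tpoly m f x) * (z x ^+ m)^-1)) => //.
  by move=> x [_ /= xa]; rewrite /tquot; case: eqP.
apply: holR_mul => //.
  by apply: holR_add => //; apply: holR_opp => //; apply: holR_sub VU (holR_tpoly _ _).
apply: holR_inv => //; first by move=> x /zV; exact: expf_neq0.
by apply: holR_exp => //; exact: holR_zeta.
Qed.

Lemma tquot_a m f : tquot m f a = tc f m.
Proof. by rewrite /tquot eqxx. Qed.

Lemma zetaD x v (t : R) : z (t *: v + a) = mkC t 0 * mkC v.1 v.2.
Proof. by apply: Cplx_ext; rewrite ?reCM ?imCM /= /GRing.scale /=; ring. Qed.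

Lemma cabs_mkCr (t : R) : cabs (mkC t 0) = `|t|.
Proof. by rewrite /cabs /= expr0n addr0 sqrtr_sqr. Qed.

Lemma tquot_is_derive m f v : holR U f ->
  is_derive a v (fun x => reC (tquot m f x)) (reC (mkC v.1 v.2 * tc f m.+1)) /\
  is_derive a v (fun x => imC (tquot m f x)) (imC (mkC v.1 v.2 * tc f m.+1)).
Proof.
move=> hf; have [K K0 HK] := tquot_bound m hf.
have cl : (fun t : R => t *: v + a) @ (0 : R) --> a.
  have H : (fun t : R => t *: v + a) @ (0 : R) --> (0 : R) *: v + a.
    by apply: cvgD; [apply: cvgZr_tmp; exact: cvg_id|exact: cvg_cst].
  by rewrite scale0r add0r in H.
have B : \forall t \near (0 : R), cabs (tquot m f (t *: v + a) - tc f m -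
     mkC t 0 * (mkC v.1 v.2 * tc f m.+1)) <= K * cabs (mkC v.1 v.2) ^+ 2 * t ^+ 2.
  near=> t.
  have H : cabs (tquot m f (t *: v + a) - tc f m - tc f m.+1 * z (t *: v + a)) <=
      K * cabs (z (t *: v + a)) ^+ 2 by near: t; exact: (cl _ HK).
  rewrite zetaD // in H.
  rewrite [mkC v.1 v.2 * tc f _]mulrC [mkC t 0 * _]mulrCA; apply: (le_trans H).
  by rewrite cabsM cabs_mkCr exprMn real_normK ?num_real // [t ^+ 2 * _]mulrC mulrA.
split; apply: (@is_derive_quad _ _ _ _ _ _ (K * cabs (mkC v.1 v.2) ^+ 2));
    apply: filterS B => t; apply: le_trans; rewrite tquot_a.
  rewrite (_ : _ - _ - _ = reC (tquot m f (t *: v + a) - tc f m -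
     mkC t 0 * (mkC v.1 v.2 * tc f m.+1))) ?cabs_re //.
  by rewrite !(reCD, reCN) [reC (mkC t 0 * _)]reCM /= mul0r subr0.
rewrite (_ : _ - _ - _ = imC (tquot m f (t *: v + a) - tc f m -
   mkC t 0 * (mkC v.1 v.2 * tc f m.+1))) ?cabs_im //.
by rewrite !(imCD, imCN) [imC (mkC t 0 * _)]imCM /= mul0r addr0.
Unshelve. all: by end_near. Qed.

(** The derivative of a quotient is a combination of quotients, also at [a]. This closed formula
    allows smoothness to be proved by induction on the order of differentiation, for all [m] and [f]
    at once. *)
Lemma tquot_D m f v x : holR U f -> U x ->
  [/\ derivable (fun x => reC (tquot m f x)) x v,
     derivable (fun x => imC (tquot m f x)) x v &
     Dc v (tquot m f) x =
       mkC v.1 v.2 * (tquot m (D f) x - m%:R * tquot m.+1 f x)].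
Proof.
move=> hf Ux; have [->|/eqP xa] := eqVneq x a.
  have [dr di] := tquot_is_derive m v hf.
  split; [by case: dr|by case: di|].
  (* At [a] the right side is [m.+1 - m], that is 1, times [tc f m.+1]. *)
  rewrite !tquot_a tc_D -natr1 mulrDl mul1r addrC addrA addNr add0r.
  by apply: Cplx_ext; rewrite ?reC_Dc ?imC_Dc; [have [_ ->] := dr|have [_ ->] := di].
have Vx : V x by [].
have hq := holR_tquotV m hf; have [sq _] := hq.
have [dr di] := smooth_derivable v sq Vx; split => //.
rewrite (holR_D _ oV hq Vx); congr (_ * _).
have [sz _] := holR_exp m oV (holR_zeta V a).
have [sf _] := holR_sub VU hf; have [st _] := holR_sub VU (holR_tpoly m f).
have E1 : D (fun y => tquot m f y * z y ^+ m) x = D (fun y => f y + (-1) * tpoly m f y) x.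
  apply: Dc_ext; have := open_near oV Vx; apply: filterS => y Vy.
  by have [->|ya] := tquot_mul m f y; [rewrite mulN1r|case: Vy].
move: E1; rewrite (Dc_mul _ sq sz Vx) Dc_zetaX.
rewrite (Dc_add _ sf _ Vx); last by apply: smooth_mul => //; exact: smooth_cst.
rewrite (Dc_mul _ (smooth_cst _ _) st Vx) Dc_cst mul0r add0r mulN1r D_tpoly.
rewrite (_ : mkC ex.1 ex.2 = 1) // mul1r mulr1.
rewrite /tquot; case: eqP => // _; set q := D _ x => E1.
have z0 := zV Vx; have zm0 k : z x ^+ k != 0 by rewrite expf_neq0.
rewrite !tpolyS; move: E1; case: m {hq sq dr di sz st} q => [|m] q.
  by rewrite !expr0 !mul0r mulr0 addr0 mulr1 !divr1 subr0 => ->.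
rewrite /= !tpolyS tc_D -/z => E1.
have {E1} -> : q = (D f x - tpoly m (D f) x - (f x - (tpoly m f x + tc f m * z x ^+ m)) /
   z x ^+ m.+1 * (m.+1%:R * z x ^+ m)) / z x ^+ m.+1.
  by apply/eqP; rewrite eq_sym -[X in _ == X](mulfK (zm0 m.+1)) -E1; apply/eqP; congr (_ / _); ring.
rewrite !exprS; move: (z x ^+ m) (zm0 m) (m.+1%:R : C) => w w0 N.
by field; apply/andP.
Qed.

Lemma tquot_Ck k m f : holR U f ->
  Ck k U (fun x => reC (tquot m f x)) /\ Ck k U (fun x => imC (tquot m f x)).
Proof.
have ct h : (forall x, V x -> {for x, continuous h}) -> {for a, continuous h} ->
    forall x, U x -> {for x, continuous (h : P -> R)}.
  by move=> hV ha x Ux; have [->//|/eqP xa] := eqVneq x a; apply: hV.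
have cV m' f' : holR U f' -> 
   (forall x, U x -> {for x, continuous (fun x => reC (tquot m' f' x))}) /\
   (forall x, U x -> {for x, continuous (fun x => imC (tquot m' f' x))}).
  move=> hf; have [/(_ 0)[cr ci] _] := holR_tquotV m' hf.
  have [K K0 HK] := tquot_bound m' hf.
  have B : \forall x \near a, cabs (tquot m' f' x - tquot m' f' a) <=
     (cabs (tc f' m'.+1) *+ 2 + K *+ 4) * `|x - a|.
    have B1 : \forall x \near a, `|x - a| <= 1.
      by apply/nbhs_ballP; exists 1 => //= x; rewrite -ball_normE /ball_ /= distrC => /ltW.
    apply: filterS2 HK B1 => x Hx x1; rewrite tquot_a.
    rewrite (_ : _ - _ = tquot m' f' x - tc f' m' - tc f' m'.+1 * z x + tc f' m'.+1 * z x); last by rewrite subrK.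
    apply: (le_trans (cabsD _ _)); rewrite addrC mulrDl; apply: lerD.
      by rewrite cabsM mulrnAl -mulrnAr ler_wpM2l ?cabs_ge0 // cabs_zeta.
    apply: (le_trans Hx); rewrite mulrnAl -mulrnAr ler_wpM2l // expr2.
    apply: (@le_trans _ _ (`|x - a| *+ 2 * 2)).
      rewrite ler_pM ?cabs_ge0 ?cabs_zeta // (le_trans (cabs_zeta _ _)) //.
      by rewrite -[2]/(1 *+ 2) lerMn2r x1.
    by rewrite mulr_natr -mulrnA.
  split; apply: ct; try by move=> x Vx; apply: Ck_cont Vx; eassumption.
    apply: continuous_lip; apply: filterS B => x; apply: le_trans.
    by rewrite -reCN -reCD cabs_re.
  apply: continuous_lip; apply: filterS B => x; apply: le_trans.
  by rewrite -imCN -imCD cabs_im.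
elim: k m f => [|k IH] m f hf; have [c1 c2] := cV m f hf => /=; first by [].
have hD := holR_Dc oU hf.
have [r1 i1] := IH m _ hD; have [r2 i2] := IH m.+1 _ hf.
split; split => // v; split.
- by move=> x Ux; have [] := tquot_D m v hf Ux.
- apply: (@Ck_ext _ _ _ _ (fun x =>
      v.1 * (reC (tquot m (D f) x) + - m%:R * reC (tquot m.+1 f x)) +
     - v.2 * (imC (tquot m (D f) x) + - m%:R * imC (tquot m.+1 f x)))) => //.
    move=> x Ux; have [_ _ E] := tquot_D m v hf Ux.
    by rewrite -reC_Dc E reCM reCD imCD reCN imCN !(reCM, imCM) reC_natr imC_natr /=; ring.
  by repeat (apply: Ck_add || apply: Ck_mul || apply: Ck_cst).
- by move=> x Ux; have [] := tquot_D m v hf Ux.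
apply: (@Ck_ext _ _ _ _ (fun x =>
    v.1 * (imC (tquot m (D f) x) + - m%:R * imC (tquot m.+1 f x)) +
   v.2 * (reC (tquot m (D f) x) + - m%:R * reC (tquot m.+1 f x)))) => //.
  move=> x Ux; have [_ _ E] := tquot_D m v hf Ux.
  by rewrite -imC_Dc E imCM reCD imCD reCN imCN !(reCM, imCM) reC_natr imC_natr /=; ring.
by repeat (apply: Ck_add || apply: Ck_mul || apply: Ck_cst).
Qed.

Lemma holR_tquot m f : holR U f -> holR U (tquot m f).
Proof.
move=> hf; split; first by move=> k; exact: tquot_Ck.
move=> x Ux; have [_ _ ->] := tquot_D m ey hf Ux; have [_ _ ->] := tquot_D m ex hf Ux.
by rewrite (_ : mkC ex.1 ex.2 = 1) // mul1r.
Qed.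

End Taylor.

(** * The maximum principle on squares *)

Section MaxPrinciple.
Context {R : realType}.
Local Notation C := (Cplx R).
Local Notation P := (R * R)%type.
Implicit Types (U : set P) (f g : P -> C) (x a v : P).

(** A maximum kills the first derivative along [v]; a positive second derivative makes it positive
    just after [x], and the mean value theorem then produces larger values. *)
Lemma no_local_max (E : normedModType R) (U : set E) (f : E -> R) (x v : E) :
  open U -> U x -> Ck 2 U f -> 0 < 'D_v ('D_v f) x ->
  ~ (\forall y \near x, f y <= f x).
Proof.
move=> oU Ux Cf D2 mx.
have C1 := Ck_S Cf.
have le0 w : 'D_w f x <= 0.
  have H := derive_right (Ck_derivable C1 Ux : derivable f x w).
  have N := near_line2 w w mx.
  rewrite -(cvg_lim _ H) //; apply: limr_le; first by apply/cvg_ex; exists ('D_w f x).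
  near=> t; have t0 : 0 < t by near: t; exact: nbhs_right_gt.
  rewrite pmulr_rle0 ?invr_gt0 // subr_le0.
  have Q s s' : 0 <= s <= t -> 0 <= s' <= t -> f (x + s *: w + s' *: w) <= f x.
    by move: s s'; near: t; exact: N.
  have := Q t 0; rewrite scale0r addr0; apply; first by rewrite lexx ltW.
  by apply/andP; split; [|exact: ltW].
have Df0 : 'D_v f x = 0.
  apply/eqP; rewrite eq_le le0 /= -oppr_le0 -mulN1r -(Ck_derive_scale _ _ C1 Ux).
  exact: le0.
have H := derive_right (Ck_derivable (Ck_D v Cf) Ux : derivable ('D_v f) x v).
rewrite Df0 in H.
have [d /= d0 Hd] : \forall t \near (0 : R)^'+, 0 < 'D_v f (x + t *: v).
  have D2h : 'D_v ('D_v f) x / 2 < 'D_v ('D_v f) x.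
    by rewrite ltr_pdivrMr // ltr_pMr // ltr1n.
  have h2 : \forall t \near (0 : R)^'+,
      'D_v ('D_v f) x / 2 < t^-1 * ('D_v f (x + t *: v) - 0).
    exact: (cvgr_gt _ H).
  near=> t; have t0 : 0 < t by near: t; exact: nbhs_right_gt.
  have : 'D_v ('D_v f) x / 2 < t^-1 * ('D_v f (x + t *: v) - 0) by near: t.
  rewrite subr0 => /(lt_trans (divr_gt0 D2 (ltr0Sn _ 1))).
  by rewrite pmulr_rgt0 // invr_gt0.
have QN : \forall y \near x, U y /\ f y <= f x.
  exact: filterI (open_near oU Ux) mx.
have N := near_line2 v v QN.
have [t [t0 td Q]] : exists t, [/\ 0 < t, t < d & forall s s', 0 <= s <= t -> 0 <= s' <= t ->
    U (x + s *: v + s' *: v) /\ f (x + s *: v + s' *: v) <= f x].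
  near (0 : R)^'+ => t; exists t; split.
  - by near: t; exact: nbhs_right_gt.
  - by near: t; exact: nbhs_right_lt.
  - by near: t; exact: N.
have o0 : (0 : R) <= 0 <= t by apply/andP; split; [|exact: ltW].
have Q1 s : 0 <= s <= t -> U (x + s *: v) /\ f (x + s *: v) <= f x.
  by move=> st; have := Q s 0 st o0; rewrite scale0r addr0.
have [s st|s /andP[s0 st] E1] := @MVT_line _ _ f x v t t0.
  exact: Ck_derivable C1 (Q1 s st).1.
have := (Q1 t _).2; rewrite lexx ltW // => /(_ isT).
rewrite -subr_le0 E1 pmulr_rle0 // leNgt => /negP; apply; apply: Hd => //=.
by rewrite sub0r normrN gtr0_norm // (lt_trans st).
Unshelve. all: by end_near. Qed.

Lemma sqr_cabs (z : C) : reC (z * Num.conj z) = cabs z ^+ 2.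
Proof. by rewrite reCM reC_conj imC_conj cabs_sqr; ring. Qed.

Lemma Dc_sqr U g v x : open U -> smooth_on U g -> U x ->
  Dc v (Dc v (fun y => g y * Num.conj (g y))) x =
  Dc v (Dc v g) x * Num.conj (g x) + (Dc v g x * Num.conj (Dc v g x)) *+ 2 +
  g x * Num.conj (Dc v (Dc v g) x).
Proof.
move=> oU sg Ux; have sc := smooth_conj oU sg.
have sD := smooth_Dc v sg; have scD := smooth_conj oU sD.
rewrite (Dc_ext (g := fun y => Dc v g y * Num.conj (g y) + g y * Num.conj (Dc v g y))).
  rewrite (Dc_add _ (smooth_mul oU sD sc) (smooth_mul oU sg scD) Ux).
  rewrite (Dc_mul _ sD sc Ux) (Dc_mul _ sg scD Ux) !Dc_conj; try by exists U.
  by rewrite mulr2n; ring.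
have := open_near oU Ux; apply: filterS => y Uy.
by rewrite (Dc_mul _ sg sc Uy) Dc_conj; last by exists U.
Qed.

Lemma laplace_sqr U g x : open U -> holR U g -> U x ->
  Dc ex (Dc ex (fun y => g y * Num.conj (g y))) x +
  Dc ey (Dc ey (fun y => g y * Num.conj (g y))) x =
  (Dc ex g x * Num.conj (Dc ex g x)) *+ 4.
Proof.
move=> oU hg Ux; have [sg cg] := hg.
have hD := holR_Dc oU hg; have [sD cD] := hD.
rewrite !(Dc_sqr _ oU sg Ux).
have -> : Dc ey (Dc ey g) x = - Dc ex (Dc ex g) x.
  rewrite (Dc_ext (g := fun y => iC * Dc ex g y)).
    by rewrite (Dc_mul _ (smooth_cst U _) sD Ux) Dc_cst mul0r add0r cD // mulrA iC2 mulN1r.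
  by have := open_near oU Ux; apply: filterS => y /cg.
rewrite cg // !rmorphM rmorphN /=.
have -> : Num.conj (iC : C) = - iC by apply: Cplx_ext; rewrite ?reC_conj ?imC_conj ?reCN ?imCN /= ?oppr0.
rewrite (_ : iC * Dc ex g x * (- iC * Num.conj (Dc ex g x)) = Dc ex g x * Num.conj (Dc ex g x)).
  by ring.
by rewrite mulrACA mulrN iC2 opprK mul1r.
Qed.

Definition square a (r : R) : set P := [set x | `|x.1 - a.1| <= r /\ `|x.2 - a.2| <= r].

Lemma square_compact a r : compact (square a r).
Proof.
have -> : square a r = `[a.1 - r, a.1 + r] `*` `[a.2 - r, a.2 + r].
  by apply/seteqP; split => x; rewrite /square /= !in_itv /= !ler_distl.
by apply: compact_setX; exact: segment_compact.
Qed.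

Lemma square_interior a r x : `|x.1 - a.1| < r -> `|x.2 - a.2| < r ->
  \forall y \near x, square a r y.
Proof.
move=> x1 x2; pose e := Num.min (r - `|x.1 - a.1|) (r - `|x.2 - a.2|).
have e0 : 0 < e by rewrite lt_min !subr_gt0 x1 x2.
apply/nbhs_ballP; exists e => // y; rewrite -ball_normE /ball_ /= distrC => xy.
have := xy; rewrite [X in X < _ -> _]/Num.norm /= gt_max !lt_min => /andP[/andP[h1 _] /andP[_ h2]].
split.
  rewrite -(subrK x.1 y.1) -addrA (le_trans (ler_normD _ _)) // -lerBrDr ltW //.
by rewrite -(subrK x.2 y.2) -addrA (le_trans (ler_normD _ _)) // -lerBrDr ltW.
Qed.

Lemma max_principle U g a (r B : R) : open U -> holR U g -> square a r `<=` U ->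
  0 < r ->
  (forall x, square a r x -> `|x.1 - a.1| = r \/ `|x.2 - a.2| = r -> cabs (g x) ^+ 2 <= B) ->
  forall x, square a r x -> cabs (g x) ^+ 2 <= B.
Proof.
move=> oU hg sU r0 bB x sx; apply/ler_addgt0Pr => e e0.
(* On the square the squared modulus of [zeta a] is at most [2 * r ^+ 2], so the added term is at
   most [e]. *)
pose c : C := mkC (e / (r ^+ 2 * 2)) 0.
have c0 : 0 < e / (r ^+ 2 * 2) by rewrite divr_gt0 // mulr_gt0 // exprn_gt0.
have hz := holR_zeta U a; have [sg _] := hg; have [sz _] := hz.
pose G y := g y * Num.conj (g y); pose Z y := zeta a y * Num.conj (zeta a y).
pose u y := G y + c * Z y.
have sG : smooth_on U G by apply: smooth_mul => //; exact: smooth_conj.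
have sZ : smooth_on U Z by apply: smooth_mul => //; exact: smooth_conj.
have scZ : smooth_on U (fun y => c * Z y) by apply: smooth_mul => //; exact: smooth_cst.
have su : smooth_on U u by exact: smooth_add.
have uE y : reC (u y) = cabs (g y) ^+ 2 + e / (r ^+ 2 * 2) * cabs (zeta a y) ^+ 2.
  by rewrite reCD reCM !sqr_cabs /= mul0r subr0.
have [||m ms um] := @compact_EVT_max _ _ (fun y => reC (u y)) (square a r) _ (square_compact (r := r)).
- by exists x.
- apply: continuous_in_subspaceT => y; rewrite inE => /sU Uy.
  by have [Cu _] := su 0; exact: Ck_cont Cu Uy.
rewrite inE in ms.
apply: (@le_trans _ _ (reC (u m))).
  apply: (@le_trans _ _ (reC (u x))); last by apply: um; rewrite inE.
  by rewrite uE lerDl mulr_ge0 ?(ltW c0) // sqr_ge0.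
have [[m1 m2]|bd] : (`|m.1 - a.1| < r /\ `|m.2 - a.2| < r) \/
    (`|m.1 - a.1| = r \/ `|m.2 - a.2| = r).
  by case: ms => /=; rewrite !le_eqVlt => /orP[/eqP|] ? /orP[/eqP|] ?; tauto.
- exfalso; have Um := sU _ ms.
  have mx : \forall y \near m, reC (u y) <= reC (u m).
    by have := square_interior m1 m2; apply: filterS => y sy; apply: um; rewrite inE.
  have [Cu _] := su 2.
  have D2 v : Dc v (Dc v u) m = Dc v (Dc v G) m + c * Dc v (Dc v Z) m.
    rewrite (Dc_ext (g := fun y => Dc v G y + c * Dc v Z y)).
      have sD := smooth_Dc v sZ.
      have scD : smooth_on U (fun y => c * Dc v Z y) by apply: smooth_mul => //; exact: smooth_cst.
      by rewrite (Dc_add _ (smooth_Dc v sG) scD Um) (Dc_mul _ (smooth_cst U _) sD Um) Dc_cst mul0r add0r.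
    have := open_near oU Um; apply: filterS => y Uy.
    by rewrite (Dc_add _ sG scZ Uy) (Dc_mul _ (smooth_cst U _) sZ Uy) Dc_cst mul0r add0r.
  have n1 : 'D_ex ('D_ex (fun y => reC (u y))) m <= 0.
    by rewrite leNgt; apply/negP => h; exact: (no_local_max oU Um Cu h mx).
  have n2 : 'D_ey ('D_ey (fun y => reC (u y))) m <= 0.
    by rewrite leNgt; apply/negP => h; exact: (no_local_max oU Um Cu h mx).
  have L1 : Dc ex (Dc ex G) m + Dc ey (Dc ey G) m = _ := laplace_sqr oU hg Um.
  have L2 : Dc ex (Dc ex Z) m + Dc ey (Dc ey Z) m = _ := laplace_sqr oU hz Um.
  have : reC (Dc ex (Dc ex u) m + Dc ey (Dc ey u) m) <= 0.
    by rewrite reCD -[0]addr0; exact: lerD n1 n2.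
  rewrite (D2 ex) (D2 ey) addrACA -[c * _ + _]mulrDr L1 L2 Dc_zeta.
  rewrite leNgt => /negP; apply.
  have q z : reC (z *+ 4) = reC z *+ 4 by rewrite !mulrS mulr0n !reCD.
  rewrite reCD q sqr_cabs ltr_wpDl ?mulrn_wge0 ?sqr_ge0 //.
  rewrite (_ : mkC ex.1 ex.2 = 1) // mul1r rmorph1 reCM /= mul0r subr0.
  by rewrite mulr_gt0 // (q 1) pmulrn_lgt0.
rewrite uE; apply: lerD; first exact: bB.
rewrite mulrAC ler_pdivrMr ?mulr_gt0 ?exprn_gt0 // ler_wpM2l ?(ltW e0) //.
rewrite cabs_sqr mulr_natr mulr2n; case: ms => h1 h2.
by apply: lerD; rewrite -[leLHS]real_normK ?num_real // lerXn2r ?nnegrE // ltW.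
Qed.

End MaxPrinciple.

(** * Zeros of holomorphic functions *)

Section Factor.
Context {R : realType}.
Local Notation C := (Cplx R).
Local Notation P := (R * R)%type.
Variables (U : set P) (a : P).
Hypotheses (oU : open U) (Ua : U a).
Implicit Types (f g : P -> C) (x v : P).

Lemma tpoly0 m f x : (forall k, (k < m)%N -> tc a f k = 0) -> tpoly a m f x = 0.
Proof. by move=> H; rewrite /tpoly big1 // => k _; rewrite H ?mul0r. Qed.

(** The maximum principle for the quotients [tquot a m f] replaces the convergence of the Taylor
    series. On the boundary of a square of half-side [d] the modulus of [zeta a] is at least [d];
    hence inside [cabs (f x) ^+ 2 <= B * (cabs (zeta a x) ^+ 2 / d ^+ 2) ^+ m] for every [m], and
    the right side tends to 0 close to [a]. *)
Lemma holR_flat f : holR U f -> (forall m, tc a f m = 0) -> \forall x \near a, f x = 0.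
Proof.
move=> hf f0; have [sf _] := hf.
have [d /= d0 dU] : exists2 d, 0 < d & square a d `<=` U.
  have /nbhs_ballP[d /= d0 aU] := open_near oU Ua; exists (d / 2); first by rewrite divr_gt0.
  move=> x [h1 h2]; apply: aU; rewrite -ball_normE /ball_ /= distrC /Num.norm /= gt_max.
  by rewrite !(le_lt_trans h1, le_lt_trans h2) // ltr_pdivrMr // ltr_pMr // ltr1n.
have [||c _ cm] := @compact_EVT_max _ _ (fun y => reC (f y * Num.conj (f y))) (square a d) _
   (square_compact (r := d)).
- by exists a; split; rewrite subrr normr0 ltW.
- apply: continuous_in_subspaceT => y; rewrite inE => /dU Uy.
  have [+ _] := smooth_mul oU sf (smooth_conj oU sf) 0; move=> H; exact: Ck_cont H Uy.
set B := reC _ in cm.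
have fm m x : f x = tquot a m f x * zeta a x ^+ m.
  have [->|->] := tquot_mul a m f x; first by rewrite tpoly0 ?subr0.
  have fa : f a = 0 by have := f0 0%N; rewrite /tc /= fact0 divr1.
  by rewrite tquot_a f0 mul0r.
have sqE m x : cabs (f x) ^+ 2 =
    cabs (tquot a m f x) ^+ 2 * (cabs (zeta a x) ^+ 2) ^+ m.
  by rewrite [in LHS](fm m x) cabsM cabsX exprMn exprAC.
have bd m x : square a d x -> cabs (f x) ^+ 2 <= B * (cabs (zeta a x) ^+ 2 / d ^+ 2) ^+ m.
  move=> sx; rewrite (sqE m x).
  rewrite [(_ / _) ^+ m]exprMn [(cabs (zeta a x) ^+ 2) ^+ m * _]mulrC mulrA ler_wpM2r ?exprn_ge0 ?cabs_ge0 //.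
  apply: (@max_principle _ U (tquot a m f) a d) => //; first exact: holR_tquot.
  move=> y sy bdy.
  have zd : d ^+ 2 <= cabs (zeta a y) ^+ 2.
    by rewrite cabs_sqr -[in leRHS]/(y.1 - a.1) -[in leRHS]/(y.2 - a.2) /=; case: bdy => <-;
      rewrite real_normK ?num_real // ?lerDl ?lerDr sqr_ge0.
  have zp : 0 < cabs (zeta a y) ^+ 2 by rewrite (lt_le_trans _ zd) ?exprn_gt0.
  rewrite exprVn ler_pdivlMr ?exprn_gt0 //.
  apply: (@le_trans _ _ (cabs (tquot a m f y) ^+ 2 * (cabs (zeta a y) ^+ 2) ^+ m)).
    by rewrite ler_wpM2l ?sqr_ge0 // lerXn2r ?nnegrE ?sqr_ge0.
  by rewrite -sqE -sqr_cabs; apply: cm; rewrite inE.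
(* Within [d / 4] of [a] the modulus of [zeta a] is at most [d / 2], since [cabs_zeta] loses a
   factor 2. *)
have d2 : 0 < d / 4 by rewrite divr_gt0.
apply/nbhs_ballP; exists (d / 4) => // x; rewrite -ball_normE /ball_ /= distrC => xd.
have sx : square a d x.
  have := ltW xd; rewrite {1}/Num.norm /= ge_max => /andP[h1 h2].
  by split; [apply: (le_trans h1)|apply: (le_trans h2)]; rewrite ler_pdivrMr // ler_pMr // ler1n.
have zs : cabs (zeta a x) ^+ 2 / d ^+ 2 <= 1 / 2.
  rewrite ler_pdivrMr ?exprn_gt0 // (@le_trans _ _ ((d / 2) ^+ 2)) //.
    rewrite lerXn2r ?nnegrE ?cabs_ge0 // ?divr_ge0 ?(ltW d0) //.
    by apply: (le_trans (cabs_zeta _ _)); rewrite mulr2n; lra.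
  by rewrite exprMn; have := exprn_gt0 2 d0; lra.
have B0 : 0 <= B by rewrite /B sqr_cabs sqr_ge0.
have lim m : cabs (f x) ^+ 2 <= B * (1 / 2) ^+ m.
  apply: (le_trans (bd m x sx)); rewrite ler_wpM2l // lerXn2r ?nnegrE //.
  by rewrite divr_ge0 ?sqr_ge0.
have : cabs (f x) ^+ 2 <= 0.
  have L : B * (1 / 2) ^+ m @[m --> \oo] --> (0 : R).
    have H : (1 / 2 : R) ^+ m @[m --> \oo] --> (0 : R) by apply: cvg_expr; rewrite ger0_norm; lra.
    have H2 : B * (1 / 2) ^+ m @[m --> \oo] --> B * 0.
      by apply: cvgM; [exact: cvg_cst|exact: H].
    by rewrite mulr0 in H2.
  rewrite -(cvg_lim _ L) //; apply: limr_ge; first by apply/cvg_ex; exists 0.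
  by apply: nearW.
by rewrite le_eqVlt ltNge sqr_ge0 orbF sqrf_eq0 cabs_eq0 => /eqP.
Qed.

Lemma holR_factor f : holR U f -> (\forall x \near a, f x = 0) \/
  exists m g, [/\ holR U g, g a != 0 & forall x, f x = zeta a x ^+ m * g x].
Proof.
move=> hf; have [f0|] := pselect (forall m, tc a f m = 0); first by left; exact: holR_flat.
move=> /existsNP[m0 /eqP m0P]; right.
have ex0 : exists m, tc a f m != 0 by exists m0.
case: (ex_minnP ex0) => m mP mmin.
have lo k : (k < m)%N -> tc a f k = 0.
  by move=> km; apply/eqP; apply/negPn/negP => /mmin; rewrite leqNgt km.
exists m, (tquot a m f); split; [exact: holR_tquot|by rewrite tquot_a|].
move=> x; rewrite mulrC; have [->|->] := tquot_mul a m f x; first by rewrite tpoly0 ?subr0.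
rewrite tquot_a; case: m mP {mmin} lo => [|m] mP lo.
  by rewrite mulr1 /tc /= fact0 divr1.
have := lo 0%N isT; rewrite /tc /= fact0 divr1 => ->.
by rewrite /zeta !subrr exprS mul0r mulr0.
Qed.

End Factor.

(** * Saturation of a spanning set *)

Section Saturation.
Context {R : realType}.
Local Notation C := (Cplx R).
Local Notation P := (R * R)%type.
Implicit Types (U : set P) (f g : P -> C) (x a v : P).

Lemma near_open (T : topologicalType) (a : T) (Q : set T) : (\forall x \near a, Q x) ->
  exists V, [/\ open V, V a & V `<=` Q].
Proof.
move=> H; exists (Q°); split; [exact: open_interior|by apply: nbhs_singleton; exact: nbhs_interior|exact: interior_subset].
Qed.

Lemma near_forall (T : topologicalType) (I : finType) (a : T) (Q : I -> T -> Prop) :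
  (forall i, \forall x \near a, Q i x) -> \forall x \near a, forall i, Q i x.
Proof. by move=> H; exact: filter_forall. Qed.

Lemma near_and (T : topologicalType) (a : T) (P Q : set T) :
  (\forall x \near a, P x) -> (\forall x \near a, Q x) ->
  \forall x \near a, P x /\ Q x.
Proof. by move=> HP HQ; exact: filterI. Qed.

Lemma dnbhs_line a (Q : set P) : (\forall y \near a^', Q y) ->
  \forall t \near (0 : R)^'+, Q (a + t *: ex).
Proof.
move=> H; have N := near_line2 ex ex H.
near=> t; have t0 : 0 < t by near: t; exact: nbhs_right_gt.
have H1 s s' : 0 <= s <= t -> 0 <= s' <= t -> a + s *: ex + s' *: ex != a -> Q (a + s *: ex + s' *: ex).
  by move: s s'; near: t; exact: N.
have := H1 t 0; rewrite scale0r addr0; apply.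
- by rewrite lexx ltW.
- by apply/andP; split; [|exact: ltW].
rewrite -subr_eq0 addrC addKr scaler_eq0 negb_or gt_eqF //=.
by apply/eqP => -[/eqP]; rewrite oner_eq0.
Unshelve. all: by end_near. Qed.

Lemma continuous_dnbhs0 (h : P -> R) a : {for a, continuous h} ->
  (\forall y \near a^', h y = 0) -> h a = 0.
Proof.
move=> ch /dnbhs_line H; apply/eqP; rewrite -normr_le0; apply/ler_addgt0Pr => e e0.
have N := near_line2 ex ex (continuous_dist_le ch e0).
have [t [t0 h0 Q]] : exists t : R, [/\ 0 < t, h (a + t *: ex) = 0 &
    forall s s', 0 <= s <= t -> 0 <= s' <= t -> `|h a - h (a + s *: ex + s' *: ex)| <= e].
  by near (0 : R)^'+ => t; exists t; split; near: t => //; exact: nbhs_right_gt.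
have := Q t 0; rewrite scale0r addr0 h0 subr0 add0r; apply.
  by rewrite lexx ltW.
by apply/andP; split; [|exact: ltW].
Unshelve. all: by end_near. Qed.

Lemma smooth_dnbhs0 U f a : smooth_on U f -> U a ->
  (\forall y \near a^', f y = 0) -> f a = 0.
Proof.
move=> /(_ 0)[cr ci] Ua H; apply: Cplx_ext.
  by apply: (continuous_dnbhs0 (Ck_cont cr Ua)); apply: filterS H => y ->.
by apply: (continuous_dnbhs0 (Ck_cont ci Ua)); apply: filterS H => y ->.
Qed.

Lemma smooth_neq0_near U f a : smooth_on U f -> U a -> f a != 0 ->
  \forall x \near a, f x != 0.
Proof.
move=> /(_ 0)[cr ci] Ua; rewrite -sqnormC_eq0.
rewrite paddr_eq0 ?sqr_ge0 // !sqrf_eq0 negb_and => /orP[h|h].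
  have := (Ck_cont cr Ua : {for a, continuous _}) => /cvgr_neq0 /(_ h); apply: filterS => x.
  by apply: contraNneq => ->.
have := (Ck_cont ci Ua : {for a, continuous _}) => /cvgr_neq0 /(_ h); apply: filterS => x.
by apply: contraNneq => ->.
Qed.

Definition hol_mx m k U (F : P -> 'M[C]_(m, k)) := forall i j, holR U (fun x => F x i j).

Lemma hol_mx_smooth m k U (F : P -> 'M[C]_(m, k)) : hol_mx U F -> smooth_mx U F.
Proof. by move=> hF i j; have [] := hF i j. Qed.

Lemma hol_mx_sub m k U V (F : P -> 'M[C]_(m, k)) : V `<=` U -> hol_mx U F -> hol_mx V F.
Proof. by move=> VU hF i j; exact: holR_sub (hF i j). Qed.

Lemma holR_eq U f g : f =1 g -> holR U f -> holR U g.
Proof. by move=> /funext ->. Qed.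

Lemma hol_mx_cst m k U (A : 'M[C]_(m, k)) : hol_mx U (fun=> A).
Proof. by move=> i j; exact: holR_cst. Qed.

Lemma hol_mx_mul m k l U (F : P -> 'M[C]_(m, k)) (G : P -> 'M[C]_(k, l)) : open U ->
  hol_mx U F -> hol_mx U G -> hol_mx U (fun x => F x *m G x).
Proof.
move=> oU hF hG i j; apply: (@holR_eq _ (fun x => \sum_k F x i k * G x k j)).
  by move=> x; rewrite mxE.
by apply: holR_sum => // ?; exact: holR_mul.
Qed.

Lemma hol_mx_add m k U (F G : P -> 'M[C]_(m, k)) : open U ->
  hol_mx U F -> hol_mx U G -> hol_mx U (fun x => F x + G x).
Proof.
by move=> oU hF hG i j; apply: holR_eq (holR_add oU (hF i j) (hG i j)) => x; rewrite mxE.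
Qed.

Lemma hol_mx_opp m k U (F : P -> 'M[C]_(m, k)) : open U ->
  hol_mx U F -> hol_mx U (fun x => - F x).
Proof.
by move=> oU hF i j; apply: holR_eq (holR_opp oU (hF i j)) => x; rewrite mxE.
Qed.

Lemma holR_prod U (I : Type) (r : seq I) (F : I -> P -> C) : open U ->
  (forall i, holR U (F i)) -> holR U (fun x => \prod_(i <- r) F i x).
Proof.
move=> oU hF; elim: r => [|i r IH].
  by apply: holR_eq (holR_cst U 1) => x; rewrite big_nil.
by apply: holR_eq (holR_mul oU (hF i) IH) => x; rewrite big_cons.
Qed.

Lemma holR_det m U (F : P -> 'M[C]_m) : open U -> hol_mx U F ->
  holR U (fun x => \det (F x)).
Proof.
move=> oU hF; apply: holR_sum => // s.
by apply: holR_mul => //; [exact: holR_cst|exact: holR_prod].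
Qed.

Lemma hol_invmx m U (F : P -> 'M[C]_m) : open U ->
  (forall x, U x -> F x \in unitmx) -> hol_mx U F -> hol_mx U (fun x => invmx (F x)).
Proof.
move=> oU uF hF i j; apply: (@holR_ext _ _ (fun x => (\det (F x))^-1 *
    ((-1) ^+ (j + i) * \det (row' j (col' i (F x)))))) => //.
  by move=> x Ux; rewrite /invmx uF // !mxE.
apply: holR_mul => //.
  by apply: holR_inv => //; exact: holR_det.
apply: holR_mul => //; first exact: holR_cst.
apply: holR_det => // k l.
by apply: holR_eq (hF (lift j k) (lift i l)) => x; rewrite !mxE.
Qed.

Lemma unitmx_near m U (F : P -> 'M[C]_m) a : open U -> U a -> smooth_mx U F ->
  F a \in unitmx -> \forall x \near a, F x \in unitmx.
Proof.
move=> oU Ua sF; rewrite unitmxE unitfE => /(smooth_neq0_near (smooth_det oU sF) Ua).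
by apply: filterS => x; rewrite unitmxE unitfE.
Qed.

Lemma row_free_near m k U (F : P -> 'M[C]_(m, k)) a : open U -> U a -> smooth_mx U F ->
  row_free (F a) -> \forall x \near a, row_free (F x).
Proof.
move=> oU Ua sF /row_freeP[D FD].
have := @unitmx_near _ U (fun x => F x *m D) a oU Ua.
rewrite FD unitmx1 => /(_ (smooth_mx_mul oU sF (smooth_mx_cst U D)) isT).
apply: filterS => x u; apply/row_freeP; exists (D *m invmx (F x *m D)).
by rewrite mulmxA mulmxV.
Qed.

(** The exponent is the smallest order of vanishing among the entries that are not zero near [a], so
    an entry of that order survives in [G a]. *)
Lemma hol_mx_factor m k U (F : P -> 'M[C]_(m, k)) a : open U -> U a -> hol_mx U F ->
  (\forall x \near a, F x = 0) \/ exists mu G, [/\ hol_mx U G, G a != 0 &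
    \forall x \near a, F x = zeta a x ^+ mu *: G x].
Proof.
move=> oU Ua hF.
have E (ij : 'I_m * 'I_k) : exists mg : nat * (P -> C), [/\ holR U mg.2,
    (\forall x \near a, F x ij.1 ij.2 = zeta a x ^+ mg.1 * mg.2 x) &
    mg.2 a != 0 \/ \forall x \near a, F x ij.1 ij.2 = 0].
  have [f0|[mu [g [hg ga fg]]]] := holR_factor oU Ua (hF ij.1 ij.2).
    exists (0, fun=> 0); split=> //=; [exact: holR_cst| |by right].
    by apply: filterS f0 => x ->; rewrite mulr0.
  by exists (mu, g); split; [exact: hg|exact: (@filterE _ (nbhs a) _ _ fg)|left].
have [mg mgP] := choice E.
have [/existsP[ij0 ij0P]|/existsPn no] := boolP [exists ij, (mg ij).2 a != 0]; last first.
  left; have H (ij : 'I_m * 'I_k) : \forall x \near a, F x ij.1 ij.2 = 0.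
    by have [_ _ [|//]] := mgP ij; rewrite (negPf (no ij)).
  apply: filterS (near_forall H) => x Hx; apply/matrixP => i j.
  by rewrite (Hx (i, j)) mxE.
pose nz (ij : 'I_m * 'I_k) := (mg ij).2 a != 0.
right; case: (@arg_minnP _ ij0 nz (fun ij => (mg ij).1) ij0P) => ij1 ij1P mn.
pose G x : 'M[C]_(m, k) := \matrix_(i, j) (if (mg (i, j)).2 a != 0 then
  zeta a x ^+ ((mg (i, j)).1 - (mg ij1).1) * (mg (i, j)).2 x else 0).
exists (mg ij1).1, G; split.
- move=> i j; apply: (@holR_eq _ (fun x => if (mg (i, j)).2 a != 0 then
    zeta a x ^+ ((mg (i, j)).1 - (mg ij1).1) * (mg (i, j)).2 x else 0)).
    by move=> x; rewrite mxE.
  case: ((mg (i, j)).2 a != 0); last exact: holR_cst.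
  apply: holR_mul => //; first by apply: holR_exp => //; exact: holR_zeta.
  by have [] := mgP (i, j).
- apply/eqP => /matrixP /(_ ij1.1 ij1.2); rewrite !mxE -surjective_pairing -/(nz ij1) ij1P.
  by rewrite subnn expr0 mul1r => /eqP; apply/negP.
have H (ij : 'I_m * 'I_k) : \forall x \near a, F x ij.1 ij.2 = (zeta a x ^+ (mg ij1).1 *: G x) ij.1 ij.2.
  have [_ f1 f2] := mgP ij; case: (boolP ((mg ij).2 a != 0)) => h.
    apply: filterS f1 => x ->; rewrite !mxE -surjective_pairing h mulrA -exprD subnKC //.
    exact: mn.
  have {}f2 : \forall x \near a, F x ij.1 ij.2 = 0 by case: f2 => //; rewrite (negPf h).
  by apply: filterS f2 => x ->; rewrite !mxE -surjective_pairing (negPf h) mulr0.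
apply: filterS (near_forall H) => x Hx; apply/matrixP => i j.
by rewrite (Hx (i, j)).
Qed.

(* One row at a time: subtract from a new row its component along the frame already found,
   divide the remainder by the power of the coordinate it contains. *)
Lemma saturation m k U (K : P -> 'M[C]_(m, k)) a : open U -> U a -> hol_mx U K ->
  exists V s (B : P -> 'M[C]_(s, k)), [/\ open V, V a, V `<=` U, hol_mx V B &
    forall x, V x -> row_free (B x) /\ (x <> a -> (K x :=: B x)%MS)].
Proof.
move=> oU Ua; elim: m K => [|m IH] K hK.
  exists U, 0%N, (fun=> 0); split => // [|x _]; first exact: hol_mx_cst.
  by split=> [|_]; [rewrite /row_free mxrank0|rewrite [K x]flatmx0; apply: eqmx_refl].
pose K1 x : 'rV[C]_k := usubmx (K x : 'M[C]_(1 + m, k)).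
pose K2 x : 'M[C]_(m, k) := dsubmx (K x : 'M[C]_(1 + m, k)).
have hK1 : hol_mx U K1 by move=> i j; apply: holR_eq (hK (lshift m i) j) => x; rewrite mxE.
have hK2 : hol_mx U K2 by move=> i j; apply: holR_eq (hK (rshift 1 i) j) => x; rewrite mxE.
have KE x : (K x :=: K1 x + K2 x)%MS.
  by rewrite -{1}[K x](@vsubmxK _ 1 m); apply: eqmx_sym; exact: addsmxE.
have [V [s [B [oV Va VU hB BP]]]] := IH K2 hK2.
have [D BD] : exists D, B a *m D = 1%:M by apply/row_freeP; have [] := BP a Va.
have uN : \forall x \near a, B x *m D \in unitmx.
  apply: (unitmx_near oV Va); last by rewrite BD unitmx1.
  by apply: smooth_mx_mul => //; [exact: hol_mx_smooth|exact: smooth_mx_cst].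
have [W [oW Wa WP]] := near_open (near_and (open_near oV Va) uN).
have WV : W `<=` V by move=> x /WP[].
have WU : W `<=` U by move=> x /WV /VU.
have uW x : W x -> B x *m D \in unitmx by move=> /WP[].
have hBD : hol_mx W (fun x => B x *m D).
  by apply: hol_mx_mul => //; [exact: hol_mx_sub WV _|exact: hol_mx_cst].
(* [D] is a right inverse of [B a]. Of all combinations of the rows of [B x], the one subtracted
   makes the remainder vanish after multiplication by [D]. *)
pose e x := K1 x - K1 x *m D *m invmx (B x *m D) *m B x.
have he : hol_mx W e.
  apply: hol_mx_add => //; first exact: hol_mx_sub WU _.
  apply: hol_mx_opp => //; apply: hol_mx_mul => //; last exact: hol_mx_sub WV _.
  apply: hol_mx_mul => //; last exact: hol_invmx.
  by apply: hol_mx_mul => //; [exact: hol_mx_sub WU _|exact: hol_mx_cst].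
have K1E x : (K1 x + B x :=: e x + B x)%MS.
  apply/eqmxP; rewrite !addsmx_sub !addsmxSr !andbT; apply/andP; split.
    rewrite -[X in (X <= _)%MS](subrK (K1 x *m D *m invmx (B x *m D) *m B x)).
    apply: addmx_sub; first exact: addsmxSl.
    exact: submx_trans (submxMl _ _) (addsmxSr _ _).
  apply: addmx_sub; first exact: addsmxSl.
  by rewrite -mulNmx; exact: submx_trans (submxMl _ _) (addsmxSr _ _).
have KB x : W x -> x <> a -> (K x :=: e x + B x)%MS.
  move=> Wx xa; have [_ /(_ xa) KBx] := BP x (WV x Wx).
  by apply: eqmx_trans (KE x) _; apply: eqmx_trans (adds_eqmx (eqmx_refl _) KBx) (K1E x).
have [e0|[mu [g [hg ga eg]]]] := hol_mx_factor oW Wa he.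
  have [Z [oZ Za ZP]] := near_open (near_and (open_near oW Wa) e0).
  exists Z, s, B; split => // [x /ZP[/WU//]||x /ZP[Wx ex0]].
    by apply: hol_mx_sub (hol_mx_sub WV hB) => x /ZP[].
  split=> [|xa]; first by have [] := BP x (WV x Wx).
  by apply: eqmx_trans (KB x Wx xa) _; rewrite ex0; exact: adds0mx.
(* [e x *m D] vanishes near [a], hence so does [g x *m D] off [a], and at [a] by continuity. As
   [B a *m D = 1%:M] and [g a != 0], the new row is independent of the rows of [B a]. *)
have gD : g a *m D = 0.
  apply/matrixP => i j; rewrite [RHS]mxE.
  have sgD : smooth_mx W (fun x => g x *m D).
    by apply: smooth_mx_mul => //; [exact: hol_mx_smooth|exact: smooth_mx_cst].
  apply: (smooth_dnbhs0 (sgD i j) Wa).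
  have N := near_and (open_near oW Wa) eg.
  have : \forall x \near a, x != a -> g x *m D = 0.
    apply: filterS N => x [Wx exg] xa.
    have : e x *m D = 0.
      rewrite /e mulmxBl -[X in _ - X]mulmxA -[X in _ - X]mulmxA mulVmx ?uW //.
      by rewrite mulmx1 subrr.
    rewrite exg -scalemxAl => /eqP; rewrite scaler_eq0 expf_eq0 zeta_eq0 (negPf xa) andbF /=.
    by move/eqP.
  by apply: filterS => x + xa => /(_ xa) ->; rewrite mxE.
pose B' x := col_mx (B x) (g x).
have hB' : hol_mx W B'.
  move=> i j; rewrite /B'; case: (splitP i) => i' ii'.
    apply: holR_eq (holR_sub WV (hB i' j)) => x.
    by rewrite (_ : i = lshift 1 i') ?col_mxEu //; apply: val_inj.
  apply: holR_eq (hg i' j) => x.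
  by rewrite (_ : i = rshift s i') ?col_mxEd //; apply: val_inj.
have fB' : row_free (B' a).
  rewrite -kermx_eq0; apply/eqP/row_matrixP => i; rewrite row0.
  set u := row i _; have uB : u *m B' a = 0.
    by apply/sub_kermxP; exact: row_sub.
  move: uB; rewrite -[u]hsubmxK /B' mul_row_col => uB.
  have u1 : lsubmx u = 0.
    by have := congr1 (mulmxr D) uB; rewrite /= mulmxDl -!mulmxA BD gD mulmx1 mulmx0 addr0 mul0mx.
  move: uB; rewrite u1 mul0mx add0r [rsubmx u]mx11_scalar mul_scalar_mx => /eqP.
  rewrite scaler_eq0 (negPf ga) orbF => /eqP ->.
  by rewrite raddf0 row_mx0.
have fN := row_free_near oW Wa (hol_mx_smooth hB') fB'.
have [Z [oZ Za ZP]] := near_open (near_and (near_and (open_near oW Wa) eg) fN).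
exists Z, (s + 1)%N, B'; split => // [x /ZP[[/WU//]]||x /ZP[[Wx exg] fx]].
  by apply: hol_mx_sub hB' => x /ZP[[]].
split=> // xa; apply: eqmx_trans (KB x Wx xa) _.
rewrite addsmxC; apply: eqmx_trans _ (addsmxE _ _).
apply: adds_eqmx; first exact: eqmx_refl.
rewrite exg; apply: eqmx_scale; rewrite expf_neq0 // zeta_eq0; exact/eqP.
Qed.

End Saturation.

(** * Orthogonal projections *)

Section GramProjector.
Context {R : realType}.
Local Notation C := (Cplx R).

Lemma mul_adj_eq0 m k (A : 'M[C]_(m, k)) : A *m A ^t* = 0 -> A = 0.
Proof.
move=> A0; apply/matrixP => i j; rewrite mxE.
have := congr1 (fun B : 'M[C]_m => B i i) A0; rewrite !mxE => /eqP.
rewrite psumr_eq0 => [/allP/(_ j (mem_index_enum _))/=|l _].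
  by rewrite !mxE -normCK sqrf_eq0 normr_eq0 => /eqP.
by rewrite !mxE -normCK exprn_ge0.
Qed.

Lemma adjmxM m k l (A : 'M[C]_(m, k)) (B : 'M[C]_(k, l)) : (A *m B) ^t* = B ^t* *m A ^t*.
Proof. by rewrite trmx_mul map_mxM. Qed.

Lemma adjmxK m k (A : 'M[C]_(m, k)) : A ^t* ^t* = A.
Proof. by apply/matrixP => i j; rewrite !mxE conjCK. Qed.

Lemma adjmx1 m : (1%:M : 'M[C]_m) ^t* = 1%:M.
Proof. by rewrite trmx1 map_mx1. Qed.

Lemma adjmxD m k (A B : 'M[C]_(m, k)) : (A + B) ^t* = A ^t* + B ^t*.
Proof. by apply/matrixP => i j; rewrite !mxE rmorphD. Qed.

Lemma adjmxN m k (A : 'M[C]_(m, k)) : (- A) ^t* = - A ^t*.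
Proof. by apply/matrixP => i j; rewrite !mxE rmorphN. Qed.

Lemma gram_unitmx m k (A : 'M[C]_(m, k)) : row_free A -> A *m A ^t* \in unitmx.
Proof.
move=> fA; rewrite -row_free_unit -kermx_eq0; apply/eqP/row_matrixP => i; rewrite row0.
set u := row i _; have uA : u *m (A *m A ^t* ) = 0 by apply/sub_kermxP; exact: row_sub.
have : u *m A = 0.
  by apply: mul_adj_eq0; rewrite adjmxM mulmxA -[u *m A *m _]mulmxA uA mul0mx.
by rewrite -[in RHS](mul0mx _ A) => /(row_free_inj fA).
Qed.

(** The orthogonal projection onto the row space of [A] when its rows are independent, in a form
    that is visibly smooth in [A]. *)
Definition gram_proj m k (A : 'M[C]_(m, k)) : 'M[C]_k :=
  A ^t* *m invmx (A *m A ^t* ) *m A.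

Lemma adj_invmx m (A : 'M[C]_m) : (invmx A) ^t* = invmx (A ^t* ).
Proof. by rewrite trmx_inv map_invmx. Qed.

Lemma gram_projP m k (A : 'M[C]_(m, k)) : row_free A ->
  [/\ (gram_proj A) ^t* = gram_proj A, gram_proj A *m gram_proj A = gram_proj A &
      (gram_proj A :=: A)%MS].
Proof.
move=> fA; have uA := gram_unitmx fA; split.
- by rewrite /gram_proj !adjmxM adj_invmx adjmxM !adjmxK mulmxA.
- by rewrite /gram_proj !mulmxA -[_ *m A *m A ^t* ]mulmxA mulmxKV.
apply/eqmxP; rewrite submxMl /=.
have {1}-> : A = A *m gram_proj A by rewrite /gram_proj !mulmxA mulmxV // mul1mx.
exact: submxMl.
Qed.

Lemma mx_col_ext m k (A B : 'M[C]_(m, k)) :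
  (forall j, A *m delta_mx j 0 = B *m (delta_mx j 0 : 'cV_k)) -> A = B.
Proof.
by move=> AB; apply/matrixP => i j; have /matrixP/(_ i 0) := AB j; rewrite -!colE !mxE.
Qed.

Lemma orthproj_uniq n (A : set 'cV[C]_n) (P Q : 'M[C]_n) :
  is_orthproj A P -> is_orthproj A Q -> P = Q.
Proof.
have H (P' Q' : 'M[C]_n) : is_orthproj A P' -> is_orthproj A Q' -> P' *m Q' = Q'.
  move=> [_ PP AP] [_ QQ AQ]; apply: mx_col_ext => j.
  rewrite -mulmxA; have : A (Q' *m delta_mx j 0) by rewrite AQ; exists (delta_mx j 0).
  by rewrite AP => -[w _ <-]; rewrite mulmxA PP.
move=> oP oQ; have [hP _ _] := oP; have [hQ _ _] := oQ.
by rewrite -(H _ _ oQ oP) -{1}hP -{1}hQ -adjmxM (H _ _ oP oQ) hQ.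
Qed.

Definition herm_proj n (P : 'M[C]_n) := P ^t* = P /\ P *m P = P.

Definition pspan n (P : 'M[C]_n) : set 'cV[C]_n := range (fun v : 'cV[C]_n => P *m v).

Lemma orthproj_pspan n (P : 'M[C]_n) : herm_proj P -> orthproj (pspan P) = P.
Proof.
move=> [hP PP]; have oP : is_orthproj (pspan P) P by split.
have H := @xgetPex _ 0 _ (ex_intro _ P oP); exact: orthproj_uniq H oP.
Qed.

End GramProjector.

(** * Square block matrices *)

Section Block.
Context {R : realType} (N n : nat).
Local Notation C := (Cplx R).

Definition bmx (B : nat -> nat -> 'M[C]_n) : 'M[C]_(\sum_(i < N) n) :=
  \mxblock_(i < N, j < N) B i j.

Lemma bmxE B s t : bmx B s t = B (tagnat.sig1 s) (tagnat.sig1 t) (tagnat.sig2 s) (tagnat.sig2 t).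
Proof. by rewrite /bmx mxE. Qed.

Lemma bmx_mul B B' : bmx B *m bmx B' = bmx (fun a b => \sum_(c < N) B a c *m B' c b).
Proof. exact: mul_mxblock. Qed.

Lemma bmx_adj B : (bmx B) ^t* = bmx (fun a b => (B b a) ^t* ).
Proof. by apply/matrixP => s t; rewrite !(mxE, bmxE). Qed.

Lemma bmx_ext B B' : (forall a b, (a < N)%N -> (b < N)%N -> B a b = B' a b) -> bmx B = bmx B'.
Proof. by move=> BB; apply/matrixP => s t; rewrite !bmxE BB. Qed.

Lemma bmx1 : bmx (fun a b => (a == b)%:R%:M) = 1%:M.
Proof.
rewrite -(@mxdiagZ _ N (fun=> n) 1) /mxdiag /bmx; apply: eq_mxblock => i j.
have -> : (i == j :> nat) = (i == j) by [].
by case: (eqVneq i j) => [_|_]; rewrite ?conform_mx_id // mulr0n raddf0.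
Qed.

Lemma bmxD B B' : bmx B + bmx B' = bmx (fun a b => B a b + B' a b).
Proof. by apply/matrixP => s t; rewrite !(mxE, bmxE). Qed.

Lemma bmxN B : - bmx B = bmx (fun a b => - B a b).
Proof. by apply/matrixP => s t; rewrite !(mxE, bmxE). Qed.

Lemma bmx0 : bmx (fun a b => 0) = 0.
Proof. by apply/matrixP => s t; rewrite !(mxE, bmxE). Qed.

End Block.

(** * Extension of the kernel across a discrete set *)

Section Toeplitz.
Context {R : realType} (N' n : nat).
Local Notation C := (Cplx R).
Local Notation N := N'.+1.
Variable T : nat -> 'M[C]_n.
Hypothesis TN : forall k, (N <= k)%N -> T k = 0.
Hypothesis TsT : forall m, \sum_(k < N) (T k) ^t* *m T (k + m) = (m == 0)%:R%:M.
Hypothesis TTs : forall m, \sum_(k < N) T k *m (T (k + m)) ^t* = (m == 0)%:R%:M.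

(** Multiplication by the loop, applied to polynomials of degree below [N]: [toep a b] takes the
    coefficient of [lambda^b] to that of [lambda^a], and [toep_over a b] takes it to that of
    [lambda^(N + a)]. *)
Definition toep a b : 'M[C]_n := if (b <= a)%N then T (a - b) else 0.
Definition toep_over a b : 'M[C]_n := T (a + N - b).

Lemma adjmx0 m k : (0 : 'M[C]_(m, k)) ^t* = 0.
Proof. by rewrite trmx0 map_mx0. Qed.

Lemma sum_widen (F : nat -> 'M[C]_n) M M' : (M <= M')%N ->
  (forall k, (M <= k)%N -> (k < M')%N -> F k = 0) ->
  \sum_(k < M') F k = \sum_(k < M) F k.
Proof.
move=> MM F0; rewrite -(big_mkord xpredT F) (@big_cat_nat _ _ _ M) //= big_mkord.
rewrite [X in _ + X]big_nat [X in _ + X]big1 ?addr0 // => k /andP[Mk kM].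
exact: F0.
Qed.

(** The sum is a coefficient of the loop times its adjoint, for the shift [b + N - a], which is
    positive. *)
Lemma toep_overE a b : (a < N)%N -> (b < N)%N ->
  \sum_(c < N) toep a c *m (toep_over b c) ^t* = 0.
Proof.
move=> aN bN; have := TTs (b + N - a).
have /negPf -> : (b + N - a != 0)%N by rewrite subn_eq0 -ltnNge ltn_addl.
rewrite raddf0 => e; rewrite -[RHS]e.
rewrite (@sum_widen (fun c => toep a c *m (toep_over b c) ^t* ) a.+1) //; last first.
  by move=> c ac _; rewrite /toep leqNgt ac mul0mx.
rewrite (@sum_widen (fun k => T k *m (T (k + (b + N - a))) ^t* ) a.+1) //; last first.
  by move=> k ak _; rewrite (TN (_ : N <= k + _)%N) ?adjmx0 ?mulmx0 //; lia.
rewrite (reindex_inj rev_ord_inj) /=; apply: eq_bigr => k _.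
have ka := ltn_ord k; rewrite /toep /toep_over subSS leq_subr.
by congr (T _ *m (T _) ^t* ); lia.
Qed.

Lemma toep_isom_le a b : (a <= b)%N -> (b < N)%N ->
  \sum_(m < N + N) (toep m a) ^t* *m toep m b = (a == b)%:R%:M.
Proof.
move=> ab bN; have := congr1 (fun A : 'M[C]_n => A ^t* ) (TsT (b - a)).
have -> : (a == b) = (b - a == 0)%N by rewrite subn_eq0; apply/eqP/idP => [->|] //; lia.
have -> : (((b - a == 0)%N%:R%:M : 'M[C]_n) ^t* ) = (b - a == 0)%N%:R%:M.
  by case: eqP => _; rewrite ?raddf0 ?adjmx0 ?adjmx1.
move=> <-; rewrite raddf_sum /= raddf_sum /=.
rewrite -(big_mkord xpredT (fun m => (toep m a) ^t* *m toep m b)).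
rewrite (@big_cat_nat _ _ _ b) /=; [|lia|lia].
rewrite [X in X + _]big_nat [X in X + _]big1 ?add0r => [|m /andP[_ mb]]; last first.
  by rewrite /toep [(b <= m)%N]leqNgt mb mulmx0.
rewrite -{1}[b]add0n big_addn big_mkord.
rewrite (@sum_widen (fun k => (toep (k + b) a) ^t* *m toep (k + b) b) N); first last.
- move=> k Nk _; rewrite /toep leq_addl addnK (TN Nk) mulmx0 //.
- lia.
apply: eq_bigr => k _; rewrite adjmxM adjmxK /toep leq_addl addnK.
rewrite (leq_trans ab) ?leq_addl //; congr ((T _) ^t* *m _); lia.
Qed.

(** Since [b < N] and [T] vanishes from [N] on, the two blocks together contain all coefficients of
    [lambda^b] times the loop, and multiplication by a unitary loop is an isometry. *)
Lemma toep_isom a b : (a < N)%N -> (b < N)%N ->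
  \sum_(c < N) (toep c a) ^t* *m toep c b +
  \sum_(c < N) (toep_over c a) ^t* *m toep_over c b = (a == b)%:R%:M.
Proof.
move=> aN bN; rewrite [X in _ + X](_ : _ = \sum_(c < N) (toep (N + c) a) ^t* *m toep (N + c) b).
  have := @big_split_ord _ _ +%R N N xpredT (fun m : 'I_(N + N) => (toep m a) ^t* *m toep m b).
  move=> /= <-.
  have [ab|/ltnW ba] := leqP a b; first exact: toep_isom_le.
  have := congr1 (fun A : 'M[C]_n => A ^t* ) (toep_isom_le ba aN).
  have -> : (((b == a)%:R%:M : 'M[C]_n) ^t* ) = (a == b)%:R%:M.
    by rewrite eq_sym; case: eqP => _; rewrite ?raddf0 ?adjmx0 ?adjmx1.
  move=> <-; rewrite raddf_sum /= raddf_sum /=; apply: eq_bigr => m _.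
  by rewrite adjmxM adjmxK.
apply: eq_bigr => c _; rewrite /toep_over /toep [(c + N)%N]addnC.
by rewrite (ltnW (ltn_addr c aN)) (ltnW (ltn_addr c bN)).
Qed.

(** Multiply the relation of [toep_isom] by the Toeplitz matrix and discard the overflow. The
    orthogonal projection onto the range is then the matrix times its adjoint, which is smooth
    without any condition on ranks. *)
Lemma toep_pi : bmx N toep *m (bmx N toep) ^t* *m bmx N toep = bmx N toep.
Proof.
have e1 : bmx N toep *m (bmx N toep_over) ^t* = 0.
  by rewrite bmx_adj bmx_mul -(bmx0 N n); apply: bmx_ext => a b; exact: toep_overE.
have e2 : (bmx N toep) ^t* *m bmx N toep + (bmx N toep_over) ^t* *m bmx N toep_over = 1%:M.
  by rewrite !bmx_adj !bmx_mul bmxD -bmx1; apply: bmx_ext => a b; exact: toep_isom.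
have := congr1 (mulmx (bmx N toep)) e2.
by rewrite mulmxDr !mulmxA e1 mul0mx addr0 mulmx1.
Qed.

End Toeplitz.

Section LocalExtension.
Context {R : realType} (N' n : nat).
Local Notation C := (Cplx R).
Local Notation P := (R * R)%type.
Local Notation N := N'.+1.

(** [dbar], and [del] further on, are twice the usual operators; the factor is absorbed in the
    matrix [A] of the extended solution equation. *)
Definition dbar m k (F : P -> 'M[C]_(m, k)) x := Dmx ex F x + iC *: Dmx ey F x.

Lemma dbar_mul m k l U (F : P -> 'M[C]_(m, k)) (G : P -> 'M[C]_(k, l)) x : open U ->
  smooth_mx U F -> smooth_mx U G -> U x ->
  dbar (fun y => F y *m G y) x = dbar F x *m G x + F x *m dbar G x.
Proof.
move=> oU sF sG Ux; rewrite /dbar !(Dmx_mul _ oU sF sG Ux) scalerDr addrACA.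
by rewrite mulmxDl mulmxDr scalemxAl scalemxAr.
Qed.

Lemma dbar_cst m k (A : 'M[C]_(m, k)) x : dbar (fun=> A) x = 0.
Proof. by rewrite /dbar !Dmx_cst scaler0 addr0. Qed.

Lemma dbar_add m k U (F G : P -> 'M[C]_(m, k)) x :
  smooth_mx U F -> smooth_mx U G -> U x ->
  dbar (fun y => F y + G y) x = dbar F x + dbar G x.
Proof. by move=> sF sG Ux; rewrite /dbar !(Dmx_add _ sF sG Ux) scalerDr addrACA. Qed.

Lemma dbar_ext m k (F G : P -> 'M[C]_(m, k)) x : {near x, F =1 G} -> dbar F x = dbar G x.
Proof. by move=> FG; rewrite /dbar !(Dmx_ext _ FG). Qed.

Lemma dbar0_hol m k U (F : P -> 'M[C]_(m, k)) : smooth_mx U F ->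
  (forall x, U x -> dbar F x = 0) -> hol_mx U F.
Proof.
move=> sF dF i j; split => // x Ux.
have /matrixP/(_ i j) := dF x Ux; rewrite !mxE => /eqP; rewrite addr_eq0 => /eqP ->.
by rewrite mulrN mulrA iC2 mulN1r opprK.
Qed.

(** The frame [w x] lifts the fixed frame [w0] of the range at [a]: it lies in the range of [Pr x]
    and [Pr a] projects it onto [w0]. The hypothesis on [dbar TT] makes the range stable under
    [dbar], and this forces [w] to be holomorphic. [K] is the first block of [w]. *)
Lemma holomorphic_frame p U a (TT Pr AA : P -> 'M[C]_p) (E0 : 'M[C]_(p, n)) (T0 : P -> 'M[C]_n) :
  open U -> U a -> smooth_mx U TT ->
  (forall x, Pr x = TT x *m (TT x) ^t* ) ->
  (forall x, U x -> Pr x *m TT x = TT x) ->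
  (forall x, U x -> dbar TT x = TT x *m AA x) ->
  (forall x, E0 ^t* *m TT x = T0 x *m E0 ^t* ) ->
  (TT a *m E0) ^t* *m (TT a *m E0) = 1%:M ->
  exists V (K h : P -> 'M[C]_n), [/\ open V, V a, V `<=` U &
    [/\ hol_mx V K, smooth_mx V h, forall x, V x -> h x \in unitmx &
    forall x, V x -> K x = T0 x *m h x]].
Proof.
move=> oU Ua sTT PrE TTP dTT E0TT E0E.
have sTTs := smooth_mx_adj oU sTT.
have sPr : smooth_mx U Pr.
  by apply: smooth_mx_ext oU _ (smooth_mx_mul oU sTT sTTs) => x _; rewrite PrE.
have PP x : U x -> Pr x *m Pr x = Pr x.
  by move=> Ux; rewrite {2}PrE mulmxA TTP // -PrE.
have [w0 w0E] : exists w0, w0 = TT a *m E0 by exists (TT a *m E0).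
have C0w0 : Pr a *m w0 = w0 by rewrite w0E mulmxA TTP.
(* On the range of [Pr x] the matrix [S1 x] acts as [Pr a]; it is the identity at [a], hence
   invertible nearby, so [S1 x *m w x = w0] can be solved. *)
have [S1 S1E] : exists S1 : P -> 'M[C]_p, forall x, S1 x = 1%:M - Pr x + Pr a.
  by exists (fun x => 1%:M - Pr x + Pr a).
have [S2 S2E] : exists S2 : P -> 'M[C]_p, forall x, S2 x = 1%:M - Pr a + Pr x.
  by exists (fun x => 1%:M - Pr a + Pr x).
have sS1 : smooth_mx U S1.
  apply: (smooth_mx_ext oU (fun x _ => esym (S1E x))).
  apply: smooth_mx_add => //; last exact: smooth_mx_cst.
  by apply: smooth_mx_add; [|exact: smooth_mx_cst|exact: smooth_mx_opp].
have sS2 : smooth_mx U S2.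
  apply: (smooth_mx_ext oU (fun x _ => esym (S2E x))).
  by apply: smooth_mx_add => //; exact: smooth_mx_cst.
have S1a : S1 a = 1%:M by rewrite S1E subrK.
have n1 : \forall x \near a, S1 x \in unitmx.
  by apply: (unitmx_near oU Ua sS1); rewrite S1a unitmx1.
have n2 : \forall x \near a, S2 x \in unitmx.
  by apply: (unitmx_near oU Ua sS2); rewrite S2E subrK unitmx1.
have [V [oV Va VP]] := near_open (near_and (open_near oU Ua) (near_and n1 n2)).
have VU : V `<=` U by move=> x /VP[].
have V1 x : V x -> S1 x \in unitmx by move=> /VP[_ []].
have V2 x : V x -> S2 x \in unitmx by move=> /VP[_ []].
have [w wE] : exists w : P -> 'M[C]_(p, n), forall x, w x = invmx (S1 x) *m w0.
  by exists (fun x => invmx (S1 x) *m w0).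
have S1w x : V x -> S1 x *m w x = w0 by move=> /V1 u; rewrite wE mulKVmx.
have sS1V := smooth_mx_sub VU sS1.
have sw : smooth_mx V w.
  apply: (smooth_mx_ext oV (fun x _ => esym (wE x))).
  exact: smooth_mx_mul oV (smooth_invmx oV V1 sS1V) (smooth_mx_cst V w0).
have Prw x : V x -> Pr x *m w x = w x.
  move=> Vx; have Ux := VU x Vx.
  (* The defect [y] lies in the range of [Pr a] and in the kernel of [Pr x], so the invertible
     matrix [S2 x] kills it. *)
  have [y yw] : exists y, y = w x - Pr x *m w x by exists (w x - Pr x *m w x).
  have yE : y = w0 - Pr a *m w x.
    by rewrite -(S1w x Vx) S1E mulmxDl mulmxBl mul1mx addrK.
  have Py : Pr x *m y = 0 by rewrite yw mulmxBr mulmxA (PP x Ux) subrr.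
  have Cy : Pr a *m y = y by rewrite yE mulmxBr C0w0 [Pr a *m (Pr a *m _)]mulmxA (PP a Ua).
  have : S2 x *m y = 0 by rewrite S2E mulmxDl mulmxBl mul1mx Cy Py subrr add0r.
  move=> /(congr1 (mulmx (invmx (S2 x)))); rewrite mulKmx ?V2 // mulmx0 yw => /eqP.
  by rewrite subr_eq0 => /eqP.
have sPrV := smooth_mx_sub VU sPr.
have dw x : V x -> dbar w x = 0.
  move=> Vx; have Ux := VU x Vx.
  (* Both terms of the product rule have their values in the range. *)
  have dPr : dbar Pr x = Pr x *m dbar Pr x.
    have -> : dbar Pr x = TT x *m AA x *m (TT x) ^t* + TT x *m dbar (fun y => (TT y) ^t* ) x.
      rewrite -(dTT _ Ux) -(dbar_mul oU sTT sTTs Ux); apply: dbar_ext.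
      by apply: (@filterE _ (nbhs x)) => y; rewrite PrE.
    by rewrite mulmxDr !mulmxA TTP.
  have e1 : dbar w x = dbar Pr x *m w x + Pr x *m dbar w x.
    rewrite -(dbar_mul oV sPrV sw Vx); apply: dbar_ext.
    by have := open_near oV Vx; apply: filterS => y /Prw.
  have e2 : dbar Pr x *m w x = 0.
    apply: (addIr (Pr x *m dbar w x)); rewrite add0r -e1.
    by rewrite [in RHS]e1 mulmxDr !mulmxA -dPr PP.
  have e4 : dbar (fun y => S1 y *m w y) x = 0.
    rewrite -(dbar_cst w0 x); apply: dbar_ext.
    by have := open_near oV Vx; apply: filterS => y /S1w.
  have sN : smooth_mx V (fun y => -1%:M *m Pr y).
    exact: smooth_mx_mul oV (smooth_mx_cst V _) sPrV.
  have e5 : dbar S1 x = - dbar Pr x.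
    rewrite (@dbar_ext _ _ _ (fun y => -1%:M *m Pr y + (1%:M + Pr a))).
      rewrite (dbar_add sN (smooth_mx_cst V _) Vx) dbar_cst addr0.
      by rewrite (dbar_mul oV (smooth_mx_cst V _) sPrV Vx) dbar_cst mul0mx add0r mulNmx mul1mx.
    by apply: (@filterE _ (nbhs x)) => y; rewrite S1E mulNmx mul1mx addrA [- _ + _]addrC.
  move: e4; rewrite (dbar_mul oV sS1V sw Vx) e5 mulNmx e2 oppr0 add0r.
  by move=> /(congr1 (mulmx (invmx (S1 x)))); rewrite mulKmx ?V1 // mulmx0.
(* As [w] lies in the range of [Pr], it is [TT] applied to the adjoint of [TT] times [w]. Its first
   block is therefore [T0] times the matrix below, which is the identity at [a]. *)
have sh : smooth_mx V (fun x => E0 ^t* *m ((TT x) ^t* *m w x)).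
  apply: (smooth_mx_mul oV (smooth_mx_cst V _)).
  exact: smooth_mx_mul oV (smooth_mx_sub VU sTTs) sw.
have nh : \forall x \near a, E0 ^t* *m ((TT x) ^t* *m w x) \in unitmx.
  apply: (unitmx_near oV Va sh).
  by rewrite wE S1a invmx1 mul1mx w0E mulmxA -adjmxM E0E unitmx1.
have [Z [oZ Za ZP]] := near_open (near_and (open_near oV Va) nh).
have ZV : Z `<=` V by move=> x /ZP[].
exists Z, (fun x => E0 ^t* *m w x), (fun x => E0 ^t* *m ((TT x) ^t* *m w x)); split.
- exact: oZ.
- exact: Za.
- by move=> x /ZV /VU.
split.
- apply: (hol_mx_mul oZ (hol_mx_cst Z _)).
  exact: hol_mx_sub ZV (dbar0_hol sw dw).
- exact: smooth_mx_sub ZV sh.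
- by move=> x /ZP[].
by move=> x /ZV Vx; rewrite mulmxA -E0TT -mulmxA [TT x *m _]mulmxA -PrE Prw.
Qed.

Variables (U : set P) (a : P) (T : nat -> P -> 'M[C]_n) (A : P -> 'M[C]_n).
Hypotheses (oU : open U) (Ua : U a).
Hypothesis TN : forall k x, U x -> (N <= k)%N -> T k x = 0.
Hypothesis TsT : forall m x, U x -> \sum_(k < N) (T k x) ^t* *m T (k + m) x = (m == 0)%:R%:M.
Hypothesis TTs : forall m x, U x -> \sum_(k < N) T k x *m (T (k + m) x) ^t* = (m == 0)%:R%:M.
Hypothesis sT : forall k, smooth_mx U (T k).
Hypothesis dT0 : forall x, U x -> dbar (T 0) x = - (T 0 x *m A x).
Hypothesis dTS : forall k x, U x -> (k.+1 < N)%N ->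
  dbar (T k.+1) x = - (T k.+1 x *m A x) + T k x *m A x.

Let TT x := bmx N (toep (T ^~ x)).
Let Pr x := TT x *m (TT x) ^t*.
(** Multiplication by [(1 - lambda) A] on polynomials cut at degree [N]. *)
Let AA x := bmx N (fun c b => if c == b then A x else if c == b.+1 then - A x else 0).

Let TTP x : U x -> Pr x *m TT x = TT x.
Proof.
move=> Ux; apply: toep_pi => [k|m|m]; [exact: TN|exact: TsT|exact: TTs].
Qed.

Let sTT : smooth_mx U TT.
Proof.
move=> s t; rewrite /TT.
have H : smooth_mx U (fun x => toep (T ^~ x) (tagnat.sig1 s) (tagnat.sig1 t)).
  by rewrite /toep; case: leqP => _; [exact: sT|exact: smooth_mx_cst].
by apply: smooth_eq (H (tagnat.sig2 s) (tagnat.sig2 t)) => x; rewrite bmxE.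
Qed.

Let dTT x : U x -> dbar TT x = - (TT x *m AA x).
Proof.
move=> Ux.
have -> : dbar TT x = bmx N (fun a b => dbar (fun y => toep (T ^~ y) a b) x).
  apply/matrixP => s t; rewrite bmxE !mxE.
  by congr (_ + _ * _); apply: eq_Dc => y; rewrite bmxE.
rewrite bmx_mul bmxN; apply: bmx_ext => i j iN jN.
have -> : \sum_(c < N) toep (T^~ x) i c *m
    (if (c : nat) == j then A x else if (c : nat) == j.+1 then - A x else 0) =
    toep (T^~ x) i j *m A x - toep (T ^~ x) i j.+1 *m A x.
  rewrite (bigD1 (Ordinal jN)) //= eqxx; congr (_ + _).
  have [jN1|jN1] := ltnP j.+1 N; last first.
    have -> : toep (T ^~ x) i j.+1 = 0 by rewrite /toep leqNgt (leq_trans iN jN1).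
    rewrite mul0mx oppr0 big1 // => c; rewrite -val_eqE /= => /negPf ->.
    by rewrite ifN ?mulmx0 // neq_ltn (leq_trans (ltn_ord c) jN1).
  rewrite (bigD1 (Ordinal jN1)) /=; last by rewrite -val_eqE /= gtn_eqF.
  rewrite gtn_eqF // eqxx mulmxN big1 ?addr0 // => c; rewrite -!val_eqE /=.
  by move=> /andP[/negPf -> /negPf ->]; rewrite mulmx0.
rewrite opprB addrC /toep; have [ji|ij] := leqP j i; last first.
  by rewrite dbar_cst [(j < i)%N]ltnNge (ltnW ij) /= !mul0mx oppr0 addr0.
case: (ltngtP j i) ji => // [ji|->] _; last first.
  by rewrite mul0mx subnn addr0 dT0.
have -> : (i - j = (i - j.+1).+1)%N by lia.
by rewrite dTS //; lia.
Qed.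

(** The inclusion of the constants into the polynomials of degree below [N]. *)
Let E0 : 'M[C]_(\sum_(i < N) n, n) :=
  \mxcol_(i < N) (if (i : nat) == 0 then 1%:M else 0 : 'M[C]_n).

Let TTE0 x : TT x *m E0 = \mxcol_(i < N) T i x.
Proof.
rewrite /TT /E0 mul_mxblock_mxrow; apply: eq_mxcol => i.
rewrite (bigD1 ord0) //= mulmx1 /toep leq0n subn0 big1 ?addr0 // => c.
by rewrite -val_eqE /= => /negPf ->; rewrite mulmx0.
Qed.

Let E0TT x : E0 ^t* *m TT x = T 0 x *m E0 ^t*.
Proof.
apply: (can_inj (@adjmxK _ _ _)); rewrite !adjmxM !adjmxK bmx_adj /E0 mul_mxblock_mxrow.
rewrite mxcol_mul; congr (_^T); apply: eq_mxcol => i.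
rewrite (bigD1 ord0) //= mulmx1 /toep leqn0 big1 ?addr0 => [|c].
  by case: eqP => [->|_]; rewrite ?subn0 ?mul1mx // mul0mx adjmx0.
by rewrite -val_eqE /= => /negPf ->; rewrite mulmx0.
Qed.

Let E0E x : U x -> (TT x *m E0) ^t* *m (TT x *m E0) = 1%:M.
Proof.
move=> Ux; rewrite TTE0; have -> : (\mxcol_(i < N) T i x) ^t* = \mxrow_(i < N) ((T i x) ^t* ).
  by apply/matrixP => s t; rewrite !mxE.
rewrite mul_mxrow_mxcol; have := TsT 0 Ux; rewrite eqxx => <-.
by apply: eq_bigr => i _; rewrite addn0.
Qed.

Lemma T0_factor : exists V (K h : P -> 'M[C]_n), [/\ open V, V a, V `<=` U &
  [/\ hol_mx V K, smooth_mx V h, forall x, V x -> h x \in unitmx &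
    forall x, V x -> K x = T 0 x *m h x]].
Proof.
apply: (@holomorphic_frame _ U a TT Pr (fun x => - AA x) E0 (T 0) oU Ua sTT (fun=> erefl) TTP _ E0TT (E0E Ua)).
by move=> x Ux; rewrite dTT // mulmxN.
Qed.

(** [T 0] is [K] times an invertible matrix on the right, so the saturated frame of the rows of [K]
    becomes a frame for those of [T 0]. The projection is formed only after this change, since it
    does not commute with it. *)
Lemma local_extension : exists V (Q : P -> 'M[C]_n), [/\ open V, V a, V `<=` U, smooth_mx V Q &
  forall x, V x -> herm_proj (Q x) /\ (x <> a -> (Q x :=: T 0 x)%MS)].
Proof.
have [V [K [h [oV Va VU [hK sh uh KE]]]]] := T0_factor.
have [W [s [B [oW Wa WV hB BP]]]] := saturation oV Va hK.
pose D x := B x *m invmx (h x).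
have uW x : W x -> h x \in unitmx by move=> /WV /uh.
have fD x : W x -> row_free (D x).
  move=> Wx; have [fB _] := BP x Wx; rewrite /row_free mxrankMfree //.
  by rewrite row_free_unit unitmx_inv uW.
have sD : smooth_mx W D.
  apply: smooth_mx_mul => //; first exact: hol_mx_smooth.
  by apply: smooth_invmx => //; exact: smooth_mx_sub WV sh.
exists W, (fun x => gram_proj (D x)); split => //.
- by move=> x /WV /VU.
- have sDs := smooth_mx_adj oW sD.
  apply: smooth_mx_mul => //; apply: smooth_mx_mul => //; apply: smooth_invmx => //.
    by move=> x /fD; exact: gram_unitmx.
  exact: smooth_mx_mul.
move=> x Wx; have [p1 p2 p3] := gram_projP (fD x Wx); split => // xa.
apply: eqmx_trans p3 _; have [_ /(_ xa) KB] := BP x Wx.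
have -> : T 0 x = K x *m invmx (h x) by rewrite KE ?mulmxK ?uW //; exact: WV.
by apply: eqmx_sym; exact: eqmxMr.
Qed.

End LocalExtension.

(** * Topology of the complex plane and real coordinates on the surface *)

Section CplxTopology.
Context {R : realType}.
Local Notation C := (Cplx R).

Lemma normCE (z : C) : `|z| = mkC (cabs z) 0.
Proof. by rewrite normc_def. Qed.

Lemma ltCE (z w : C) : (z < w) = (imC w == imC z) && (reC z < reC w).
Proof. exact: ltcE. Qed.

(** Balls of [C] have complex radii; positivity forces the imaginary part to vanish, which gives
    back real radii. *)
Lemma nbhs_CplxP (z : C) (Q : set C) :
  nbhs z Q <-> exists2 e : R, 0 < e & forall w, cabs (w - z) < e -> Q w.
Proof.
split=> [/nbhs_ballP[e /= e0 zQ]|[e e0 H]].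
  move: e0; rewrite ltCE /= => /andP[/eqP ie re]; exists (reC e) => // w wz.
  apply: zQ; rewrite -ball_normE /ball_ /= normCE ltCE /= ie eqxx /= -cabsN.
  by rewrite opprB.
apply/nbhs_ballP; exists (mkC e 0); first by rewrite /= ltCE /= eqxx.
move=> w; rewrite -ball_normE /ball_ /= normCE ltCE /= eqxx /= => wz.
by apply: H; rewrite -cabsN opprB.
Qed.

Lemma mkC_continuous : continuous (fun x : R * R => mkC x.1 x.2 : C).
Proof.
move=> x Q /= /nbhs_CplxP[e e0 H]; apply/nbhs_ballP; exists (e / 2); first by rewrite /= divr_gt0.
move=> y; rewrite -ball_normE /ball_ /= distrC => xy; apply: H.
have := cabs_zeta x y; rewrite /zeta => /le_lt_trans; apply.
by rewrite -mulr_natr -ltr_pdivlMr.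
Qed.

Lemma reC_continuous : continuous (@reC R : C -> R).
Proof.
move=> z Q /nbhs_ballP[e /= e0 H]; apply/nbhs_CplxP; exists e => // w wz; apply: H.
by rewrite -ball_normE /ball_ /= distrC -reCN -reCD (le_lt_trans (cabs_re _)).
Qed.

Lemma imC_continuous : continuous (@imC R : C -> R).
Proof.
move=> z Q /nbhs_ballP[e /= e0 H]; apply/nbhs_CplxP; exists e => // w wz; apply: H.
by rewrite -ball_normE /ball_ /= distrC -imCN -imCD (le_lt_trans (cabs_im _)).
Qed.

End CplxTopology.

Section Charts.
Context {R : realType} (M : riemannSurface R).
Local Notation C := (Cplx R).
Local Notation P := (R * R)%type.

(** The chart is read in [R * R], where smoothness is defined: [rim] is its image, [rmap] and [rinv]
    the two directions. *)
Definition rim (c : chart R M) : set P := [set x | chart_im c setT (mkC x.1 x.2)].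
Definition rmap (c : chart R M) (p : M) : P := (reC (chart_map c p), imC (chart_map c p)).
Definition rinv (c : chart R M) (x : P) : M := chart_inv c (mkC x.1 x.2).

Variable c : chart R M.
Hypothesis cc : coordinate c.

Lemma rim_open : open (rim c).
Proof.
have [[_ oi _ _ _] _] := cc.
by apply: (open_comp (f := fun x : P => mkC x.1 x.2)) => // x _; exact: mkC_continuous.
Qed.

Lemma rmap_rim p : chart_dom c p -> rim c (rmap c p).
Proof. by move=> cp; rewrite /rim /rmap /= mkCE; exists p. Qed.

Lemma rmapK p : chart_dom c p -> rinv c (rmap c p) = p.
Proof. by move=> cp; rewrite /rinv /rmap /= mkCE; have [[_ _ H _ _] _] := cc; exact: H. Qed.

Lemma rinvP x : rim c x -> chart_dom c (rinv c x) /\ rmap c (rinv c x) = x.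
Proof.
move=> [p [cp _] px]; rewrite /rinv -px; have [[_ _ H _ _] _] := cc.
by rewrite H //; split => //; rewrite /rmap px; case: x {px}.
Qed.

Lemma rinv_cvg x : rim c x -> {for x, continuous (rinv c)}.
Proof.
move=> xr; have [[_ _ _ _ H] _] := cc.
have ci : {for mkC x.1 x.2, continuous (chart_inv c)} by exact: H.
exact: (@continuous_comp _ _ _ (fun x : P => mkC x.1 x.2) (chart_inv c) x (@mkC_continuous _ _) ci).
Qed.

Lemma rmap_cvg p : chart_dom c p -> {for p, continuous (rmap c)}.
Proof.
move=> cp; have [[_ _ _ H _] _] := cc; have ci := H p cp.
have c1 : {for p, continuous (fun q => reC (chart_map c q))}.
  exact: (@continuous_comp _ _ _ (chart_map c) (@reC R) p ci (@reC_continuous _ _)).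
have c2 : {for p, continuous (fun q => imC (chart_map c q))}.
  exact: (@continuous_comp _ _ _ (chart_map c) (@imC R) p ci (@imC_continuous _ _)).
exact: cvg_pair c1 c2.
Qed.

Lemma chart_dom_open : open (chart_dom c).
Proof. by have [[]] := cc. Qed.

Lemma near_rinv p (Q : set M) : chart_dom c p -> (\forall q \near p, Q q) ->
  \forall x \near rmap c p, rim c x /\ Q (rinv c x).
Proof.
move=> cp H; have rp := rmap_rim cp.
apply: near_and; first exact: open_near rim_open rp.
by have := rinv_cvg rp; rewrite /prop_for /continuous_at rmapK // => /(_ _ H).
Qed.

Lemma near_rmap p (Q : set P) : chart_dom c p -> (\forall x \near rmap c p, Q x) ->
  \forall q \near p, chart_dom c q /\ Q (rmap c q).
Proof.
move=> cp H; apply: near_and; first exact: open_near chart_dom_open cp.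
by have := rmap_cvg cp; apply.
Qed.

Lemma dnbhs_rinv p (Q : set M) : chart_dom c p -> (\forall q \near p^', Q q) ->
  \forall x \near (rmap c p)^', rim c x /\ Q (rinv c x).
Proof.
move=> cp H; have := near_rinv (Q := fun q => q != p -> Q q) cp H.
apply: filterS => x [rx Hx] xp; split => //; apply: Hx.
by apply: contra_neq xp => <-; have [_ ->] := rinvP rx.
Qed.

End Charts.

(** * Smooth maps on the surface *)

Section Manifold.
Context {R : realType} (M : riemannSurface R).
Local Notation C := (Cplx R).
Local Notation P := (R * R)%type.

Lemma atlas_coordinate (c : chart R M) : rs_atlas c -> coordinate c.
Proof.
move=> ac; split; first exact: rs_chart.
by move=> c' ac'; split; exact: rs_transition.
Qed.

Lemma coordinate_cover (p : M) : exists2 c : chart R M, coordinate c & chart_dom c p.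
Proof. by have [c /atlas_coordinate] := rs_cover p; exists c. Qed.

Definition smoothM m k (F : M -> 'M[C]_(m, k)) :=
  forall c, coordinate c -> smooth_mx (rim c) (fun x => F (rinv c x)).

Lemma smoothM_cst m k (A : 'M[C]_(m, k)) : smoothM (fun=> A).
Proof. by move=> c cc; exact: smooth_mx_cst. Qed.

Lemma smoothM_mul m k l (F : M -> 'M[C]_(m, k)) (G : M -> 'M[C]_(k, l)) :
  smoothM F -> smoothM G -> smoothM (fun p => F p *m G p).
Proof. by move=> sF sG c cc; apply: smooth_mx_mul (sF c cc) (sG c cc); exact: rim_open. Qed.

Lemma smoothM_add m k (F G : M -> 'M[C]_(m, k)) :
  smoothM F -> smoothM G -> smoothM (fun p => F p + G p).
Proof. by move=> sF sG c cc; apply: smooth_mx_add (sF c cc) (sG c cc); exact: rim_open. Qed.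

Lemma smoothM_opp m k (F : M -> 'M[C]_(m, k)) : smoothM F -> smoothM (fun p => - F p).
Proof. by move=> sF c cc; apply: smooth_mx_opp (sF c cc); exact: rim_open. Qed.

Lemma smoothM_scale m k (z : C) (F : M -> 'M[C]_(m, k)) : smoothM F -> smoothM (fun p => z *: F p).
Proof.
move=> sF c cc; apply: smooth_mx_scale (smooth_cst _ _) (sF c cc); exact: rim_open.
Qed.

Lemma smoothM_conj m k (F : M -> 'M[C]_(m, k)) : smoothM F ->
  smoothM (fun p => map_mx Num.conj (F p)).
Proof. by move=> sF c cc; apply: smooth_mx_conj (sF c cc); exact: rim_open. Qed.

Lemma smoothM_sum m k (I : Type) (r : seq I) (F : I -> M -> 'M[C]_(m, k)) :
  (forall i, smoothM (F i)) -> smoothM (fun p => \sum_(i <- r) F i p).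
Proof.
move=> sF c cc; apply: smooth_mx_sum => [|i _]; [exact: rim_open|exact: sF].
Qed.

Lemma off_discreteS (U : set M) (Q Q' : M -> Prop) : (forall p, Q p -> Q' p) ->
  off_discrete U Q -> off_discrete U Q'.
Proof. by move=> QQ H p Up; apply: filterS (H p Up). Qed.

Lemma off_discrete_and (U : set M) (Q Q' : M -> Prop) : off_discrete U Q ->
  off_discrete U Q' -> off_discrete U (fun p => Q p /\ Q' p).
Proof. by move=> H H' p Up; apply: filterI; [exact: H|exact: H']. Qed.

Lemma off_discrete_sub (U V : set M) (Q : M -> Prop) : V `<=` U ->
  off_discrete U Q -> off_discrete V Q.
Proof. by move=> VU H p /VU; exact: H. Qed.

Lemma off_discrete_all (I : finType) (U : set M) (Q : I -> M -> Prop) :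
  (forall i, off_discrete U (Q i)) -> off_discrete U (fun p => forall i, Q i p).
Proof. by move=> H p Up; apply: filter_forall => i; exact: H. Qed.

(** Exceptional points are isolated and points are closed, so the property holds on whole
    neighbourhoods off a discrete set. This is what allows it to be differentiated. *)
Lemma off_discrete_near (U : set M) (Q : M -> Prop) : open U -> off_discrete U Q ->
  off_discrete U (fun p => U p /\ \forall q \near p, Q q).
Proof.
move=> oU H p Up; have [W [oW Wp WQ]] := near_open (H p Up : \forall q \near p, q != p -> Q q).
have op : open (~` [set p]).
  apply: closed_openC; apply: compact_closed; last exact: compact_set1.
  exact: rs_hausdorff.
apply: filterS (near_and (open_near oW Wp) (open_near oU Up)) => q [Wq Uq] qp; split => //.
have nq : (~` [set p]) q by apply/eqP.
by apply: filterS (near_and (open_near oW Wq) (open_near op nq)) => q' [/WQ H' /eqP].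
Qed.

Lemma chart_smooth_eq0 (c : chart R M) m k (G : P -> 'M[C]_(m, k)) (p : M) :
  coordinate c -> chart_dom c p -> smooth_mx (rim c) G ->
  (\forall q \near p^', chart_dom c q -> G (rmap c q) = 0) -> G (rmap c p) = 0.
Proof.
move=> cc cp sG H; apply/matrixP => a b; rewrite mxE.
apply: (smooth_dnbhs0 (sG a b) (rmap_rim cp)).
apply: filterS (dnbhs_rinv cc cp H) => x [rx Hx].
by have [dx e] := rinvP cc rx; rewrite -e Hx // mxE.
Qed.

(** Reduces an identity between smooth maps to the points where the projection in question spans the
    expected row space. *)
Lemma smoothM_eq0 m k (F : M -> 'M[C]_(m, k)) : smoothM F ->
  off_discrete setT (fun p => F p = 0) -> forall p, F p = 0.
Proof.
move=> sF H p; have [c cc cp] := coordinate_cover p.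
rewrite -(rmapK cc cp); apply: (chart_smooth_eq0 (G := fun x => F (rinv c x)) cc cp (sF c cc)).
by apply: filterS (H p I) => q Fq cq; rewrite rmapK.
Qed.

Lemma mx_dzE m k (c : chart R M) (F : M -> 'M[C]_(m, k)) (p : M) :
  mx_dz c F p = 2^-1 *: (Dmx ex (fun x => F (rinv c x)) (rmap c p) -
    iC *: Dmx ey (fun x => F (rinv c x)) (rmap c p)).
Proof. by apply/matrixP => a b; rewrite !mxE mulrC. Qed.

End Manifold.

(** * Laurent polynomials on the circle and polynomial loops *)

Section Laurent.
Context {R : realType}.
Local Notation C := (Cplx R).
Implicit Types l : circle R.

Lemma circle_neq0 l : val l != 0.
Proof. by have /eqP := valP l; apply: contra_eq_neq => ->; rewrite normr0 eq_sym oner_eq0. Qed.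

Lemma circle_conj l : Num.conj (val l) = (val l)^-1.
Proof.
apply: (mulfI (circle_neq0 l)); rewrite mulfV ?circle_neq0 // -normCK.
by have /eqP -> := valP l; rewrite expr1n.
Qed.

Lemma circle_conjX l k : Num.conj (val l ^+ k) = (val l) ^- k.
Proof. by rewrite rmorphXn /= circle_conj exprVn. Qed.

(** Infinitely many points with arguments in [[0, pi]], where [cos] is injective: enough to
    determine a polynomial. *)
Definition circle_pt (k : nat) : circle R := cis (k.+1%:R)^-1.

Lemma circle_pt_inj : injective (fun k => val (circle_pt k)).
Proof.
move=> j k /= [jk _]; have H i : (i.+1%:R : R)^-1 \in `[0, pi].
  rewrite in_itv /= invr_ge0 ler0n /=; apply: (@le_trans _ _ 1); last by apply: le_trans (pi_ge2 R); rewrite ler1n.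
  by rewrite invf_le1 ?ltr0n // ler1n.
have /(congr1 GRing.inv) := cos_inj (H j) (H k) jk; rewrite !invrK => /eqP.
by rewrite eqr_nat => /eqP [].
Qed.

Lemma poly_circle0 (p : {poly C}) : (forall l, p.[val l] = 0) -> p = 0.
Proof.
move=> H; apply/eqP/negPn/negP => p0.
have := @max_poly_roots _ p [seq val (circle_pt k) | k <- iota 0 (size p)] p0.
rewrite size_map size_iota ltnn => X; suff: false by []; apply: X.
  by apply/allP => z /mapP[k _ ->]; rewrite /root H.
by rewrite map_inj_uniq ?iota_uniq //; exact: circle_pt_inj.
Qed.

(** Terms are indexed by any finite type and exponents may repeat, so that products of two sums,
    indexed by pairs, are compared without being collected first. *)
Lemma laurent_coef (I : finType) m k (e : I -> nat) (B : I -> 'M[C]_(m, k)) :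
  (forall l, \sum_i val l ^+ e i *: B i = 0) -> forall j, \sum_(i | e i == j) B i = 0.
Proof.
move=> H j; apply/matrixP => a b; rewrite mxE summxE.
have : \sum_i B i a b *: 'X^(e i) = 0 :> {poly C}.
  apply: poly_circle0 => l; have /matrixP/(_ a b) := H l; rewrite summxE mxE => <-.
  by rewrite horner_sum; apply: eq_bigr => i _; rewrite hornerZ hornerXn mxE mulrC.
move=> /(congr1 (fun p : {poly C} => p`_j)); rewrite coef_sum coef0 => E0; rewrite -[RHS]E0.
rewrite big_mkcond; apply: eq_bigr => i _; rewrite coefZ coefXn eq_sym.
by case: eqP => _; rewrite ?mulr1 ?mulr0.
Qed.

Lemma laurent_eq (I J : finType) m k (e : I -> nat) (B : I -> 'M[C]_(m, k))
    (f : J -> nat) (D : J -> 'M[C]_(m, k)) :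
  (forall l, \sum_i val l ^+ e i *: B i = \sum_j val l ^+ f j *: D j) ->
  forall t, \sum_(i | e i == t) B i = \sum_(j | f j == t) D j.
Proof.
move=> H t.
have := @laurent_coef (I + J)%type m k (fun s => match s with inl i => e i | inr j => f j end)
  (fun s => match s with inl i => B i | inr j => - D j end).
move=> /(_ _ t); rewrite !big_sumType /= sumrN => /(_ _)/eqP; rewrite subr_eq0 => X.
apply/eqP; apply: X => l; rewrite big_sumType /= H -[RHS](subrr (\sum_j val l ^+ f j *: D j)).
by congr (_ + _); rewrite -sumrN; apply: eq_bigr => j _; rewrite scalerN.
Qed.

End Laurent.

Section AdjointLinear.
Context {R : realType}.
Local Notation C := (Cplx R).

Lemma adjmxZ m k (z : C) (A : 'M[C]_(m, k)) : (z *: A) ^t* = Num.conj z *: A ^t*.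
Proof. by apply/matrixP => a b; rewrite !mxE rmorphM. Qed.

Lemma adjmx_sum m k (I : Type) (r : seq I) (F : I -> 'M[C]_(m, k)) :
  (\sum_(i <- r) F i) ^t* = \sum_(i <- r) (F i) ^t*.
Proof.
elim: r => [|i r IH]; first by rewrite !big_nil adjmx0.
by rewrite !big_cons adjmxD IH.
Qed.

End AdjointLinear.

Section PolyLoop.
Context {R : realType} (n : nat).
Local Notation C := (Cplx R).
Implicit Types (l : circle R) (T : nat -> 'M[C]_n).

Definition ploop i T : loop R n := fun l => \sum_(k < i.+1) val l ^+ k *: T k.

Lemma ploop_adj i T l : (ploop i T l) ^t* = \sum_(k < i.+1) (val l) ^- k *: (T k) ^t*.
Proof.
rewrite /ploop adjmx_sum; apply: eq_bigr => k _.
by rewrite adjmxZ circle_conjX.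
Qed.

Lemma ploop_inj i T T' : (forall l, ploop i T l = ploop i T' l) ->
  forall k, (k <= i)%N -> T k = T' k.
Proof.
move=> H k ki.
have := @laurent_eq _ 'I_i.+1 'I_i.+1 _ _ (fun j => val j) (fun j => T j) (fun j => val j) (fun j => T' j) H k.
have E (T0 : nat -> 'M[C]_n) : \sum_(j < i.+1 | val j == k) T0 j = T0 k.
  by rewrite (big_pred1 (Ordinal (ki : (k < i.+1)%N))).
by rewrite !E.
Qed.

Variables (i : nat) (T : nat -> 'M[C]_n).
Hypothesis Ti : forall k, (i < k)%N -> T k = 0.
Hypothesis uT : forall l, (ploop i T l) ^t* *m ploop i T l = 1%:M.

(** The unitarity relation is multiplied by [lambda^i] to clear negative powers, and the
    coefficients of [lambda^(i + m)] are compared. *)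
Lemma ploop_TsT m : \sum_(k < i.+1) (T k) ^t* *m T (k + m) = (m == 0)%:R%:M.
Proof.
have H l : \sum_(ab : 'I_i.+1 * 'I_i.+1) val l ^+ (i - ab.1 + ab.2) *: ((T ab.1) ^t* *m T ab.2) =
    \sum_(u : 'I_1) val l ^+ i *: 1%:M.
  rewrite big_ord1 -(uT l) ploop_adj mulmx_suml scaler_sumr.
  rewrite -(pair_bigA _ (fun a b : 'I_i.+1 => val l ^+ (i - a + b) *: ((T a) ^t* *m T b))) /=.
  apply: eq_bigr => a _; rewrite mulmx_sumr scaler_sumr; apply: eq_bigr => b _.
  rewrite -scalemxAl -scalemxAr !scalerA; congr (_ *: _).
  by rewrite exprD; congr (_ * _); rewrite exprB ?unitfE; [|rewrite -ltnS|exact: circle_neq0].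
have := laurent_eq H (i + m)%N.
rewrite [RHS](_ : _ = (m == 0)%:R%:M); last first.
  rewrite big_mkcond big_ord1 -[X in X == _]addn0 eqn_add2l eq_sym.
  by case: eqP => _ //; rewrite raddf0.
move=> <-; rewrite -(pair_big_dep xpredT (fun a b : 'I_i.+1 => i - a + b == i + m)%N
   (fun a b => (T a) ^t* *m T b)) /=.
apply: eq_bigr => a _; have ai := ltn_ord a.
have E (b : 'I_i.+1) : (i - a + b == i + m)%N = (b == a + m :> nat)%N by apply/eqP/eqP; lia.
under eq_bigl do rewrite E.
have [am|am] := ltnP (a + m) i.+1.
  by rewrite (big_pred1 (Ordinal am)).
rewrite (Ti am) mulmx0 big_pred0 // => b; apply/eqP => bE; have := ltn_ord b; lia.
Qed.

Lemma ploop_TTs m : \sum_(k < i.+1) T k *m (T (k + m)) ^t* = (m == 0)%:R%:M.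
Proof.
have H l : \sum_(ab : 'I_i.+1 * 'I_i.+1) val l ^+ (i + ab.1 - ab.2) *: (T ab.1 *m (T ab.2) ^t* ) =
    \sum_(u : 'I_1) val l ^+ i *: 1%:M.
  rewrite big_ord1 -(mulmx1C (uT l)) ploop_adj mulmx_suml scaler_sumr.
  rewrite -(pair_bigA _ (fun a b : 'I_i.+1 => val l ^+ (i + a - b) *: (T a *m (T b) ^t* ))) /=.
  apply: eq_bigr => a _; rewrite mulmx_sumr scaler_sumr; apply: eq_bigr => b _.
  rewrite -scalemxAl -scalemxAr !scalerA; congr (_ *: _).
  by rewrite exprB ?unitfE ?exprD; [|have := ltn_ord b; lia|exact: circle_neq0].
have [mi|im] := leqP m i; last first.
  rewrite gtn_eqF; last by apply: leq_ltn_trans im.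
  rewrite raddf0 big1 // => k _; have -> : T (k + m) = 0 by apply: Ti; lia.
  by rewrite adjmx0 mulmx0.
have := laurent_eq H (i - m)%N.
rewrite [RHS](_ : _ = (m == 0)%:R%:M); last first.
  rewrite big_mkcond big_ord1; have -> : (i == i - m)%N = (m == 0)%N by apply/eqP/eqP; lia.
  by case: eqP => _ //; rewrite raddf0.
move=> <-; rewrite -(pair_big_dep xpredT (fun a b : 'I_i.+1 => i + a - b == i - m)%N
   (fun a b => T a *m (T b) ^t* )) /=.
apply: eq_bigr => a _; have ai := ltn_ord a.
have E (b : 'I_i.+1) : (i + a - b == i - m)%N = (b == a + m :> nat)%N.
  by have bi := ltn_ord b; apply/eqP/eqP; lia.
under eq_bigl do rewrite E.
have [am|am] := ltnP (a + m) i.+1.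
  by rewrite (big_pred1 (Ordinal am)).
rewrite (Ti am) adjmx0 mulmx0 big_pred0 // => b; apply/eqP => bE; have := ltn_ord b; lia.
Qed.

End PolyLoop.

Section Del.
Context {R : realType}.
Local Notation C := (Cplx R).
Local Notation P := (R * R)%type.

Definition del m k (F : P -> 'M[C]_(m, k)) x := Dmx ex F x - iC *: Dmx ey F x.

Lemma del_mul m k l U (F : P -> 'M[C]_(m, k)) (G : P -> 'M[C]_(k, l)) x : open U ->
  smooth_mx U F -> smooth_mx U G -> U x ->
  del (fun y => F y *m G y) x = del F x *m G x + F x *m del G x.
Proof.
move=> oU sF sG Ux; rewrite /del !(Dmx_mul _ oU sF sG Ux) scalerDr opprD addrACA.
by rewrite mulmxBl mulmxBr scalemxAl scalemxAr.
Qed.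

Lemma del_cst m k (A : 'M[C]_(m, k)) x : del (fun=> A) x = 0.
Proof. by rewrite /del !Dmx_cst scaler0 subr0. Qed.

Lemma del_add m k U (F G : P -> 'M[C]_(m, k)) x :
  smooth_mx U F -> smooth_mx U G -> U x ->
  del (fun y => F y + G y) x = del F x + del G x.
Proof. by move=> sF sG Ux; rewrite /del !(Dmx_add _ sF sG Ux) scalerDr opprD addrACA. Qed.

Lemma eq_del m k (F G : P -> 'M[C]_(m, k)) x : F =1 G -> del F x = del G x.
Proof. by move=> /funext ->. Qed.

Lemma eq_dbar m k (F G : P -> 'M[C]_(m, k)) x : F =1 G -> dbar F x = dbar G x.
Proof. by move=> /funext ->. Qed.

Lemma conj_iC : Num.conj (iC : C) = - iC.
Proof. by apply: Cplx_ext; rewrite ?reC_conj ?imC_conj ?reCN ?imCN /= ?oppr0. Qed.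

Lemma del_conj m k U (F : P -> 'M[C]_(m, k)) x : smooth_mx U F -> U x ->
  del (fun y => map_mx Num.conj (F y)) x = map_mx Num.conj (dbar F x).
Proof.
move=> sF Ux; rewrite /del /dbar !(Dmx_conj _ sF Ux).
by rewrite map_mxD map_mxZ /= conj_iC scaleNr.
Qed.

Lemma del_adj m k U (F : P -> 'M[C]_(m, k)) x : smooth_mx U F -> U x ->
  del (fun y => (F y) ^t* ) x = (dbar F x) ^t*.
Proof.
move=> sF Ux; rewrite (del_conj (smooth_mx_tr sF) Ux); congr (map_mx _ _).
by rewrite /dbar !Dmx_tr linearD linearZ.
Qed.

Lemma del_scale m k U (z : C) (F : P -> 'M[C]_(m, k)) x : open U -> smooth_mx U F -> U x ->
  del (fun y => z *: F y) x = z *: del F x.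
Proof.
move=> oU sF Ux; have := del_mul oU (smooth_mx_cst U z%:M) sF Ux.
rewrite del_cst mul0mx add0r mul_scalar_mx => <-; apply: eq_del => y.
by rewrite mul_scalar_mx.
Qed.

Lemma dbar_scale m k U (z : C) (F : P -> 'M[C]_(m, k)) x : open U -> smooth_mx U F -> U x ->
  dbar (fun y => z *: F y) x = z *: dbar F x.
Proof.
move=> oU sF Ux; have := dbar_mul oU (smooth_mx_cst U z%:M) sF Ux.
rewrite dbar_cst mul0mx add0r mul_scalar_mx => <-.
by apply: dbar_ext; apply: (@filterE _ (nbhs x)) => y; rewrite mul_scalar_mx.
Qed.

Lemma del_sum m k U (I : Type) (r : seq I) (F : I -> P -> 'M[C]_(m, k)) x : open U ->
  (forall i, smooth_mx U (F i)) -> U x ->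
  del (fun y => \sum_(i <- r) F i y) x = \sum_(i <- r) del (F i) x.
Proof.
move=> oU sF Ux; elim: r => [|i r IH].
  by rewrite big_nil (eq_del _ (fun y => big_nil _ _ _ _)) del_cst.
rewrite big_cons -IH -(del_add (sF i) _ Ux); last exact: smooth_mx_sum.
by apply: eq_del => y; rewrite big_cons.
Qed.

Lemma dbar_sum m k U (I : Type) (r : seq I) (F : I -> P -> 'M[C]_(m, k)) x : open U ->
  (forall i, smooth_mx U (F i)) -> U x ->
  dbar (fun y => \sum_(i <- r) F i y) x = \sum_(i <- r) dbar (F i) x.
Proof.
move=> oU sF Ux; elim: r => [|i r IH].
  by rewrite big_nil (eq_dbar _ (fun y => big_nil _ _ _ _)) dbar_cst.
rewrite big_cons -IH -(dbar_add (sF i) _ Ux); last exact: smooth_mx_sum.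
by apply: dbar_ext; apply: (@filterE _ (nbhs x)) => y; rewrite big_cons.
Qed.

End Del.

(** * Extended solutions *)

Section ExtSol.
Context {R : realType} {M : riemannSurface R} {n : nat}.
Local Notation C := (Cplx R).
Local Notation P := (R * R)%type.
Implicit Types (T : nat -> M -> 'M[C]_n) (c : chart R M).

(** An extended solution given by its coefficients. Since they vanish beyond degree [i], the loops
    determine the whole family, and shifted indices need no case distinction. *)
Definition ext_sol i T := [/\ forall k p, (i < k)%N -> T k p = 0,
  forall k, smoothM (T k),
  forall p l, (ploop i (T ^~ p) l) ^t* *m ploop i (T ^~ p) l = 1%:M,
  forall p, ploop i (T ^~ p) (@circle1 R) = 1%:M &
  forall c, coordinate c -> forall x, rim c x -> exists A, forall l,
    del (fun y => ploop i (T ^~ (rinv c y)) l) x =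
    (1 - (val l)^-1) *: (ploop i (T ^~ (rinv c x)) l *m A)].

Section Coefs.
Variables (i : nat) (T : nat -> M -> 'M[C]_n) (c : chart R M).
Hypotheses (esT : ext_sol i T) (cc : coordinate c).

Let Ti k p : (i < k)%N -> T k p = 0. Proof. by have [H _ _ _ _] := esT; exact: H. Qed.
Let sT k : smoothM (T k). Proof. by have [_ H _ _ _] := esT. Qed.
Let uT p l : (ploop i (T ^~ p) l) ^t* *m ploop i (T ^~ p) l = 1%:M.
Proof. by have [_ _ H _ _] := esT. Qed.

Let ro := rim_open cc.

Lemma ploop_smooth l : smooth_mx (rim c) (fun y => ploop i (T ^~ (rinv c y)) l).
Proof.
apply: smooth_mx_sum => // k _; apply: smooth_mx_scale => //; first exact: smooth_cst.
exact: sT.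
Qed.

Lemma del_ploop l x : rim c x -> del (fun y => ploop i (T ^~ (rinv c y)) l) x =
  \sum_(k < i.+1) val l ^+ k *: del (fun y => T k (rinv c y)) x.
Proof.
move=> rx; rewrite (del_sum _ ro _ rx); last first.
  by move=> k; apply: smooth_mx_scale => //; [exact: smooth_cst|exact: sT].
by apply: eq_bigr => k _; rewrite (del_scale _ ro (sT k cc) rx).
Qed.

Lemma dbar_ploop l x : rim c x -> dbar (fun y => ploop i (T ^~ (rinv c y)) l) x =
  \sum_(k < i.+1) val l ^+ k *: dbar (fun y => T k (rinv c y)) x.
Proof.
move=> rx; rewrite (dbar_sum _ ro _ rx); last first.
  by move=> k; apply: smooth_mx_scale => //; [exact: smooth_cst|exact: sT].
by apply: eq_bigr => k _; rewrite (dbar_scale _ ro (sT k cc) rx).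
Qed.

(** Differentiating the unitarity relation gives [del] of the adjoint loop, and adjunction turns
    [del] into [dbar]; on the circle it turns [1 - lambda^-1] into [1 - lambda]. *)
Lemma dbar_ploopE x A : rim c x -> (forall l,
    del (fun y => ploop i (T ^~ (rinv c y)) l) x =
    (1 - (val l)^-1) *: (ploop i (T ^~ (rinv c x)) l *m A)) -> forall l,
  dbar (fun y => ploop i (T ^~ (rinv c y)) l) x =
  - (1 - val l) *: (ploop i (T ^~ (rinv c x)) l *m A ^t* ).
Proof.
move=> rx H l; set F := fun y => ploop _ _ _; have sF : smooth_mx (rim c) F by exact: ploop_smooth.
have sFs := smooth_mx_adj ro sF.
have : del (fun y => (F y) ^t* *m F y) x = 0.
  by rewrite -(del_cst 1%:M x); apply: eq_del => y; rewrite uT.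
rewrite (del_mul ro sFs sF rx) (H l) => E.
have {}E : del (fun y => (F y) ^t* ) x = - (1 - (val l)^-1) *: (A *m (F x) ^t* ).
  rewrite -[LHS]mulmx1 -(mulmx1C (uT (rinv c x) l)) mulmxA.
  move/eqP: E; rewrite addr_eq0 => /eqP ->; rewrite mulNmx scaleNr; congr (- _).
  by rewrite -scalemxAr -scalemxAl; congr (_ *: _); rewrite !mulmxA uT mul1mx.
rewrite -[LHS]adjmxK -(del_adj sF rx) E adjmxZ adjmxM adjmxK; congr (_ *: _).
by rewrite rmorphN rmorphB rmorph1 fmorphV /= circle_conj invrK.
Qed.

(** The relation for [T 0] comes from the power [lambda^-1], which occurs on the right side of the
    equation only. *)
Lemma coef_del x A : rim c x -> (forall l,
    del (fun y => ploop i (T ^~ (rinv c y)) l) x =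
    (1 - (val l)^-1) *: (ploop i (T ^~ (rinv c x)) l *m A)) ->
  T 0 (rinv c x) *m A = 0 /\ forall k,
  del (fun y => T k (rinv c y)) x = T k (rinv c x) *m A - T k.+1 (rinv c x) *m A.
Proof.
move=> rx H; pose t k := T k (rinv c x); pose d k := del (fun y => T k (rinv c y)) x.
have E := @laurent_coef R ('I_i.+1 + 'I_i.+1)%type n n
  (fun s => match s with inl k => k.+1 | inr k => val k end)
  (fun s => match s with inl k => d k - t k *m A | inr k => t k *m A end).
have {}E : forall j, \sum_(k < i.+1 | k.+1 == j) (d k - t k *m A) +
    \sum_(k < i.+1 | val k == j) t k *m A = 0.
  move=> j; have := E _ j; rewrite big_sumType; apply => l; rewrite big_sumType /=.
  have := H l; rewrite del_ploop // => /(congr1 (fun B => val l *: B)).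
  rewrite scalerA mulrBr mulr1 mulfV ?circle_neq0 // scalerBl scale1r scaler_sumr => e.
  rewrite (eq_bigr (fun k : 'I_i.+1 => val l *: (val l ^+ k *: d k) -
     val l *: (val l ^+ k *: (t k *m A)))); last first.
    by move=> k _; rewrite -scalerBr -scalerBr scalerA exprS.
  rewrite sumrB e -[in X in _ - X]scaler_sumr.
  rewrite (_ : \sum_(k < i.+1) val l ^+ k *: (t k *m A) = ploop i (T ^~ (rinv c x)) l *m A); last first.
    by rewrite mulmx_suml; apply: eq_bigr => k _; rewrite scalemxAl.
  by rewrite [X in X + _ = _]addrAC subrr add0r addNr.
split.
  have := E 0; rewrite big_pred0 // add0r (big_pred1 (ord0 : 'I_i.+1)) //.
move=> k; have [ki|ik] := leqP k i; last first.
  rewrite (Ti _ ik) (Ti _ (ltnW ik : (i < k.+1)%N)) mul0mx subrr.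
  by rewrite (eq_del _ (fun y => Ti (rinv c y) ik)) del_cst.
have := E k.+1; rewrite (big_pred1 (Ordinal (ki : (k < i.+1)%N))) //.
move/eqP; rewrite addrAC subr_eq0 /= => /eqP <-.
have [ki1|ik] := ltnP k i.
  by rewrite (big_pred1 (Ordinal (ki1 : (k.+1 < i.+1)%N))) //= addrK.
rewrite big_pred0; first by rewrite Ti ?mul0mx ?subr0 ?addr0.
by move=> j; apply/eqP => /= jk; have := ltn_ord j; lia.
Qed.

Lemma coef_dbar x A : rim c x -> (forall l,
    del (fun y => ploop i (T ^~ (rinv c y)) l) x =
    (1 - (val l)^-1) *: (ploop i (T ^~ (rinv c x)) l *m A)) ->
  dbar (fun y => T 0 (rinv c y)) x = - (T 0 (rinv c x) *m A ^t* ) /\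
  forall k, (k < i)%N -> dbar (fun y => T k.+1 (rinv c y)) x =
     - (T k.+1 (rinv c x) *m A ^t* ) + T k (rinv c x) *m A ^t*.
Proof.
move=> rx H; pose t k := T k (rinv c x); pose d k := dbar (fun y => T k (rinv c y)) x.
have E := @laurent_coef R ('I_i.+1 + 'I_i.+1)%type n n
  (fun s => match s with inl k => val k | inr k => k.+1 end)
  (fun s => match s with inl k => d k + t k *m A ^t* | inr k => - (t k *m A ^t* ) end).
have {}E : forall j, \sum_(k < i.+1 | val k == j) (d k + t k *m A ^t* ) +
    \sum_(k < i.+1 | k.+1 == j) - (t k *m A ^t* ) = 0.
  move=> j; have := E _ j; rewrite big_sumType; apply => l; rewrite big_sumType /=.
  have := dbar_ploopE rx H l; rewrite dbar_ploop // => e.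
  rewrite (eq_bigr (fun k : 'I_i.+1 => val l ^+ k *: d k + val l ^+ k *: (t k *m A ^t* ))); last first.
    by move=> k _; rewrite scalerDr.
  rewrite big_split /= e.
  rewrite (_ : \sum_(k < i.+1) val l ^+ k *: (t k *m A ^t* ) =
      ploop i (T ^~ (rinv c x)) l *m A ^t* ); last first.
    by rewrite mulmx_suml; apply: eq_bigr => k _; rewrite scalemxAl.
  rewrite (_ : \sum_(k < i.+1) _ = - (val l *: (ploop i (T ^~ (rinv c x)) l *m A ^t* ))); last first.
    rewrite mulmx_suml scaler_sumr -sumrN; apply: eq_bigr => k _.
    by rewrite -scalemxAl scalerA -exprS scalerN.
  by rewrite opprB scalerBl scale1r addrNK subrr.
split.
  have := E 0; rewrite [X in _ + X]big_pred0 // addr0 (big_pred1 (ord0 : 'I_i.+1)) //.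
  by move/eqP; rewrite addr_eq0 => /eqP.
move=> k ki; have := E k.+1.
rewrite (big_pred1 (Ordinal (ki : (k.+1 < i.+1)%N))) // (big_pred1 (Ordinal (ltnW ki : (k < i.+1)%N))) //=.
by move/eqP; rewrite subr_eq0 => /eqP <-; rewrite addrC addrK.
Qed.

(** Solving for [A] by unitarity. The matrix is given separately at each point; this formula shows
    that it is smooth. *)
Lemma coef_A x A : rim c x -> (forall l,
    del (fun y => ploop i (T ^~ (rinv c y)) l) x =
    (1 - (val l)^-1) *: (ploop i (T ^~ (rinv c x)) l *m A)) ->
  A = \sum_(k < i.+1) (T k (rinv c x)) ^t* *m del (fun y => T k (rinv c y)) x.
Proof.
move=> rx H; have [_ E] := coef_del rx H.
under eq_bigr => k _ do rewrite E mulmxBr !mulmxA.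
have U := @ploop_TsT R n i (T ^~ (rinv c x)) (fun k => Ti _) (uT _).
have U0 : \sum_(k < i.+1) (T k (rinv c x)) ^t* *m T k (rinv c x) = 1%:M.
  by rewrite -[RHS](U 0); apply: eq_bigr => k _; rewrite addn0.
have U1 : \sum_(k < i.+1) (T k (rinv c x)) ^t* *m T k.+1 (rinv c x) = 0.
  have := U 1; rewrite raddf0 => e; rewrite -[RHS]e.
  by apply: eq_bigr => k _; rewrite addn1.
by rewrite sumrB -!mulmx_suml U0 U1 mul0mx subr0 mul1mx.
Qed.

End Coefs.

End ExtSol.

Section HermProj.
Context {R : realType}.
Local Notation C := (Cplx R).

Lemma herm_proj_sub n m (A : 'M[C]_n) (B : 'M[C]_(m, n)) : herm_proj A ->
  reflect (B *m A = B) (B <= A)%MS.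
Proof.
move=> [_ AA]; apply: (iffP idP) => [/submxP[D ->]|<-]; last exact: submxMl.
by rewrite -mulmxA AA.
Qed.

Lemma herm_proj_uniq n (A B : 'M[C]_n) : herm_proj A -> herm_proj B -> (A :=: B)%MS -> A = B.
Proof.
move=> hA hB AB.
have /(herm_proj_sub _ hB) e1 : (A <= B)%MS by rewrite AB.
have /(herm_proj_sub _ hA) e2 : (B <= A)%MS by rewrite AB.
by have [aA _] := hA; have [aB _] := hB; rewrite -e1 -[A]aA -[B]aB -adjmxM e2 aB.
Qed.

Lemma herm_projC n (A : 'M[C]_n) : herm_proj A -> herm_proj (1%:M - A).
Proof.
move=> [aA AA]; split; first by rewrite adjmxD adjmxN adjmx1 aA.
by rewrite mulmxBl mul1mx mulmxBr mulmx1 AA subrr subr0.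
Qed.

Lemma herm_proj_conj n (A : 'M[C]_n) : herm_proj A -> herm_proj (map_mx Num.conj A).
Proof.
move=> [aA AA]; split; last by rewrite -map_mxM AA.
by rewrite -[in RHS]aA; apply/matrixP => a b; rewrite !mxE.
Qed.

End HermProj.

(** * Gluing the local extensions *)

Section KernelBundle.
Context {R : realType} {M : riemannSurface R} {n : nat}.
Local Notation C := (Cplx R).
Local Notation P := (R * R)%type.
Variables (i : nat) (T : nat -> M -> 'M[C]_n).
Hypothesis esT : ext_sol i T.

Definition proj_germ (F : M -> 'M[C]_n) (c : chart R M) (p : M) (V : set P) (Q : P -> 'M[C]_n) :=
  [/\ coordinate c /\ chart_dom c p, open V /\ V (rmap c p), V `<=` rim c, smooth_mx V Q &
    forall x, V x -> herm_proj (Q x) /\ (x <> rmap c p -> (Q x :=: F (rinv c x))%MS)].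

(** Near [p] and off [p] both projections are the one onto the row space of [F]. Passing to the
    limit takes continuity only, so the change between the two charts enters merely as a continuous
    map. *)
Lemma proj_germ_uniq F c p V Q c' V' Q' : proj_germ F c p V Q -> proj_germ F c' p V' Q' ->
  Q (rmap c p) = Q' (rmap c' p).
Proof.
move=> [[cc cp] [oV Vp] Vr sQ QP] [[cc' cp'] [oV' Vp'] Vr' sQ' QP'].
have rp := rmap_rim cp.
have E : \forall x \near (rmap c p)^', Q x = Q' (rmap c' (rinv c x)).
  have N := near_and (near_rinv cc cp (near_rmap cc' cp' (open_near oV' Vp'))) (open_near oV Vp).
  apply: filterS N => x [[rx [cx' Vx']] Vx] /eqP xp.
  have [hQ QE] := QP _ Vx; have [hQ' QE'] := QP' _ Vx'.
  apply: herm_proj_uniq => //; apply: eqmx_trans (QE xp) _; apply: eqmx_sym.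
  have {2}<- : rinv c' (rmap c' (rinv c x)) = rinv c x by rewrite rmapK.
  apply: QE' => e; apply: xp; have [_ <-] := rinvP cc rx; congr (rmap c _).
  by rewrite -(rmapK cc' cx') e rmapK.
have ct (f : C -> R) : continuous f -> forall a b,
    {for rmap c p, continuous (fun x => f (Q x a b))} ->
    {for rmap c' p, continuous (fun x => f (Q' x a b))} ->
    f (Q (rmap c p) a b) = f (Q' (rmap c' p) a b).
  move=> _ a b h1 h2; apply/eqP; rewrite -subr_eq0; apply/eqP.
  have {2}<- : rinv c (rmap c p) = p by rewrite rmapK.
  apply: (@continuous_dnbhs0 R (fun x => f (Q x a b) - f (Q' (rmap c' (rinv c x)) a b))); last first.
    by apply: filterS E => x ->; rewrite subrr.
  apply: cvgB => //; have k1 := rinv_cvg cc rp.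
  have k2 : {for rinv c (rmap c p), continuous (rmap c')} by rewrite rmapK //; exact: rmap_cvg.
  have k3 := continuous_comp k1 k2.
  apply: (@continuous_comp _ _ _ (rmap c' \o rinv c) (fun x => f (Q' x a b)) (rmap c p) k3).
  by rewrite /= rmapK.
apply/matrixP => a b; apply: Cplx_ext.
  apply: (ct (@reC R)); first exact: reC_continuous.
    by have [H _] := sQ a b 0%N; exact: Ck_cont H Vp.
  by have [H _] := sQ' a b 0%N; exact: Ck_cont H Vp'.
apply: (ct (@imC R)); first exact: imC_continuous.
  by have [_ H] := sQ a b 0%N; exact: Ck_cont H Vp.
by have [_ H] := sQ' a b 0%N; exact: Ck_cont H Vp'.
Qed.

(** A germ is assumed in every coordinate, so smoothness in a given coordinate is read off the germs
    of that same coordinate. *)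
Lemma proj_germ_glue F :
  (forall c p, coordinate c -> chart_dom c p -> exists V Q, proj_germ F c p V Q) ->
  exists pi : M -> 'M[C]_n, [/\ forall p, herm_proj (pi p), smoothM pi &
    off_discrete setT (fun p => (pi p :=: F p)%MS)].
Proof.
move=> H0; have H p : exists c V Q, proj_germ F c p V Q.
  by have [c cc cp] := coordinate_cover p; exists c; exact: H0.
have H' p : exists B, exists c V Q, proj_germ F c p V Q /\ B = Q (rmap c p).
  by have [c [V [Q g]]] := H p; exists (Q (rmap c p)), c, V, Q.
have [pi piP] := choice H'.
have piE c p V Q : proj_germ F c p V Q -> forall x, V x -> pi (rinv c x) = Q x.
  move=> [[cc cp] [oV Vp] Vr sQ QP] x Vx; have rx := Vr x Vx.
  have [dx xE] := rinvP cc rx.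
  have [c' [V' [Q' [g' ->]]]] := piP (rinv c x).
  have [ep|np] := eqVneq x (rmap c p).
    rewrite -[in RHS]xE; apply: (proj_germ_uniq (V' := V) g'); split => //; first by rewrite xE.
    by move=> y Vy; rewrite xE ep; exact: QP.
  (* A germ at [p] becomes a germ at a nearby point once [p] is removed from its domain. *)
  have op : open (~` [set rmap c p]) 
    by apply: closed_openC; apply: compact_closed; [exact: norm_hausdorff|exact: compact_set1].
  rewrite -[in RHS]xE; apply: (proj_germ_uniq (V' := V `&` ~` [set rmap c p]) g'); split => //.
  - by split; [exact: openI|rewrite xE; split => //; apply/eqP].
  - by move=> y [/Vr].
  - by apply: smooth_mx_sub sQ => y [].
  - by move=> y [Vy /= yp]; have [hQ QE] := QP _ Vy; split => // _; exact: QE.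
exists pi; split.
- by move=> p; have [c [V [Q [[_ [_ Vp] _ _ QP] ->]]]] := piP p; have [] := QP _ Vp.
- move=> c cc a b; apply: smooth_pt => x rx; have [dx xE] := rinvP cc rx.
  have [V [Q g]] := H0 c _ cc dx; have [[_ _] [oV Vp] Vr sQ _] := g.
  rewrite xE in Vp; apply: (@smooth_near _ _ x (fun y => Q y a b)).
    by apply: filterS (open_near oV Vp) => y Vy; rewrite (piE _ _ _ _ g).
  by apply: smooth_sub (sQ a b) => y ->.
- move=> p _; have [c [V [Q g]]] := H p.
  have [[cc cp] [oV Vp] Vr sQ QP] := g.
  apply: filterS (near_rmap cc cp (open_near oV Vp)) => q [cq Vq] /eqP qp.
  have [_ QE] := QP _ Vq; have := piE _ _ _ _ g _ Vq; rewrite rmapK // => ->.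
  rewrite -[X in (_ :=: F X)%MS](rmapK cc cq); apply: QE => e.
  by apply: qp; rewrite -(rmapK cc cq) e rmapK.
Qed.

Lemma kernel_bundle : exists pi : M -> 'M[C]_n, [/\ forall p, herm_proj (pi p), smoothM pi &
    off_discrete setT (fun p => (pi p :=: T 0 p)%MS)].
Proof.
apply: proj_germ_glue => c p cc cp; have [Ti sT uT _ eT] := esT.
have [A0 A0P] : exists A0 : P -> 'M[C]_n, forall x, rim c x -> forall l,
    del (fun y => ploop i (T ^~ (rinv c y)) l) x =
    (1 - (val l)^-1) *: (ploop i (T ^~ (rinv c x)) l *m A0 x).
  have H x : exists A, rim c x -> forall l, del (fun y => ploop i (T ^~ (rinv c y)) l) x =
    (1 - (val l)^-1) *: (ploop i (T ^~ (rinv c x)) l *m A).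
    have [rx|rx] := pselect (rim c x); last by exists 0.
    by have [A AP] := eT c cc x rx; exists A.
  by have [A0 A0P] := choice H; exists A0.
have [V [Q [oV Va VU sQ QP]]] := @local_extension R i n (rim c) (rmap c p)
  (fun k x => T k (rinv c x)) (fun x => (A0 x) ^t* ) (rim_open cc) (rmap_rim cp)
  (fun k x _ ik => Ti k _ ik)
  (fun m x _ => ploop_TsT (fun k => Ti k (rinv c x)) (uT (rinv c x)) m)
  (fun m x _ => ploop_TTs (fun k => Ti k (rinv c x)) (uT (rinv c x)) m)
  (fun k => sT k c cc)
  (fun x rx => proj1 (coef_dbar esT cc rx (A0P x rx)))
  (fun k x rx ki => proj2 (coef_dbar esT cc rx (A0P x rx)) k ki).
by exists V, Q; split.
Qed.

End KernelBundle.

Section SmoothDel.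
Context {R : realType}.
Local Notation C := (Cplx R).
Local Notation P := (R * R)%type.

Lemma smooth_mx_del m k U (F : P -> 'M[C]_(m, k)) : open U -> smooth_mx U F ->
  smooth_mx U (del F).
Proof.
move=> oU sF; apply: smooth_mx_add => //; first by move=> a b; apply: smooth_eq (smooth_Dc ex (sF a b)) => x; rewrite mxE.
apply: smooth_mx_opp => //; apply: smooth_mx_scale => //; first exact: smooth_cst.
by move=> a b; apply: smooth_eq (smooth_Dc ey (sF a b)) => x; rewrite mxE.
Qed.

End SmoothDel.

(** * Factors of projections and the Uhlenbeck step *)

Section Factor.
Context {R : realType} {n : nat}.
Local Notation C := (Cplx R).
Implicit Types (l : circle R) (P : 'M[C]_n).

Definition pfac P l := P + val l *: (1%:M - P).
Definition pfacV P l := P + (val l)^-1 *: (1%:M - P).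

Lemma herm_projM P : herm_proj P -> [/\ P *m P = P, P *m (1%:M - P) = 0,
  (1%:M - P) *m P = 0 & (1%:M - P) *m (1%:M - P) = 1%:M - P].
Proof.
move=> hP; have [_ PP] := hP; have [_ QQ] := herm_projC hP; split=> //.
  by rewrite mulmxBr mulmx1 PP subrr.
by rewrite mulmxBl mul1mx PP subrr.
Qed.

Lemma mul_pfac m (A : 'M[C]_(m, n)) P l :
  A *m pfac P l = A *m P + val l *: (A *m (1%:M - P)).
Proof. by rewrite scalemxAr -mulmxDr. Qed.

Lemma pfacK P l : herm_proj P -> pfac P l *m pfacV P l = 1%:M.
Proof.
move=> /herm_projM[e1 e2 e3 e4]; rewrite /pfac /pfacV mulmxDl !mulmxDr.
rewrite -!scalemxAl -!scalemxAr e1 e2 e3 e4 !scaler0 addr0 add0r scalerA.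
by rewrite mulfV ?circle_neq0 // scale1r addrC subrK.
Qed.

Lemma pfacVK P l : herm_proj P -> pfacV P l *m pfac P l = 1%:M.
Proof. by move=> hP; apply: mulmx1C; exact: pfacK. Qed.

Lemma pfac_adj P l : herm_proj P -> (pfac P l) ^t* = pfacV P l.
Proof. by move=> hP; rewrite adjmxD adjmxZ circle_conj (proj1 hP) (proj1 (herm_projC hP)). Qed.

Lemma pfacV_adj P l : herm_proj P -> (pfacV P l) ^t* = pfac P l.
Proof. by move=> hP; rewrite -pfac_adj // adjmxK. Qed.

(** The matrix of the equation after a factor has been removed. In the application [z] is
    [1 - lambda^-1] and [D] is the derivative of [P]; the two hypotheses cancel what would depend on
    lambda in the new matrix [A (1 - P) + P D]. *)
Lemma pfacV_step (F A P D : 'M[C]_n) (z : C) l : herm_proj P -> P *m A = 0 ->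
  (1%:M - P) *m D + A *m P = 0 ->
  z *: (F *m A) *m pfacV P l + F *m (z *: D) =
  z *: (F *m pfacV P l *m (A *m (1%:M - P) + P *m D)).
Proof.
move=> hP PA; have [e1 e2 e3 e4] := herm_projM hP; rewrite /pfacV.
have [Q QE] : exists Q, Q = 1%:M - P by exists (1%:M - P).
rewrite -QE in e2 e3 e4 *; move=> e.
have QA : Q *m A = A by rewrite QE mulmxBl mul1mx PA subr0.
have -> : F *m (P + (val l)^-1 *: Q) *m (A *m Q + P *m D) =
    F *m ((val l)^-1 *: (A *m Q) + P *m D).
  rewrite -mulmxA; congr (_ *m _); rewrite mulmxDl -scalemxAl !mulmxDr.
  by rewrite !mulmxA PA QA e1 e3 !mul0mx add0r addr0 addrC.
rewrite -!scalemxAl -scalemxAr -scalerDr -mulmxA -mulmxDr; congr (_ *: (_ *m _)).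
rewrite mulmxDr -scalemxAr addrAC [RHS]addrC; congr (_ + _).
apply/eqP; rewrite -subr_eq0 -e QE mulmxBl mul1mx; apply/eqP.
by rewrite [RHS]addrAC [A *m P + _]addrC.
Qed.

End Factor.

Section UhlenbeckStep.
Context {R : realType} {M : riemannSurface R} {n : nat}.
Local Notation C := (Cplx R).
Local Notation P := (R * R)%type.

(** The quotient is a polynomial loop of degree [i] because [T 0] kills the complement of [pi] and
    [T i.+1] kills [pi]. The equation survives because [pi] kills [A] on the left and the derivative
    of [pi] is tied to that of [T 0]. *)
Lemma uhlenbeck_ext_sol i (T : nat -> M -> 'M[C]_n) : ext_sol i.+1 T ->
  exists (pi : M -> 'M[C]_n) T', [/\ forall p, herm_proj (pi p), smoothM pi, ext_sol i T',
    forall p l, ploop i.+1 (T ^~ p) l = ploop i (T' ^~ p) l *m pfac (pi p) l &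
    off_discrete setT (fun p => (pi p :=: T 0%N p)%MS)].
Proof.
move=> esT; have [pi [hpi spi gpi]] := kernel_bundle esT.
have [Ti sT uT T1 eT] := esT.
have sq : smoothM (fun p => 1%:M - pi p) by apply: smoothM_add; [exact: smoothM_cst|exact: smoothM_opp].
have T0q p : T 0%N p *m (1%:M - pi p) = 0.
  move: p; apply: smoothM_eq0; first exact: smoothM_mul.
  apply: off_discreteS gpi => p pT; have /(herm_proj_sub _ (hpi p)) e : (T 0%N p <= pi p)%MS by rewrite pT.
  by rewrite mulmxBr mulmx1 e subrr.
have T0pi p : T 0%N p *m pi p = T 0%N p.
  by have /eqP := T0q p; rewrite mulmxBr mulmx1 subr_eq0 => /eqP.
(* For the shift [i.+1] unitarity leaves a single term: [T 0] times the adjoint of [T i.+1] is 0. *)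
have Tipi p : T i.+1 p *m pi p = 0.
  move: p; apply: smoothM_eq0; first exact: smoothM_mul.
  apply: off_discreteS gpi => p pT.
  have := @ploop_TTs R n i.+1 (T ^~ p) (fun k => Ti k p) (uT p) i.+1.
  rewrite big_ord_recl big1 ?addr0 => [|k _]; last first.
    have -> : T (lift ord0 k + i.+1)%N p = 0 by apply: Ti; rewrite /= /bump /=; lia.
    by rewrite adjmx0 mulmx0.
  rewrite add0n raddf0 => /(congr1 (fun A : 'M[C]_n => A ^t* )); rewrite adjmxM adjmxK adjmx0.
  move=> e; have /submxP[D piD] : (pi p <= T 0%N p)%MS by rewrite pT.
  by have [piA _] := hpi p; rewrite -[pi p]piA piD adjmxM mulmxA e mul0mx.
pose T' k p : 'M[C]_n := T k p *m pi p + T k.+1 p *m (1%:M - pi p).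
have fac p l : ploop i.+1 (T ^~ p) l = ploop i (T' ^~ p) l *m pfac (pi p) l.
  have [e1 e2 e3 e4] := herm_projM (hpi p).
  have -> : ploop i (T' ^~ p) l *m pfac (pi p) l =
     \sum_(k < i.+1) val l ^+ k *: (T k p *m pi p) + \sum_(k < i.+1) val l ^+ k.+1 *: (T k.+1 p *m (1%:M - pi p)).
    rewrite -big_split mulmx_suml; apply: eq_bigr => k _ /=.
    rewrite -scalemxAl exprSr -scalerA -scalerDr; congr (_ *: _).
    rewrite mul_pfac /T' !mulmxDl -!mulmxA.
    by rewrite e1 e2 e3 e4 !mulmx0 addr0 add0r.
  rewrite -[LHS]mulmx1 -[in LHS](subrK (pi p) 1%:M) addrC mulmxDr; congr (_ + _).
    rewrite mulmx_suml big_ord_recr /= -scalemxAl Tipi scaler0 addr0.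
    by apply: eq_bigr => k _; rewrite scalemxAl.
  rewrite mulmx_suml big_ord_recl -scalemxAl T0q scaler0 add0r.
  by apply: eq_bigr => k _; rewrite scalemxAl.
have facV p l : ploop i (T' ^~ p) l = ploop i.+1 (T ^~ p) l *m pfacV (pi p) l.
  by rewrite fac -mulmxA pfacK // mulmx1.
have sT' k : smoothM (T' k) by apply: smoothM_add; exact: smoothM_mul.
exists pi, T'; split; [exact: hpi|exact: spi| |exact: fac|exact: gpi]; split.
- move=> k p ik; rewrite /T' (Ti k.+1) // mul0mx addr0.
  by move: ik; rewrite leq_eqVlt => /orP[/eqP <-|ik]; [exact: Tipi|rewrite Ti // mul0mx].
- exact: sT'.
- move=> p l; rewrite facV adjmxM mulmxA -[X in X *m _ = _]mulmxA uT mulmx1.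
  by rewrite pfacV_adj // pfacK.
- by move=> p; rewrite facV T1 mul1mx /pfacV /= invr1 scale1r addrC subrK.
move=> c cc; have ro := rim_open cc.
pose t k x := T k (rinv c x); pose q x := pi (rinv c x).
have st k : smooth_mx (rim c) (t k) by exact: sT.
have sqq : smooth_mx (rim c) q by exact: spi.
(* The smooth formula of [coef_A], so that identities for [A] extend from the generic points. *)
pose A x := \sum_(k < i.+2) (t k x) ^t* *m del (t k) x.
have sA : smooth_mx (rim c) A.
  apply: smooth_mx_sum => // k _; apply: smooth_mx_mul => //; first exact: smooth_mx_adj.
  exact: smooth_mx_del.
have AP x : rim c x -> forall l, del (fun y => ploop i.+1 (T ^~ (rinv c y)) l) x =
    (1 - (val l)^-1) *: (ploop i.+1 (T ^~ (rinv c x)) l *m A x).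
  by move=> rx; have [A' A'P] := eT c cc x rx; have AA : A' = A x := coef_A esT cc rx A'P; rewrite -AA.
have gen (G : P -> 'M[C]_n) : smooth_mx (rim c) G ->
    (forall x, rim c x -> (q x :=: t 0%N x)%MS -> G x = 0) -> forall x, rim c x -> G x = 0.
  move=> sG H x rx; have [dx xE] := rinvP cc rx; rewrite -xE.
  apply: (chart_smooth_eq0 cc dx sG); apply: filterS (gpi _ I) => p pE cp.
  by apply: H; [exact: rmap_rim|rewrite /q /t rmapK].
have piA : forall x, rim c x -> q x *m A x = 0.
  apply: gen; first exact: smooth_mx_mul.
  move=> x rx qt; have /submxP[D ->] : (q x <= t 0%N x)%MS by rewrite qt.
  by rewrite -mulmxA (proj1 (coef_del esT cc rx (AP x rx))) mulmx0.
(* Applying [dbar] to [T 0 = T 0 pi] gives a relation with [T 0] as left factor. Where the row space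
   of [pi] is that of [T 0], this factor may be replaced by [pi], and the adjoint relation together
   with [pi A = 0] and [pi pi = pi] is the claim. *)
have del_q : forall x, rim c x -> (1%:M - q x) *m del q x + A x *m q x = 0.
  apply: gen.
    apply: smooth_mx_add => //; last exact: smooth_mx_mul.
    by apply: smooth_mx_mul => //; [exact: (sq c cc)|exact: smooth_mx_del].
  move=> x rx qt; have [dT0 _] := coef_dbar esT cc rx (AP x rx).
  have [qA qq] := hpi (rinv c x); rewrite -/(q x) in qA qq.
  have E1 : t 0%N x *m (dbar q x + (A x) ^t* *m (1%:M - q x)) = 0.
    have : dbar (fun y => t 0 y *m q y) x = dbar (t 0%N) x by apply: eq_dbar => y; rewrite /t T0pi.
    rewrite (dbar_mul ro (st 0%N) sqq rx) dT0 -/(t 0%N x) mulNmx => /eqP.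
    rewrite addrC subr_eq => /eqP e.
    rewrite [(A x) ^t* *m _]mulmxBr mulmx1 [LHS]mulmxDr [X in _ + X]mulmxBr mulmxA e.
    by rewrite addrACA addNr subrr addr0.
  have E2 : q x *m (dbar q x + (A x) ^t* *m (1%:M - q x)) = 0.
    by have /submxP[D {1}->] : (q x <= t 0%N x)%MS; rewrite ?qt // -mulmxA E1 mulmx0.
  have dq : (dbar q x) ^t* = del q x.
    by rewrite -(del_adj sqq rx); apply: eq_del => y; have [] := hpi (rinv c y).
  have := congr1 (fun B : 'M[C]_n => B ^t* ) E2.
  rewrite adjmx0 adjmxM adjmxD adjmxM adjmxK dq qA (proj1 (herm_projC (hpi _))).
  have -> : (1%:M - pi (rinv c x)) *m A x = A x by rewrite mulmxBl mul1mx piA // subr0.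
  move=> e0; have e : del q x *m q x + A x *m q x = 0 by rewrite -mulmxDl.
  have : del (fun y => q y *m q y) x = del q x by apply: eq_del => y; have [] := hpi (rinv c y).
  rewrite (del_mul ro sqq sqq rx) => e2.
  by rewrite mulmxBl mul1mx -{1}e2 addrK; exact: e.
move=> x rx; exists (A x *m (1%:M - q x) + q x *m del q x) => l.
have sE : smooth_mx (rim c) (fun y => pfacV (q y) l).
  apply: smooth_mx_add => //; apply: smooth_mx_scale; [exact: ro|exact: smooth_cst|exact: (sq c cc)].
rewrite (eq_del _ (fun y => facV (rinv c y) l)) (del_mul ro (ploop_smooth esT cc l) sE rx).
have dE : del (fun y => pfacV (q y) l) x = (1 - (val l)^-1) *: del q x.
  have s1 : smooth_mx (rim c) (fun y => 1%:M - q y) by exact: (sq c cc).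
  rewrite (del_add sqq _ rx); last by apply: smooth_mx_scale => //; exact: smooth_cst.
  rewrite (del_scale _ ro s1 rx) (del_add (smooth_mx_cst _ _) (smooth_mx_opp ro sqq) rx) del_cst add0r.
  have -> : del (fun y => - q y) x = - del q x.
    have := del_scale (-1) ro sqq rx; rewrite scaleN1r => <-.
    by apply: eq_del => y; rewrite scaleN1r.
  by rewrite scalerN scalerBl scale1r.
rewrite AP // dE (facV (rinv c x) l); apply: pfacV_step; [exact: hpi|exact: piA|exact: del_q].
Qed.

End UhlenbeckStep.

(** * Conjugation of loops *)

Section Sharp.
Context {R : realType} {M : riemannSurface R} {n : nat}.
Local Notation C := (Cplx R).
Local Notation P := (R * R)%type.
Implicit Types (T : nat -> M -> 'M[C]_n) (l : circle R).

Lemma conjmx_adj m k (A : 'M[C]_(m, k)) : map_mx Num.conj (A ^t* ) = A^T.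
Proof. by apply/matrixP => a b; rewrite !mxE conjCK. Qed.

Lemma conjmxK m k (A : 'M[C]_(m, k)) : map_mx Num.conj (map_mx Num.conj A) = A.
Proof. by apply/matrixP => a b; rewrite !mxE conjCK. Qed.

Lemma conjmxZ m k (z : C) (A : 'M[C]_(m, k)) :
  map_mx Num.conj (z *: A) = Num.conj z *: map_mx Num.conj A.
Proof. by apply/matrixP => a b; rewrite !mxE rmorphM. Qed.

Lemma conjmx_sum m k (I : Type) (r : seq I) (F : I -> 'M[C]_(m, k)) :
  map_mx Num.conj (\sum_(i <- r) F i) = \sum_(i <- r) map_mx Num.conj (F i).
Proof.
elim: r => [|i r IH]; first by rewrite !big_nil map_mx0.
by rewrite !big_cons -IH map_mxD.
Qed.

Lemma conjmx_eqmx m1 m2 k (A : 'M[C]_(m1, k)) (B : 'M[C]_(m2, k)) :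
  (A :=: B)%MS -> (map_mx Num.conj A :=: map_mx Num.conj B)%MS.
Proof.
have H a b (A' : 'M[C]_(a, k)) (B' : 'M[C]_(b, k)) : (A' <= B')%MS ->
    (map_mx Num.conj A' <= map_mx Num.conj B')%MS.
  by move=> /submxP[D ->]; rewrite map_mxM submxMl.
by move=> AB; apply/eqmxP/andP; split; apply: H; rewrite AB.
Qed.

(** The coefficients of [lambda^i] times the conjugate loop. A loop of degree [i] is real exactly
    when its coefficients are fixed by this operation. *)
Definition sharp i T k p : 'M[C]_n := if (k <= i)%N then map_mx Num.conj (T (i - k)%N p) else 0.

Lemma sharpK i T k p : (k <= i)%N -> sharp i (sharp i T) k p = T k p.
Proof. by move=> ki; rewrite /sharp ki leq_subr subKn // conjmxK. Qed.

Lemma ploop_sharp i T p l :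
  ploop i (sharp i T ^~ p) l = val l ^+ i *: map_mx Num.conj (ploop i (T ^~ p) l).
Proof.
rewrite /ploop conjmx_sum scaler_sumr.
rewrite (reindex_inj rev_ord_inj); apply: eq_bigr => k _.
have ki : (k <= i)%N by rewrite -ltnS.
have -> : (rev_ord k : nat) = (i - k)%N by rewrite /= subSS.
rewrite conjmxZ circle_conjX scalerA -exprB ?unitfE ?circle_neq0 //.
by rewrite /sharp leq_subr subKn.
Qed.

(** Conjugation exchanges [del] and [dbar], and the factor [1 - lambda] of the [dbar] equation has
    conjugate [1 - lambda^-1]. *)
Lemma ext_sol_sharp i T : ext_sol i T -> ext_sol i (sharp i T).
Proof.
move=> esT; have [Ti sT uT T1 eT] := esT; split.
- by move=> k p ik; rewrite /sharp leqNgt ik.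
- by move=> k; rewrite /sharp; case: leqP => _; [exact: smoothM_conj|exact: smoothM_cst].
- move=> p l; rewrite !ploop_sharp adjmxZ -scalemxAl -scalemxAr scalerA.
  rewrite circle_conjX mulVf ?expf_neq0 ?circle_neq0 // scale1r.
  set F := ploop _ _ _.
  have -> : (map_mx Num.conj F) ^t* = map_mx Num.conj (F ^t* ).
    by apply/matrixP => a b; rewrite !mxE.
  by rewrite -map_mxM uT map_mx1.
- by move=> p; rewrite ploop_sharp T1 map_mx1 /= expr1n scale1r.
move=> c cc x rx; have [A AP] := eT c cc x rx; exists (- A^T) => l.
have ro := rim_open cc; have sF := ploop_smooth esT cc l.
rewrite (eq_del _ (fun y => ploop_sharp i T (rinv c y) l)).
rewrite (del_scale _ ro (smooth_mx_conj ro sF) rx) (del_conj sF rx) (dbar_ploopE esT cc rx AP).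
rewrite ploop_sharp conjmxZ map_mxM conjmx_adj mulmxN scalerN -scaleNr -scalemxAl !scalerA.
by congr (_ *: _); rewrite mulrC rmorphN rmorphB rmorph1 /= circle_conj.
Qed.

Lemma sharp_id i T : ext_sol i T -> sharp i (sharp i T) = T.
Proof.
move=> [Ti _ _ _ _]; apply/funext => k; apply/funext => p.
by have [ki|ik] := leqP k i; [rewrite sharpK|rewrite Ti // /sharp leqNgt ik].
Qed.

(** The row space of the projection is prescribed only off a discrete set; smoothness fixes it
    elsewhere. In a Segal step the top coefficient gives the complement of the projection. *)
Definition step_rel b i T T' (pi : M -> 'M[C]_n) :=
  [/\ forall p, herm_proj (pi p), smoothM pi,
    forall p l, ploop i.+1 (T ^~ p) l = ploop i (T' ^~ p) l *m pfac (pi p) l &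
    off_discrete setT (fun p => match b with
      | Uhlenbeck => (pi p :=: T 0%N p)%MS
      | Segal => (1%:M - pi p :=: T i.+1 p)%MS end)].

(** Lambda times the conjugate of [pi + lambda (1 - pi)] is again such a factor, for the complement
    of the conjugate of [pi]. *)
Lemma step_rel_sharp b i T T' pi : step_rel b i T T' pi ->
  step_rel (other_step b) i (sharp i.+1 T) (sharp i T') (fun p => 1%:M - map_mx Num.conj (pi p)).
Proof.
move=> [hpi spi fac gpi]; split.
- by move=> p; apply: herm_projC; exact: herm_proj_conj.
- by apply: smoothM_add; [exact: smoothM_cst|apply: smoothM_opp; exact: smoothM_conj].
- move=> p l; rewrite !ploop_sharp fac map_mxM exprSr -scalerA scalemxAr scalemxAl; congr (_ *m _).
  rewrite /pfac map_mxD conjmxZ map_mxB map_mx1 circle_conj scalerDr scalerA (mulfV (circle_neq0 l)).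
  by rewrite scale1r opprB addrC; congr (_ + _ *: _); rewrite addrCA subrr addr0.
apply: off_discreteS gpi => p; case: b => E; have := conjmx_eqmx E; rewrite /sharp.
  by rewrite leqnn subnn opprB addrCA subrr addr0.
by rewrite leq0n subn0 map_mxB map_mx1.
Qed.

Lemma step_exists b i T : ext_sol i.+1 T ->
  exists pi T', ext_sol i T' /\ step_rel b i T T' pi.
Proof.
have U T0 : ext_sol i.+1 T0 -> exists pi T', ext_sol i T' /\ step_rel Uhlenbeck i T0 T' pi.
  by move=> /uhlenbeck_ext_sol[pi [T' [h1 h2 h3 h4 h5]]]; exists pi, T'; split; [exact: h3|split].
move=> esT; case: b; first exact: U.
have [pi [T' [eT' sr]]] := U _ (ext_sol_sharp esT).
have := step_rel_sharp sr; rewrite (sharp_id esT) => sr'.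
exists (fun p => 1%:M - map_mx Num.conj (pi p)), (sharp i T').
by split; [exact: ext_sol_sharp|exact: sr'].
Qed.

End Sharp.

(** * The sequence of alternate steps *)

Section Alternating.
Context {R : realType} {M : riemannSurface R} {n : nat}.
Local Notation C := (Cplx R).

Definition alternating_data b r (pi : nat -> M -> 'M[C]_n) (F : nat -> nat -> M -> 'M[C]_n) :=
  (forall i, (i <= r)%N -> ext_sol i (F i)) /\
  forall i, (i < r)%N -> step_rel (step_at b r i.+1) i (F i.+1) (F i) (pi i.+1).

Lemma other_stepK b : other_step (other_step b) = b. Proof. by case: b. Qed.

Lemma step_at_other b r i : (i <= r)%N -> step_at (other_step b) r i = step_at b r.+1 i.
Proof. by move=> ir; rewrite /step_at subSn //=; case: odd; rewrite /= ?other_stepK. Qed.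

Lemma alternating_exists b r T : ext_sol r T -> exists pi F, F r = T /\ alternating_data b r pi F.
Proof.
elim: r b T => [|r IH] b T esT.
  exists (fun _ _ => 0), (fun=> T); split; first exact: erefl.
  by split=> i; [rewrite leqn0 => /eqP ->; exact: esT|rewrite ltn0].
have [P0 [T' [eT' sr]]] := step_exists b esT.
have [pi [F [Fr [eF dF]]]] := IH (other_step b) T' eT'.
exists (fun i => if i == r.+1 then P0 else pi i), (fun i => if i == r.+1 then T else F i).
split; first by rewrite eqxx.
split => i.
  by rewrite leq_eqVlt => /orP[/eqP ->|ir]; [rewrite eqxx; exact: esT|rewrite (ltn_eqF ir); exact: eF].
rewrite ltnS leq_eqVlt => /orP[/eqP ->|ir].
  by rewrite eqxx /step_at subnn (ltn_eqF (ltnSn r)) Fr; exact: sr.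
rewrite eqSS (ltn_eqF ir) (ltn_eqF (ltnW ir : (i < r.+1)%N)) -(step_at_other b ir).
exact: dF.
Qed.

End Alternating.

Section LinSpan.
Context {K : fieldType} {V : lmodType K}.
Implicit Types (A B : set V) (v w : V).

Lemma lin_span_ind A (Q : V -> Prop) : Q 0 ->
  (forall a w v, A w -> Q v -> Q (a *: w + v)) -> forall v, lin_span A v -> Q v.
Proof.
move=> Q0 QS v [m [a [w [Aw ->]]]].
by apply: big_rec => // i x _; exact: QS.
Qed.

Lemma lin_span0 A : lin_span A 0.
Proof. by exists 0%N, (fun=> 0), (fun=> 0); split=> [[]//|]; rewrite big_ord0. Qed.

Lemma lin_span_cons A a w v : A w -> lin_span A v -> lin_span A (a *: w + v).
Proof.
move=> Aw [m [b [u [Au ->]]]].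
exists m.+1, (fun i => if unlift ord0 i is Some j then b j else a),
  (fun i => if unlift ord0 i is Some j then u j else w); split.
  by move=> i; case: unliftP => [j|] _.
rewrite big_ord_recl unlift_none; congr (_ + _).
by apply: eq_bigr => i _; rewrite liftK.
Qed.

Lemma lin_span_gen A w : A w -> lin_span A w.
Proof. by move=> Aw; have := lin_span_cons 1 Aw (lin_span0 A); rewrite scale1r addr0. Qed.

Lemma lin_span_add A v w : lin_span A v -> lin_span A w -> lin_span A (v + w).
Proof.
move=> Av Aw; move: v Av; apply: lin_span_ind; first by rewrite add0r.
by move=> a u v Au Av; rewrite -addrA; exact: lin_span_cons.
Qed.

Lemma lin_span_scale A a v : lin_span A v -> lin_span A (a *: v).
Proof.
move: v; apply: lin_span_ind; first by rewrite scaler0; exact: lin_span0.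
by move=> b u v Au Av; rewrite scalerDr scalerA; exact: lin_span_cons.
Qed.

End LinSpan.

(** * The Hardy space *)

Section Hardy.
Context {R : realType} {n : nat}.
Local Notation C := (Cplx R).
Local Notation mu := (@lebesgue_measure R).
Local Notation D := (`[0%R, (2 * pi)%R]%classic : set R).
Implicit Types (f g P Q : circle_fun R n) (l : circle R) (v : 'cV[C]_n).

Local Notation TR := (measurableTypeR R).

Let mD : @measurable _ TR D. Proof. exact: measurable_itv. Qed.

Definition integr (h : R -> R) : Prop := mu.-integrable D (EFin \o (h : TR -> R)).
Definition meas (h : R -> R) : Prop := @measurable_fun _ _ TR R D h.

Lemma integr_add h k : integr h -> integr k -> integr (fun t => h t + k t).
Proof. by move=> ih ik; have := integrableD mD ih ik. Qed.

Lemma integr_scale c h : integr h -> integr (fun t => c * h t).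
Proof. by move=> ih; have := integrableZl mD c ih. Qed.

Lemma muD : mu D = (2 * pi)%:E.
Proof.
rewrite lebesgue_measure_itv /= lte_fin mulr_gt0 ?pi_gt0 //.
by rewrite oppr0 addr0.
Qed.

Lemma integr_cst c : integr (fun=> c).
Proof.
have H := @measurable_bounded_integrable _ TR R mu (fun=> c) D mD. apply: H; [|exact: measurable_cst|exact: bounded_cst].
by have muE : mu D = _ := muD; rewrite [X in (X < _)%E]muE ltry.
Qed.

Lemma integr_le h k : meas h -> (forall t, `|h t| <= k t) -> integr k -> integr h.
Proof.
move=> mh hk; apply: le_integrable => //; first exact/measurable_EFinP.
by move=> t _ /=; rewrite lee_fin (le_trans (hk t)) // ler_norm.
Qed.

Definition mcomp f := forall j, meas (fun t => reC (f (cis t) j 0)) /\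
  meas (fun t => imC (f (cis t) j 0)).

Lemma sqnorm_ge0 v : 0 <= sqnorm v.
Proof. by apply: sumr_ge0 => j _; rewrite addr_ge0 ?sqr_ge0. Qed.

Lemma mcomp_sqnorm f : mcomp f -> meas (fun t => sqnorm (f (cis t))).
Proof.
move=> mf; apply: measurable_sum => j; have [m1 m2] := mf j.
by apply: measurable_funD; exact: measurable_funX.
Qed.

Definition nrm f := (\int[mu]_(t in D) sqnorm (f (cis t)))%R.

Lemma L2P f : L2 f <-> mcomp f /\ integr (fun t => sqnorm (f (cis t))).
Proof.
have E : (\int[mu]_(t in D) `|(EFin \o (fun t : R => sqnorm (f (cis t)))) t| = L2sqnorm f)%E.
  by apply: eq_integral => t _ /=; rewrite ger0_norm ?sqnorm_ge0.
split=> [[mf fin]|[mf /integrableP[mi fin]]]; split => //; last by rewrite -E.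
by apply/integrableP; split; [apply/measurable_EFinP; exact: mcomp_sqnorm|rewrite E].
Qed.

Lemma L2_nrm f : L2 f -> L2sqnorm f = (nrm f)%:E.
Proof. by move=> /L2P[_ ?]; rewrite /nrm /Rintegral fineK //; exact: integrable_fin_num. Qed.

Lemma L2_le f g c : mcomp f -> L2 g -> (forall l, sqnorm (f l) <= c * sqnorm (g l)) ->
  L2 f /\ nrm f <= c * nrm g.
Proof.
move=> mf /L2P[mg ig] fg; have icg := integr_scale c ig.
have if1 : integr (fun t => sqnorm (f (cis t))).
  by apply: integr_le icg; [exact: mcomp_sqnorm|move=> t; rewrite ger0_norm ?sqnorm_ge0].
split; first exact/L2P.
by rewrite /nrm -(RintegralZl _ mD ig); apply: le_Rintegral => // t _; exact: fg.
Qed.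

(** Constants are irrelevant for density arguments, so this crude bound stands in for the triangle
    inequality of the norm. *)
Lemma sqnormD v w : sqnorm (v + w) <= 2 * sqnorm v + 2 * sqnorm w.
Proof.
rewrite /sqnorm !mulr_sumr -big_split /=; apply: ler_sum => j _.
rewrite !mxE reCD imCD; move: (reC _) (imC _) (reC _) (imC _) => a b c d.
by have := sqr_ge0 (a - c); have := sqr_ge0 (b - d); nra.
Qed.

Lemma L2_add f g : L2 f -> L2 g -> L2 (f + g) /\ nrm (f + g) <= 2 * nrm f + 2 * nrm g.
Proof.
move=> /L2P[mf if1] /L2P[mg ig].
have mfg : mcomp (f + g).
  move=> j; have [m1 m2] := mf j; have [m3 m4] := mg j; split.
    apply: eq_measurable_fun (measurable_funD m1 m3) => t _ /=.
    by rewrite -reCD fctE mxE.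
  apply: eq_measurable_fun (measurable_funD m2 m4) => t _ /=.
  by rewrite -imCD fctE mxE.
have i2 := integr_add (integr_scale 2 if1) (integr_scale 2 ig).
have ifg : integr (fun t => sqnorm ((f + g) (cis t))).
  apply: integr_le i2; first exact: mcomp_sqnorm.
  by move=> t; rewrite ger0_norm ?sqnorm_ge0 //; exact: sqnormD.
split; first exact/L2P.
rewrite /nrm -(RintegralZl _ mD if1) -(RintegralZl _ mD ig) -RintegralD //; try exact: integr_scale.
by apply: le_Rintegral => // t _; exact: sqnormD.
Qed.

Lemma sqnormZ z v : sqnorm (z *: v) = (reC z ^+ 2 + imC z ^+ 2) * sqnorm v.
Proof.
rewrite /sqnorm mulr_sumr; apply: eq_bigr => j _.
by rewrite mxE reCM imCM; ring.
Qed.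

Lemma mcomp_mul (w : circle R -> C) f :
  meas (fun t => reC (w (cis t))) -> meas (fun t => imC (w (cis t))) ->
  mcomp f -> mcomp (fun l => w l *: f l).
Proof.
move=> m1 m2 mf j; have [m3 m4] := mf j; split.
  apply: eq_measurable_fun (measurable_funB (measurable_funM m1 m3) (measurable_funM m2 m4)) => t _ /=.
  by rewrite mxE reCM.
apply: eq_measurable_fun (measurable_funD (measurable_funM m1 m4) (measurable_funM m2 m3)) => t _ /=.
by rewrite mxE imCM addrC.
Qed.

Lemma L2_scale z f : L2 f ->
  L2 (fun l => z *: f l) /\ nrm (fun l => z *: f l) <= (reC z ^+ 2 + imC z ^+ 2) * nrm f.
Proof.
move=> L2f; apply: (L2_le _ L2f) => [|l]; last by rewrite sqnormZ.
by apply: mcomp_mul; [exact: measurable_cst|exact: measurable_cst|have [] := L2f].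
Qed.

Lemma sqnorm_circle l v : sqnorm (val l *: v) = sqnorm v.
Proof.
rewrite sqnormZ; have := valP l; rewrite normCE => /eqP/(congr1 (@reC R)) /= c1.
by rewrite -[X in X * _]cabs_sqr c1 expr1n mul1r.
Qed.

Lemma meas_cos : meas (@cos R).
Proof. by apply: measurable_funTS; apply: continuous_measurable_fun; exact: continuous_cos. Qed.

Lemma meas_sin : meas (@sin R).
Proof. by apply: measurable_funTS; apply: continuous_measurable_fun; exact: continuous_sin. Qed.

Lemma mcomp_lam f : mcomp f -> mcomp (fun l => val l *: f l).
Proof. by apply: mcomp_mul; [exact: meas_cos|exact: meas_sin]. Qed.

Lemma mcomp_lamV f : mcomp f -> mcomp (fun l => (val l)^-1 *: f l).
Proof.
have E l : (val l)^-1 = Num.conj (val l) by rewrite circle_conj.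
have -> : (fun l => (val l)^-1 *: f l) = (fun l => Num.conj (val l) *: f l).
  by apply/funext => l; rewrite E.
apply: mcomp_mul.
  by apply: eq_measurable_fun meas_cos => t _; rewrite reC_conj.
by apply: eq_measurable_fun (measurable_funN meas_sin) => t _; rewrite imC_conj.
Qed.

Lemma L2_lam f : L2 f -> L2 (fun l => val l *: f l) /\ nrm (fun l => val l *: f l) <= 1 * nrm f.
Proof.
move=> L2f; apply: (L2_le _ L2f) => [|l]; last by rewrite sqnorm_circle mul1r.
by apply: mcomp_lam; have [] := L2f.
Qed.

Lemma L2_lamV f : L2 f ->
  L2 (fun l => (val l)^-1 *: f l) /\ nrm (fun l => (val l)^-1 *: f l) <= 1 * nrm f.
Proof.
move=> L2f; apply: (L2_le _ L2f) => [|l]; first by apply: mcomp_lamV; have [] := L2f.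
by rewrite -(sqnorm_circle l) scalerA mulfV ?circle_neq0 // scale1r mul1r.
Qed.

Lemma L2_delta (i j : 'I_n) f : L2 f -> L2 (fun l => delta_mx i j *m f l) /\
  nrm (fun l => delta_mx i j *m f l) <= 1 * nrm f.
Proof.
have E v a : (delta_mx i j *m v) a 0 = if a == i then v j 0 else 0.
  rewrite mxE (bigD1 j) //= big1 => [|k kj]; last by rewrite mxE (negPf kj) andbF mul0r.
  by rewrite mxE eqxx andbT addr0; case: eqP; rewrite ?mul1r ?mul0r.
move=> L2f; have [mf _] := L2f; apply: (L2_le _ L2f) => [a|l].
  have [m1 m2] := mf j; split.
    apply: (eq_measurable_fun (fun t => if a == i then reC (f (cis t) j 0) else 0)).
      by move=> t _; rewrite E; case: eqP.
    by case: eqP => _ //; exact: measurable_cst.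
  apply: (eq_measurable_fun (fun t => if a == i then imC (f (cis t) j 0) else 0)).
    by move=> t _; rewrite E; case: eqP.
  by case: eqP => _ //; exact: measurable_cst.
rewrite mul1r /sqnorm (bigD1 i) //= big1 => [|a ai]; last first.
  by rewrite E (negPf ai) /= expr0n /= addr0.
rewrite E eqxx addr0 (bigD1 j) //= lerDl; apply: sumr_ge0 => k _.
by rewrite addr_ge0 ?sqr_ge0.
Qed.

Lemma L2_cst v : L2 (fun=> v).
Proof. by apply/L2P; split; [move=> j; split; exact: measurable_cst|exact: integr_cst]. Qed.

Lemma circle_funD f g l : (f + g) l = f l + g l. Proof. by rewrite fctE. Qed.
Lemma circle_funZ z f l : (z *: f) l = z *: f l. Proof. by []. Qed.

Local Notation pol := (lin_span (@Hplus_gen R n)).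

Lemma pol_map (B : circle R -> 'M[C]_n) :
  (forall P, Hplus_gen P -> pol (fun l => B l *m P l)) ->
  forall P, pol P -> pol (fun l => B l *m P l).
Proof.
move=> H; apply: lin_span_ind.
  rewrite (_ : (fun l => _) = 0); first exact: lin_span0.
  by apply/funext => l; rewrite mulmx0.
move=> a w v /H Aw Av; rewrite (_ : (fun l => _) = a *: (fun l => B l *m w l) + (fun l => B l *m v l)).
  by apply: lin_span_add => //; exact: lin_span_scale.
by apply/funext => l; rewrite !circle_funD !circle_funZ mulmxDr scalemxAr.
Qed.

Lemma pol_L2 P : pol P -> L2 P.
Proof.
move: P; apply: lin_span_ind; first exact: (L2_cst 0).
move=> a w v [k [j ->]] Lv.
have Lw : L2 (fun l => val l ^+ k *: delta_mx j 0 : 'cV[C]_n).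
  elim: k => [|k IH]; first by rewrite (_ : (fun l => _) = fun=> delta_mx j 0); [exact: L2_cst|apply/funext => l; rewrite expr0 scale1r].
  rewrite (_ : (fun l => _) = fun l => val l *: (val l ^+ k *: delta_mx j 0)).
    exact: (proj1 (L2_lam IH)).
  by apply/funext => l; rewrite scalerA exprS.
by have [H _] := L2_add (proj1 (L2_scale a Lw)) Lv.
Qed.

Lemma HplusP f : Hplus f <-> L2 f /\ forall e, 0 < e -> exists2 P, pol P & nrm (f - P) < e.
Proof.
have LB f' P : L2 f' -> pol P -> L2 (f' - P).
  move=> L2f polP; have := proj1 (L2_scale (-1) (pol_L2 polP)) => /(fun h => proj1 (L2_add L2f h)).
  by congr L2; apply/funext => l; rewrite !fctE scaleN1r.
split=> [[L2f H]|[L2f H]]; split => // e e0; have [P polP] := H e e0; exists P => //.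
  by rewrite -lte_fin -L2_nrm //; exact: LB.
by rewrite L2_nrm ?lte_fin //; exact: LB.
Qed.

Lemma L2_sub f g : L2 f -> L2 g -> L2 (f - g).
Proof.
move=> L2f /(L2_scale (-1))[/(L2_add L2f)[H _] _]; move: H.
by congr L2; apply/funext => l; rewrite !fctE scaleN1r.
Qed.

Lemma Hplus_pol P : pol P -> Hplus P.
Proof.
move=> polP; apply/HplusP; split=> [|e e0]; first exact: pol_L2.
exists P => //; rewrite subrr /nrm (_ : (fun t => _) = fun=> 0).
  by rewrite Rintegral_cst // mul0r.
apply/funext => t; rewrite /sqnorm big1 // => j _.
have -> : (0 : circle_fun R n) (cis t) j 0 = 0 by rewrite [LHS]mxE.
by rewrite /= expr0n addr0.
Qed.

(** Boundedness carries polynomials close to [f] to polynomials close to the image of [f]. *)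
Lemma Hplus_map c (B : circle R -> 'M[C]_n) :
  (forall f, L2 f -> L2 (fun l => B l *m f l) /\ nrm (fun l => B l *m f l) <= c * nrm f) ->
  (forall P, Hplus_gen P -> pol (fun l => B l *m P l)) ->
  forall f, Hplus f -> Hplus (fun l => B l *m f l).
Proof.
move=> LB pB f /HplusP[L2f H]; apply/HplusP; split; first by have [] := LB f L2f.
move=> e e0; have d0 : 0 < e / (`|c| + 1) by rewrite divr_gt0 // ltr_wpDl.
have [P polP fP] := H _ d0; exists (fun l => B l *m P l); first exact: pol_map.
have [_ le] := LB _ (L2_sub L2f (pol_L2 polP)).
have -> : (fun l => B l *m f l) - (fun l => B l *m P l) = fun l => B l *m (f - P) l.
  by apply/funext => l; rewrite !fctE mulmxBr.
apply: le_lt_trans le _; have n0 : 0 <= nrm (f - P).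
  by apply: Rintegral_ge0 => t _; exact: sqnorm_ge0.
apply: (@le_lt_trans _ _ ((`|c| + 1) * nrm (f - P))).
  by apply: ler_wpM2r => //; rewrite (le_trans (ler_norm c)) // lerDl.
by rewrite mulrC -ltr_pdivlMr // ltr_wpDl.
Qed.

Lemma Hplus_ext f g : f =1 g -> Hplus f -> Hplus g. Proof. by move=> /funext ->. Qed.

Lemma Hplus_add f g : Hplus f -> Hplus g -> Hplus (fun l => f l + g l).
Proof.
move=> /HplusP[L2f Hf] /HplusP[L2g Hg]; apply/HplusP; split; first by have [] := L2_add L2f L2g.
move=> e e0; have e4 : 0 < e / 4 by rewrite divr_gt0.
have [P polP fP] := Hf _ e4; have [Q polQ gQ] := Hg _ e4.
exists (P + Q); first exact: lin_span_add.
have [_ le] := L2_add (L2_sub L2f (pol_L2 polP)) (L2_sub L2g (pol_L2 polQ)).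
rewrite (_ : (fun l => f l + g l) - (P + Q) = (f - P) + (g - Q)).
  by apply: le_lt_trans le _; lra.
by apply/funext => l; rewrite !fctE opprD addrACA.
Qed.

Lemma Hplus_scale z f : Hplus f -> Hplus (fun l => z *: f l).
Proof.
move=> Hf; apply: (@Hplus_ext (fun l => z%:M *m f l)); first by move=> l; rewrite mul_scalar_mx.
apply: (Hplus_map (c := reC z ^+ 2 + imC z ^+ 2)) Hf => [g /(L2_scale z)|P gP].
  by rewrite (_ : (fun l => z%:M *m g l) = fun l => z *: g l) //; apply/funext => l; rewrite mul_scalar_mx.
rewrite (_ : (fun l => _) = z *: P); first by apply: lin_span_scale; exact: lin_span_gen.
by apply/funext => l; rewrite mul_scalar_mx.
Qed.

Lemma Hplus_lam f : Hplus f -> Hplus (fun l => val l *: f l).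
Proof.
move=> Hf; apply: (@Hplus_ext (fun l => (val l)%:M *m f l)); first by move=> l; rewrite mul_scalar_mx.
apply: (Hplus_map (c := 1)) Hf => [g /L2_lam|P [k [j ->]]].
  by rewrite (_ : (fun l => (val l)%:M *m g l) = fun l => val l *: g l) //; apply/funext => l; rewrite mul_scalar_mx.
apply: lin_span_gen; exists k.+1, j; apply/funext => l.
by rewrite mul_scalar_mx scalerA exprS.
Qed.

Lemma Hplus_cst v : Hplus (fun=> v).
Proof.
apply: Hplus_pol; have -> : (fun=> v) = \sum_j v j 0 *: (fun l : circle R => val l ^+ 0 *: delta_mx j 0 : 'cV[C]_n).
  apply/funext => l; rewrite fct_sumE [LHS](matrix_sum_delta v); apply: eq_bigr => j _.
  by rewrite big_ord1 circle_funZ expr0 scale1r.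
elim/big_ind: _ => [|f g|j _]; [exact: lin_span0|exact: lin_span_add|].
by apply: lin_span_scale; apply: lin_span_gen; exists 0%N, j.
Qed.

Lemma Hplus_sum (I : Type) (r : seq I) (F : I -> circle_fun R n) :
  (forall i, Hplus (F i)) -> Hplus (fun l => \sum_(i <- r) F i l).
Proof.
move=> HF; elim: r => [|i r IH].
  by apply: (Hplus_ext _ (Hplus_cst 0)) => l; rewrite big_nil.
by apply: (Hplus_ext _ (Hplus_add (HF i) IH)) => l; rewrite big_cons.
Qed.

Lemma Hplus_delta (i j : 'I_n) f : Hplus f -> Hplus (fun l => delta_mx i j *m f l).
Proof.
apply: (Hplus_map (c := 1)) => [g|P [k [a ->]]]; first exact: L2_delta.
rewrite (_ : (fun l => _) = (a == j)%:R *: (fun l : circle R => val l ^+ k *: delta_mx i 0 : 'cV[C]_n)).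
  by apply: lin_span_scale; apply: lin_span_gen; exists k, i.
apply/funext => l; rewrite circle_funZ -scalemxAr mul_delta_mx_cond eq_sym scalerA mulrC -scalerA.
by case: eqP; rewrite ?scale1r ?scale0r ?mulr1n ?mulr0n.
Qed.

Lemma Hplus_mx (A : 'M[C]_n) f : Hplus f -> Hplus (fun l => A *m f l).
Proof.
move=> Hf; apply: (@Hplus_ext (fun l => \sum_i \sum_j A i j *: (delta_mx i j *m f l))).
  move=> l; rewrite [in RHS](matrix_sum_delta A) mulmx_suml; apply: eq_bigr => i _.
  by rewrite mulmx_suml; apply: eq_bigr => j _; rewrite scalemxAl.
apply: Hplus_sum => i; apply: Hplus_sum => j; apply: Hplus_scale; exact: Hplus_delta.
Qed.

Lemma Hplus_lamX k f : Hplus f -> Hplus (fun l => val l ^+ k *: f l).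
Proof.
move=> Hf; elim: k => [|k IH]; first by apply: (Hplus_ext _ Hf) => l; rewrite expr0 scale1r.
by apply: (Hplus_ext _ (Hplus_lam IH)) => l; rewrite scalerA exprS.
Qed.

Lemma Hplus_ploop i T f : Hplus f -> Hplus (fun l => ploop i T l *m f l).
Proof.
move=> Hf; apply: (@Hplus_ext (fun l => \sum_(k < i.+1) val l ^+ k *: (T k *m f l))).
  by move=> l; rewrite /ploop mulmx_suml; apply: eq_bigr => k _; rewrite scalemxAl.
by apply: Hplus_sum => k; apply: Hplus_lamX; exact: Hplus_mx.
Qed.

Lemma integr_comp f j : L2 f -> integr (fun t => reC (f (cis t) j 0)) /\
  integr (fun t => imC (f (cis t) j 0)).
Proof.
move=> /L2P[mf if1]; have i2 := integr_add (integr_cst 1) if1; have [m1 m2] := mf j.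
have le1 (t : R) : reC (f (cis t) j 0) ^+ 2 + imC (f (cis t) j 0) ^+ 2 <= sqnorm (f (cis t)).
  rewrite /sqnorm (bigD1 j) //= lerDl; apply: sumr_ge0 => k _.
  by rewrite addr_ge0 ?sqr_ge0.
have le2 (a b : R) : `|a| <= 1 + (a ^+ 2 + b ^+ 2).
  rewrite -(real_normK (num_real a)); have := sqr_ge0 b; have := sqr_ge0 (`|a| - 1).
  have := normr_ge0 a; move: `|a| => x; nra.
split; apply: integr_le i2 => // t.
  by apply: le_trans (le2 _ (imC (f (cis t) j 0))) _; rewrite lerD2l.
by apply: le_trans (le2 _ (reC (f (cis t) j 0))) _; rewrite lerD2l addrC.
Qed.

Local Notation Int h := (\int[mu]_(t in D) h t)%R.

Lemma IntD h k : integr h -> integr k -> Int (fun t => h t + k t) = Int h + Int k.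
Proof. by move=> ih ik; rewrite (RintegralD mD ih ik). Qed.

Lemma IntZ c h : integr h -> Int (fun t => c * h t) = c * Int h.
Proof. by move=> ih; rewrite (RintegralZl _ mD ih). Qed.

Lemma Int_cst c : Int (fun=> c) = c * (2 * pi).
Proof. by rewrite Rintegral_cst // [X in fine X](muD : mu D = _). Qed.

Lemma Int_sum (I : Type) (r : seq I) (h : I -> R -> R) : (forall i, integr (h i)) ->
  integr (fun t => \sum_(i <- r) h i t) /\
  Int (fun t => \sum_(i <- r) h i t) = \sum_(i <- r) Int (h i).
Proof.
move=> ih; elim: r => [|i r [IH1 IH2]].
  rewrite (_ : (fun t : R => _) = fun=> 0); last by apply/funext => t; rewrite big_nil.
  by split; [exact: integr_cst|rewrite Int_cst mul0r big_nil].
rewrite (_ : (fun t : R => _) = fun t => h i t + \sum_(i <- r) h i t); last first.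
  by apply/funext => t; rewrite big_cons.
by split; [exact: integr_add|rewrite IntD // IH2 big_cons].
Qed.

(** The Fourier coefficient of order 0. *)
Definition mean f : 'cV[C]_n := \col_j mkC (Int (fun t => reC (f (cis t) j 0)) / (2 * pi))
  (Int (fun t => imC (f (cis t) j 0)) / (2 * pi)).

Let pi2 : 2 * pi != 0 :> R. Proof. by rewrite mulf_neq0 // gt_eqF // pi_gt0. Qed.

Lemma mean_cst v : mean (fun=> v) = v.
Proof.
by apply/matrixP => j b; rewrite (ord1 b) mxE; apply: Cplx_ext; rewrite /= Int_cst mulfK.
Qed.

Lemma mean_add f g : L2 f -> L2 g -> mean (f + g) = mean f + mean g.
Proof.
move=> L2f L2g; apply/matrixP => j b; rewrite (ord1 b) !mxE.
have [i1 i2] := integr_comp j L2f; have [i3 i4] := integr_comp j L2g.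
apply: Cplx_ext; rewrite ?reCD ?imCD /= -mulrDl; congr (_ / _).
  by rewrite -IntD //; congr Rintegral; apply/funext => t; rewrite -reCD fctE mxE.
by rewrite -IntD //; congr Rintegral; apply/funext => t; rewrite -imCD fctE mxE.
Qed.

Lemma mean_scale z f : L2 f -> mean (z *: f) = z *: mean f.
Proof.
move=> L2f; apply/matrixP => j b; rewrite (ord1 b) !mxE.
have [i1 i2] := integr_comp j L2f.
apply: Cplx_ext; rewrite ?reCM ?imCM /=.
  rewrite (_ : (fun t : R => _) = fun t => reC z * reC (f (cis t) j 0) + - imC z * imC (f (cis t) j 0)).
    rewrite IntD; [|exact: integr_scale|exact: integr_scale].
    by rewrite !IntZ // mulrDl mulNr !mulrA mulNr.
  by apply/funext => t; rewrite circle_funZ mxE reCM mulNr.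
rewrite (_ : (fun t : R => _) = fun t => reC z * imC (f (cis t) j 0) + imC z * reC (f (cis t) j 0)).
  rewrite IntD; [|exact: integr_scale|exact: integr_scale].
  by rewrite !IntZ // mulrDl !mulrA.
by apply/funext => t; rewrite circle_funZ mxE imCM.
Qed.

Lemma mean_sub f g : L2 f -> L2 g -> mean (f - g) = mean f - mean g.
Proof.
move=> L2f L2g; have L2n : L2 (-1 *: g) by have [] := L2_scale (-1) L2g.
by rewrite -[- g]scaleN1r mean_add // mean_scale // scaleN1r.
Qed.

(** Expand the integral of the squared norm of [f] minus its mean, which is nonnegative. *)
Lemma nrm_mean f : L2 f -> nrm (fun=> mean f) <= nrm f.
Proof.
move=> L2f; have if1 : integr (fun t => sqnorm (f (cis t))) by have /L2P[] := L2f.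
pose m := mean f.
pose h (j : 'I_n) t := reC (m j 0) * reC (f (cis t) j 0) + imC (m j 0) * imC (f (cis t) j 0).
have ih j : integr (h j).
  by have [i1 i2] := integr_comp j L2f; apply: integr_add; exact: integr_scale.
have [is1 Is] := Int_sum (index_enum 'I_n) ih.
have Ih j : Int (h j) = (2 * pi) * (reC (m j 0) ^+ 2 + imC (m j 0) ^+ 2).
  have [i1 i2] := integr_comp j L2f.
  rewrite IntD ?IntZ //; try exact: integr_scale.
  have E1 : Int (fun t => reC (f (cis t) j 0)) = reC (m j 0) * (2 * pi) by rewrite mxE /= divfK.
  have E2 : Int (fun t => imC (f (cis t) j 0)) = imC (m j 0) * (2 * pi) by rewrite mxE /= divfK.
  by rewrite E1 E2; ring.
have : 0 <= Int (fun t => sqnorm (f (cis t) - m)).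
  by apply: Rintegral_ge0 => t _; exact: sqnorm_ge0.
rewrite (_ : (fun t : R => _) = fun t => (sqnorm (f (cis t)) + (- 2) * \sum_j h j t) + sqnorm m).
  rewrite IntD; [|apply: integr_add => //; exact: integr_scale|exact: integr_cst].
  rewrite IntD //; last exact: integr_scale.
  rewrite IntZ // Is (eq_bigr _ (fun j _ => Ih j)) -mulr_sumr Int_cst /nrm Int_cst.
  rewrite -/(sqnorm m) -/m; set a := Rintegral _ _ _.
  by move: a (sqnorm m) (2 * pi) => a b q; nra.
apply/funext => t; rewrite /sqnorm mulr_sumr -!big_split /=; apply: eq_bigr => j _.
by rewrite !mxE reCD imCD reCN imCN /h /m mxE; ring.
Qed.

Lemma cisX t k : val (@cis R t) ^+ k = mkC (cos (k%:R * t)) (sin (k%:R * t)).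
Proof.
elim: k => [|k IH]; first by rewrite expr0 mul0r cos0 sin0.
rewrite exprS IH -addn1 natrD mulrDl mul1r cosD sinD.
by apply: Cplx_ext; rewrite ?reCM ?imCM /=; ring.
Qed.

Lemma Int_cos k : Int (fun t => cos (k.+1%:R * t)) = 0 /\ Int (fun t => sin (k.+1%:R * t)) = 0.
Proof.
have k0 : k.+1%:R != 0 :> R by rewrite pnatr_eq0.
have p0 : (0 : R) < 2 * pi by rewrite mulr_gt0 // pi_gt0.
have kp : k.+1%:R * (2 * pi) = 0 + (pi *+ 2) *+ k.+1 :> R.
  by rewrite add0r -[(_ *+ 2) *+ _]mulr_natl -[pi *+ 2]mulr_natl.
have cl (t : R) : continuous_at t (fun t => k.+1%:R * t) by exact: (@mulrl_continuous R k.+1%:R t).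
have dl (t : R) : is_derive t (1 : R) (fun t : R => k.+1%:R * t) k.+1%:R.
  by have := is_deriveZ k.+1%:R (is_derive_id t (1 : R)); rewrite /GRing.scale /= mulr1.
have FTC (f F : R -> R) : continuous f -> (forall t, is_derive t (1 : R) F (f t)) ->
    F (2 * pi) = F 0 -> Int f = 0.
  move=> cf dF FF; rewrite /Rintegral (@continuous_FTC2 R f F 0 (2 * pi)) //.
  - by rewrite FF -EFinB subrr.
  - by apply: continuous_subspaceT.
  - have cF t : {for t, continuous F} by apply: differentiable_continuous; apply/derivable1_diffP.
    split=> [t _|//|//]; [by []|apply: cvg_at_right_filter|apply: cvg_at_left_filter]; exact: cF.
  - by move=> t _; rewrite derive1E derive_val.
split.
  apply: (FTC _ (fun t => k.+1%:R^-1 * sin (k.+1%:R * t))).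
  - by move=> t; apply: continuous_comp (cl t) _; exact: continuous_cos.
  - move=> t; have := is_deriveZ k.+1%:R^-1 (is_derive1_comp (is_derive_sin (k.+1%:R * t)) (dl t)).
    by move/is_derive_eq; apply; rewrite /GRing.scale /=; field.
  - by rewrite kp (periodicn (@sinD2pi R)) mulr0 sin0.
apply: (FTC _ (fun t => - k.+1%:R^-1 * cos (k.+1%:R * t))).
- by move=> t; apply: continuous_comp (cl t) _; exact: continuous_sin.
- move=> t; have := is_deriveZ (- k.+1%:R^-1) (is_derive1_comp (is_derive_cos (k.+1%:R * t)) (dl t)).
  by move/is_derive_eq; apply; rewrite /GRing.scale /=; field.
- by rewrite kp (periodicn (@cosD2pi R)) mulr0 cos0.
Qed.

Lemma mean_lam P : pol P -> mean (fun l => val l *: P l) = 0.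
Proof.
move=> polP; suff [] : L2 P /\ mean (fun l => val l *: P l) = 0 by [].
move: P polP; apply: lin_span_ind.
  split; first exact: (L2_cst 0).
  rewrite (_ : (fun l => _) = fun=> 0); first exact: mean_cst.
  by apply/funext => l; rewrite scaler0.
move=> a w v gw [L2v m0]; have L2w := pol_L2 (lin_span_gen gw).
split; first by have [] := L2_add (proj1 (L2_scale a L2w)) L2v.
have [k [j wE]] := gw.
have E : mean (fun l : circle R => val l ^+ k.+1 *: delta_mx j 0 : 'cV[C]_n) = 0.
  have [Ic Is] := Int_cos k.
  apply/matrixP => i b; rewrite (ord1 b) !mxE; apply: Cplx_ext => /=.
    rewrite (_ : (fun t : R => _) = fun t => (i == j)%:R * cos (k.+1%:R * t)).
      case: eqP => _; last by rewrite (_ : (fun t : R => _) = fun=> 0) ?Int_cst ?mul0r //; apply/funext => t; rewrite mul0r.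
      by rewrite (_ : (fun t : R => _) = fun t => cos (k.+1%:R * t)) ?Ic ?mul0r //; apply/funext => t; rewrite mul1r.
    by apply/funext => t; rewrite !mxE cisX eqxx andbT; case: eqP => _; rewrite ?mulr1 ?mulr0 ?mul1r ?mul0r.
  rewrite (_ : (fun t : R => _) = fun t => (i == j)%:R * sin (k.+1%:R * t)).
    case: eqP => _; last by rewrite (_ : (fun t : R => _) = fun=> 0) ?Int_cst ?mul0r //; apply/funext => t; rewrite mul0r.
    by rewrite (_ : (fun t : R => _) = fun t => sin (k.+1%:R * t)) ?Is ?mul0r //; apply/funext => t; rewrite mul1r.
  by apply/funext => t; rewrite !mxE cisX eqxx andbT; case: eqP => _; rewrite ?mulr1 ?mulr0 ?mul1r ?mul0r.
rewrite (_ : (fun l => _) = a *: (fun l => val l *: w l) + (fun l => val l *: v l)); last first.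
  by apply/funext => l; rewrite !circle_funD !circle_funZ scalerDr !scalerA mulrC.
have [L2lw _] := L2_lam L2w; have [L2lv _] := L2_lam L2v.
rewrite mean_add // ?mean_scale // ?m0 ?addr0.
  rewrite (_ : (fun l => _) = fun l : circle R => val l ^+ k.+1 *: delta_mx j 0 : 'cV[C]_n).
    by rewrite E scaler0.
  by apply/funext => l; rewrite wE scalerA exprS.
by have [] := L2_scale a L2lw.
Qed.

Lemma pol_split P : pol P -> exists v Q, pol Q /\ forall l, P l = v + val l *: Q l.
Proof.
move: P; apply: lin_span_ind.
  by exists 0, 0; split=> [|l]; [exact: lin_span0|rewrite scaler0 addr0].
move=> a w P [k [j wE]] [v [Q [polQ PE]]]; case: k wE => [|k] wE.
  exists (a *: delta_mx j 0 + v), Q; split => // l.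
  by rewrite circle_funD circle_funZ PE wE expr0 scale1r addrA.
exists v, (a *: (fun l => val l ^+ k *: delta_mx j 0) + Q); split.
  by apply: lin_span_cons => //; exists k, j.
move=> l; rewrite !circle_funD !circle_funZ PE wE addrCA scalerDr.
by rewrite !scalerA exprS mulrA [a * _]mulrC.
Qed.

Lemma mean_pol v Q : pol Q -> mean (fun l => v + val l *: Q l) = v.
Proof.
move=> polQ; have [L2l _] := L2_lam (pol_L2 polQ).
rewrite (_ : (fun l => _) = (fun=> v) + (fun l => val l *: Q l)) //.
by rewrite mean_add ?mean_cst ?mean_lam ?addr0 //; exact: L2_cst.
Qed.

(** The constant is the mean. If [P = v + lambda Q] is a polynomial close to [f], then [v] is the
    mean of [P], so [Q] differs from the quotient, up to the factor [lambda^-1], by [f - P] minus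
    its mean. *)
Lemma Hplus_split f : Hplus f -> exists v, Hplus (fun l => (val l)^-1 *: (f l - v)).
Proof.
move=> /HplusP[L2f H]; exists (mean f); have L2m := L2_cst (mean f).
have [L2g _] := L2_lamV (L2_sub L2f L2m).
apply/HplusP; split; first by apply: L2g.
(* The error is at most [4 * nrm (f - P)]: a factor 2 from [L2_add], and the mean is no larger than
   [f - P] itself. *)
move=> e e0; have d0 : 0 < e / 8 by rewrite divr_gt0.
have [P polP fP] := H _ d0; have [v [Q [polQ PE]]] := pol_split polP.
exists Q => //; have L2P' := pol_L2 polP.
have mP : mean P = v by rewrite -[RHS](mean_pol v polQ); congr mean; apply/funext.
have L2d := L2_sub L2f L2P'; have L2c := L2_cst (mean (f - P)).
have [_ le1] := L2_lamV (L2_sub L2d L2c).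
have [_ le2] := L2_add L2d (proj1 (L2_scale (-1) L2c)).
have [_ le3] := L2_scale (-1) L2c.
have le4 := nrm_mean L2d.
have -> : (fun l => (val l)^-1 *: (f l - mean f)) - Q =
    fun l => (val l)^-1 *: (f - P - (fun=> mean (f - P))) l.
  apply/funext => l; rewrite !fctE mean_sub // mP PE.
  have {1}-> : Q l = (val l)^-1 *: (val l *: Q l) by rewrite scalerA mulVf ?circle_neq0 // scale1r.
  have E (x y z w : 'cV[C]_n) : x - y - z = x - (w + z) - (y - w).
    by apply/matrixP => i b; rewrite !mxE; ring.
  by rewrite -scalerBr; congr (_ *: _); exact: E.
apply: le_lt_trans le1 _; rewrite mul1r; apply: le_lt_trans (_ : 4 * nrm (f - P) < e); last by lra.
have -> : f - P - (fun=> mean (f - P)) = f - P + (fun=> -1 *: mean (f - P)).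
  by apply/funext => l; rewrite !fctE scaleN1r.
apply: le_trans le2 _; move: le3; rewrite reCN imCN /= => le3; lra.
Qed.

(** Lambda turns a polynomial close to [lambda^-1 v] into one without constant term close to [v],
    while the mean of the difference is [v]. With [Hplus_split], this is all that is used about
    Fourier coefficients from here on. *)
Lemma Hplus_cst0 v : Hplus (fun l => (val l)^-1 *: v) -> v = 0.
Proof.
move=> /HplusP[L2v H]; have n0 : sqnorm v = 0.
  apply/eqP; rewrite eq_le sqnorm_ge0 andbT; apply/ler_addgt0Pr => e e0; rewrite add0r.
  have [Q polQ vQ] := H _ (mulr_gt0 e0 (mulr_gt0 (ltr0n R 2) (pi_gt0 R))).
  have L2d := L2_sub L2v (pol_L2 polQ); have [L2ld le1] := L2_lam L2d.
  have E : (fun l => val l *: (((fun l => (val l)^-1 *: v) - Q) l)) = fun l => v + val l *: (-1 *: Q) l.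
    apply/funext => l; rewrite !fctE scalerDr scalerA mulfV ?circle_neq0 // scale1r.
    by rewrite scaleN1r.
  have := nrm_mean L2ld; rewrite E mean_pol; last exact: lin_span_scale.
  rewrite -E => le2; have := le_trans le2 le1; rewrite mul1r => /le_lt_trans/(_ vQ).
  rewrite [nrm _]Int_cst ltr_pM2r ?mulr_gt0 ?pi_gt0 //; exact: ltW.
apply/matrixP => j b; rewrite (ord1 b) mxE; have /eqP := n0.
rewrite psumr_eq0 => [/allP/(_ j (mem_index_enum _))|k _]; last by rewrite addr_ge0 ?sqr_ge0.
rewrite /= paddr_eq0 ?sqr_ge0 // !sqrf_eq0 => /andP[/eqP a /eqP c]; exact: Cplx_ext.
Qed.

End Hardy.

(** * Shift-invariant subspaces of loops *)

Section LoopSpaces.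
Context {R : realType} {n : nat}.
Local Notation C := (Cplx R).
Implicit Types (F G : loop R n) (f g h y : circle_fun R n) (l : circle R) (P : 'M[C]_n) (T : nat -> 'M[C]_n).

Definition unitary_loop F := forall l, (F l) ^t* *m F l = 1%:M.

Lemma unitary_loopV F l : unitary_loop F -> F l *m (F l) ^t* = 1%:M.
Proof. by move=> /(_ l) /mulmx1C. Qed.

Lemma loop_imageP F y : unitary_loop F ->
  loop_image F Hplus y <-> Hplus (fun l => (F l) ^t* *m y l).
Proof.
move=> uF; split=> [[f Hf <-]|Hy].
  by apply: Hplus_ext Hf => l; rewrite mulmxA uF mul1mx.
exists (fun l => (F l) ^t* *m y l) => //; apply/funext => l.
by rewrite mulmxA unitary_loopV // mul1mx.
Qed.

Lemma pfac_mul m P l (B : 'M[C]_(n, m)) :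
  pfac P l *m B = P *m B + val l *: ((1%:M - P) *m B).
Proof. by rewrite scalemxAl -mulmxDl. Qed.

Lemma pfacV_mul m P l (B : 'M[C]_(n, m)) :
  pfacV P l *m B = P *m B + (val l)^-1 *: ((1%:M - P) *m B).
Proof. by rewrite scalemxAl -mulmxDl. Qed.

Lemma pfac_Hplus P f : Hplus f -> Hplus (fun l => pfac P l *m f l).
Proof.
move=> Hf; apply: (@Hplus_ext _ _ (fun l => P *m f l + val l *: ((1%:M - P) *m f l))).
  by move=> l; rewrite pfac_mul.
by apply: Hplus_add; [exact: Hplus_mx|apply: Hplus_lam; exact: Hplus_mx].
Qed.

Lemma Hplus_sub f g : Hplus f -> Hplus g -> Hplus (fun l => f l - g l).
Proof.
move=> Hf /(Hplus_scale (-1)) Hg; apply: Hplus_ext (Hplus_add Hf Hg) => l.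
by rewrite scaleN1r.
Qed.

Lemma Hplus_uncons f : Hplus f -> exists v g, Hplus g /\ forall l, f l = v + val l *: g l.
Proof.
move=> /Hplus_split[v Hg]; exists v, (fun l => (val l)^-1 *: (f l - v)); split => // l.
by rewrite scalerA mulfV ?circle_neq0 // scale1r addrC subrK.
Qed.

(** If [lambda y] is the loop applied to [g], with [y] in the Hardy space, then the constant term
    [T 0 v] vanishes. The rows of [P] are combinations of those of [T 0], so [P v = 0] and [P g] is
    divisible by lambda; this is membership in the image of [G]. *)
Lemma uhlenbeck_image i T G P : unitary_loop G -> herm_proj P ->
  (forall f, Hplus f -> Hplus (fun l => G l *m f l)) ->
  (forall l, ploop i T l = G l *m pfac P l) -> (P <= T 0%N)%MS ->
  loop_image G Hplus = uhlenbeck_step (loop_image (ploop i T) Hplus).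
Proof.
move=> uG hP HG E /submxP[D PD]; apply/seteqP; split=> [_ [f Hf <-]|].
  split; last exact: HG.
  exists (fun l => val l *: (G l *m f l)); last first.
    by apply/funext => l; rewrite /lam_mul scalerA exprN1 mulVf ?circle_neq0 // scale1r.
  exists (fun l => val l *: (P *m f l) + (1%:M - P) *m f l).
    by apply: Hplus_add; [apply: Hplus_lam; exact: Hplus_mx|exact: Hplus_mx].
  apply/funext => l; rewrite E -mulmxA [RHS]scalemxAr; congr (_ *m _).
  have [e1 e2 e3 e4] := herm_projM hP.
  rewrite pfac_mul [P *m (_ + _)]mulmxDr [(1%:M - P) *m (_ + _)]mulmxDr -!scalemxAr.
  rewrite !mulmxA e1 e2 e3 e4 !mul0mx scaler0 addr0 add0r -scalerDr -mulmxDl.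
  by rewrite addrCA subrr addr0 mul1mx.
move=> y [[_ [g Hg <-] yE] Hy].
have {}yE l : val l *: y l = ploop i T l *m g l.
  by rewrite -yE /lam_mul scalerA exprN1 mulfV ?circle_neq0 // scale1r.
have [v [g' [Hg' gE]]] := Hplus_uncons Hg.
have Tv : T 0%N *m v = 0.
  apply: Hplus_cst0; apply: (@Hplus_ext _ _ (fun l => y l - ploop i T l *m g' l -
      \sum_(k < i) val l ^+ k *: (T k.+1 *m v))); last first.
    apply: Hplus_sub; first by apply: Hplus_sub => //; exact: Hplus_ploop.
    by apply: Hplus_sum => k; apply: Hplus_lamX; exact: Hplus_cst.
  move=> l; apply: (scalerI (circle_neq0 l)); rewrite !scalerBr yE gE mulmxDr -scalemxAr.
  rewrite [X in X - _ = _]addrK scalerA mulfV ?circle_neq0 // scale1r.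
  rewrite /ploop big_ord_recl expr0 scale1r mulmxDl mulmx_suml scaler_sumr.
  rewrite (eq_bigr (fun k : 'I_i => val l *: (val l ^+ k *: (T k.+1 *m v)))) ?addrK //.
  by move=> k _; rewrite -scalemxAl scalerA -exprS.
have Pv : P *m v = 0 by rewrite PD -mulmxA Tv mulmx0.
exists (fun l => P *m g' l + (1%:M - P) *m g l).
  by apply: Hplus_add; exact: Hplus_mx.
apply/funext => l; apply: (scalerI (circle_neq0 l)); rewrite yE E -mulmxA [LHS]scalemxAr.
congr (_ *m _); rewrite pfac_mul scalerDr; congr (_ + _).
by rewrite gE mulmxDr Pv add0r scalemxAr.
Qed.

(** Let [v] be the constant term of [f]. Modulo the image of the larger loop, [G f] is that loop
    applied to [lambda^-1 (1 - P) v]. By the row space hypothesis [(1 - P) v] is the adjoint of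
    [T i.+1] applied to some [w], and then this term is [lambda^i w] modulo the same image. *)
Lemma segal_image i T G P : unitary_loop G -> unitary_loop (ploop i.+1 T) -> herm_proj P ->
  (forall f, Hplus f -> Hplus (fun l => val l ^+ i *: ((G l) ^t* *m f l))) ->
  (forall l, ploop i.+1 T l = G l *m pfac P l) -> (1%:M - P <= T i.+1)%MS ->
  loop_image G Hplus = segal_step i.+1 (loop_image (ploop i.+1 T) Hplus).
Proof.
move=> uG uF hP HG E /submxP[D PD].
(* The step with parameter [i.+1] adds [lambda^i] times the Hardy space. *)
have lamE l : (val l ^ (i.+1%:Z - 1))%R = val l ^+ i by rewrite intS addrC addKr.
apply/seteqP; split; last first.
  move=> _ [_ [f Hf <-]] [_ [h Hh <-] <-]; apply/(loop_imageP _ uG).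
  apply: (Hplus_ext _ (Hplus_add (pfac_Hplus P Hf) (HG _ Hh))) => l.
  rewrite circle_funD mulmxDr E -mulmxA mulmxA uG mul1mx; congr (_ + _).
  by rewrite /lam_mul lamE scalemxAr.
move=> _ [f Hf <-]; have [v [g [Hg fE]]] := Hplus_uncons Hf.
pose w := D ^t* *m v.
have Qv : (1%:M - P) *m v = (T i.+1) ^t* *m w.
  by have [<- _] := herm_projC hP; rewrite PD adjmxM mulmxA.
exists (fun l => ploop i.+1 T l *m (P *m f l + ((1%:M - P) *m g l -
    \sum_(k < i.+1) val l ^+ (i - k) *: ((T k) ^t* *m w)))).
  exists (fun l => P *m f l + ((1%:M - P) *m g l - \sum_(k < i.+1) val l ^+ (i - k) *: ((T k) ^t* *m w))) => //.
  apply: Hplus_add; first exact: Hplus_mx.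
  apply: Hplus_sub; first exact: Hplus_mx.
  by apply: Hplus_sum => k; apply: Hplus_lamX; exact: Hplus_cst.
exists (lam_mul (i.+1%:Z - 1) (fun=> w)); first by exists (fun=> w) => //; exact: Hplus_cst.
apply/funext => l; rewrite circle_funD /lam_mul lamE; apply: (scalerI (circle_neq0 l)).
rewrite scalerDr scalerA -exprS.
(* [lambda^(i.+1)] times the adjoint loop is a polynomial with constant term the adjoint of
   [T i.+1]; the sum collects the other terms, divided by lambda. *)
have Fw : val l *: (ploop i.+1 T l *m \sum_(k < i.+1) val l ^+ (i - k) *: ((T k) ^t* *m w)) =
   val l ^+ i.+1 *: w - ploop i.+1 T l *m ((1%:M - P) *m v).
  have -> : val l ^+ i.+1 *: w = ploop i.+1 T l *m (val l ^+ i.+1 *: ((ploop i.+1 T l) ^t* *m w)).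
    by rewrite -scalemxAr mulmxA unitary_loopV // mul1mx.
  rewrite -mulmxBr [LHS]scalemxAr; congr (_ *m _); rewrite Qv.
  suff -> : val l ^+ i.+1 *: ((ploop i.+1 T l) ^t* *m w) =
      val l *: (\sum_(k < i.+1) val l ^+ (i - k) *: ((T k) ^t* *m w)) + (T i.+1) ^t* *m w.
    by rewrite addrK.
  rewrite ploop_adj mulmx_suml [LHS]scaler_sumr [LHS]big_ord_recr; congr (_ + _); last first.
    by rewrite -scalemxAl scalerA mulfV ?expf_neq0 ?circle_neq0 // scale1r.
  rewrite [RHS]scaler_sumr; apply: eq_bigr => k _.
  rewrite -scalemxAl !scalerA -exprS -exprB ?unitfE ?circle_neq0 //; last first.
    exact: ltnW (ltn_ord k).
  by have -> : (i.+1 - widen_ord (leqnSn i.+1) k)%N = (i - k).+1 by rewrite /= subSn // -ltnS.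
rewrite !mulmxDr scalerDr mulmxN scalerDr scalerN Fw opprB.
have -> : G l *m f l = ploop i.+1 T l *m pfacV P l *m f l by rewrite E -[_ *m _ *m pfacV _ _]mulmxA pfacK // mulmx1.
have -> : val l *: (ploop i.+1 T l *m pfacV P l *m f l) =
    val l *: (ploop i.+1 T l *m (P *m f l)) + ploop i.+1 T l *m ((1%:M - P) *m f l).
  rewrite -mulmxA pfacV_mul [ploop _ _ _ *m (_ + _)]mulmxDr scalerDr; congr (_ + _).
  by rewrite -scalemxAr scalerA mulfV ?circle_neq0 // scale1r.
rewrite -!addrA addNr addr0; congr (_ + _).
rewrite scalemxAr -mulmxDr; congr (_ *m _).
by rewrite fE mulmxDr -scalemxAr addrC.
Qed.

End LoopSpaces.

Section Laurent.
Context {R : realType} {n : nat}.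
Local Notation C := (Cplx R).
Implicit Types (f g h y : circle_fun R n) (l : circle R) (T : nat -> 'M[C]_n).

(** Coefficients are peeled off from below: after multiplication by all but one of the missing
    powers of lambda, only [lambda^-1 p 0] lies outside the polynomials, and [Hplus_cst0]
    applies. *)
Lemma laurent_Hplus N m (p : nat -> 'cV[C]_n) :
  Hplus (fun l => val l ^- m *: \sum_(k < N) val l ^+ k *: p k) ->
  forall k, (k < N)%N -> (k < m)%N -> p k = 0.
Proof.
elim: N m p => [//|N IH] [//|m] p H.
have E l : \sum_(k < N.+1) val l ^+ k *: p k = p 0%N + val l *: \sum_(k < N) val l ^+ k *: p k.+1.
  rewrite big_ord_recl expr0 scale1r scaler_sumr; congr (_ + _).
  by apply: eq_bigr => k _; rewrite scalerA -exprS.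
have p0 : p 0%N = 0.
  apply: Hplus_cst0; apply: (@Hplus_ext _ _ (fun l => val l ^+ m *: (val l ^- m.+1 *: \sum_(k < N.+1) val l ^+ k *: p k) -
      \sum_(k < N) val l ^+ k *: p k.+1)).
    move=> l; rewrite E scalerA exprSr invfM mulrA mulfV ?expf_neq0 ?circle_neq0 // mul1r.
    by rewrite scalerDr scalerA mulVf ?circle_neq0 // scale1r addrK.
  apply: Hplus_sub; first exact: Hplus_lamX.
  by apply: Hplus_sum => k; apply: Hplus_lamX; exact: Hplus_cst.
move=> [//|k]; rewrite !ltnS; apply: (IH m (fun k => p k.+1)).
apply: Hplus_ext H => l; rewrite E p0 add0r scalerA exprS invfM mulrC mulrA.
by rewrite mulfV ?circle_neq0 // mul1r.
Qed.

(** The coefficients of [lambda^i] times the adjoint loop, which is again a polynomial. *)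
Definition rev_adj i T k : 'M[C]_n := (T (i - k)%N) ^t*.

Lemma ploop_rev i T l : ploop i (rev_adj i T) l = val l ^+ i *: (ploop i T l) ^t*.
Proof.
rewrite ploop_adj scaler_sumr /ploop (reindex_inj rev_ord_inj); apply: eq_bigr => k _.
have ki : (k <= i)%N by rewrite -ltnS.
have -> : (rev_ord k : nat) = (i - k)%N by rewrite /= subSS.
by rewrite /rev_adj subKn // scalerA -exprB ?unitfE ?circle_neq0.
Qed.

Lemma poly_mul m k i j (A : nat -> 'M[C]_(n, m)) (B : nat -> 'M[C]_(m, k)) (l : circle R) :
  (\sum_(a < i.+1) val l ^+ a *: A a) *m (\sum_(b < j.+1) val l ^+ b *: B b) =
  \sum_(q < (i + j).+1) val l ^+ q *: \sum_(a < i.+1) \sum_(b < j.+1 | (a + b == q)%N) A a *m B b.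
Proof.
under [RHS]eq_bigr => q _ do rewrite scaler_sumr.
rewrite exchange_big mulmx_suml; apply: eq_bigr => a _.
under [RHS]eq_bigr => q _ do rewrite scaler_sumr.
rewrite (exchange_big_dep xpredT) //= mulmx_sumr; apply: eq_bigr => b _.
have ab : (a + b < (i + j).+1)%N by have := ltn_ord a; have := ltn_ord b; lia.
rewrite (big_pred1 (Ordinal ab)) => [|q]; last by rewrite /= eq_sym.
by rewrite -scalemxAl -scalemxAr scalerA exprD.
Qed.

Lemma ploop_mul i j T T' : exists U, forall l,
  ploop i T l *m ploop j T' l = ploop (i + j) U l.
Proof.
by exists (fun q => \sum_(a < i.+1) \sum_(b < j.+1 | (a + b == q)%N) T a *m T' b) => l; exact: poly_mul.
Qed.

(** The quotient of the two loops and its adjoint both map constants into the Hardy space, so the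
    quotient has neither negative nor positive powers. The remaining constant is determined at
    lambda = 1. *)
Lemma loop_image_inj i T T' : unitary_loop (ploop i T) -> unitary_loop (ploop i T') ->
  ploop i T (@circle1 R) = 1%:M -> ploop i T' (@circle1 R) = 1%:M ->
  loop_image (ploop i T) Hplus = loop_image (ploop i T') Hplus ->
  forall l, ploop i T l = ploop i T' l.
Proof.
move=> uT uT' T1 T1' WW.
pose K l := (ploop i T' l) ^t* *m ploop i T l.
have [U UE] := ploop_mul i i (rev_adj i T') T.
have KE l : val l ^+ i *: K l = ploop (i + i) U l by rewrite -UE ploop_rev scalemxAl.
have KH v : Hplus (fun l => K l *m v).
  have : loop_image (ploop i T) Hplus (fun l => ploop i T l *m v) by exists (fun=> v) => //; exact: Hplus_cst.
  by rewrite WW => /(loop_imageP _ uT'); apply: Hplus_ext => l; rewrite mulmxA.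
have KsH v : Hplus (fun l => (K l) ^t* *m v).
  have : loop_image (ploop i T') Hplus (fun l => ploop i T' l *m v) by exists (fun=> v) => //; exact: Hplus_cst.
  by rewrite -WW => /(loop_imageP _ uT); apply: Hplus_ext => l; rewrite mulmxA adjmxM adjmxK.
have V (U' : nat -> 'M[C]_n) : (forall v, Hplus (fun l => val l ^- i *: (ploop (i + i) U' l *m v))) ->
    forall k, (k < i)%N -> U' k = 0.
  move=> H k ki; apply: mx_col_ext => j; rewrite mul0mx.
  apply: (@laurent_Hplus (i + i).+1 i (fun k => U' k *m delta_mx j 0)) => //; last by lia.
  apply: Hplus_ext (H (delta_mx j 0)) => l; congr (_ *: _).
  by rewrite mulmx_suml; apply: eq_bigr => q _; rewrite scalemxAl.
have Ulo k : (k < i)%N -> U k = 0.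
  apply: V => v; apply: Hplus_ext (KH v) => l.
  by rewrite -KE -scalemxAl scalerA mulVf ?expf_neq0 ?circle_neq0 // scale1r.
have Urev : forall k, (k < i)%N -> rev_adj (i + i) U k = 0.
  apply: V => v; apply: Hplus_ext (KsH v) => l.
  rewrite ploop_rev -KE adjmxZ circle_conjX scalerA -scalemxAl scalerA exprD.
  by rewrite mulfK ?mulVf ?expf_neq0 ?circle_neq0 // scale1r.
have Uhi k : (k < i)%N -> U (i + i - k)%N = 0.
  by move=> /Urev; rewrite /rev_adj => e; rewrite -[U _]adjmxK e adjmx0.
have K0 l : K l = U i.
  apply: (scalerI (expf_neq0 i (circle_neq0 l))); rewrite KE.
  have ii : (i < (i + i).+1)%N by rewrite ltnS leq_addr.
  rewrite /ploop (bigD1 (Ordinal ii)) //= big1 ?addr0 // => k; rewrite -val_eqE /= neq_ltn.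
  case/orP => ki; first by rewrite Ulo ?scaler0.
  have := Uhi (i + i - k)%N; rewrite subKn -1?ltnS ?ltn_ord // => -> //; rewrite ?scaler0 //.
  by have := ltn_ord k; lia.
have U1 : U i = 1%:M by rewrite -(K0 (@circle1 R)) /K T1 T1' adjmx1 mul1mx.
move=> l; have := K0 l; rewrite U1 /K => /(congr1 (mulmx (ploop i T' l))).
by rewrite mulmxA unitary_loopV // mul1mx mulmx1.
Qed.

(** The parameter of the Segal step drops by one because the Uhlenbeck step divides by lambda. *)
Lemma segal_uhlenbeck i (W : set (circle_fun R n)) :
  segal_step i.+1 (uhlenbeck_step W) = uhlenbeck_step (segal_step i.+2 W).
Proof.
have lamE j l : (val l ^ (j.+1%:Z - 1))%R = val l ^+ j by rewrite intS addrC addKr.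
have lamN l : (val l ^ (-1))%R = (val l)^-1 by rewrite exprN1.
apply/seteqP; split.
  move=> _ [a [[w Ww aE] Ha]] [_ [h Hh <-] <-]; split.
    exists (w + lam_mul (i.+2%:Z - 1) h).
      by exists w => //; exists (lam_mul (i.+2%:Z - 1) h) => //; exists h.
    apply/funext => l; rewrite /lam_mul lamN !circle_funD -aE scalerDr; congr (_ + _).
    by rewrite !lamE scalerA exprS mulrA mulVf ?circle_neq0 // mul1r.
  apply: Hplus_add => //; apply: (Hplus_ext _ (Hplus_lamX i Hh)) => l.
  by rewrite /lam_mul lamE.
move=> y [[_ [w Ww [_ [h Hh <-] <-]] yE] Hy].
have lh : Hplus (fun l => val l ^+ i *: h l) by exact: Hplus_lamX.
exists (lam_mul (-1) w).
  split; first by exists w.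
  apply: (Hplus_ext _ (Hplus_sub Hy lh)) => l.
  rewrite -yE /lam_mul lamN circle_funD lamE scalerDr scalerA exprS mulrA mulVf ?circle_neq0 //.
  by rewrite mul1r addrK.
exists (lam_mul (i.+1%:Z - 1) h); first by exists h.
apply/funext => l; rewrite -yE /lam_mul lamN !circle_funD !lamE scalerDr scalerA exprS mulrA mulVf ?circle_neq0 //.
by rewrite mul1r.
Qed.

End Laurent.

(** * Reality after two alternate steps *)

Section Reality.
Context {R : realType} {M : riemannSurface R} {n : nat}.
Local Notation C := (Cplx R).
Implicit Types (T : nat -> M -> 'M[C]_n) (l : circle R).

Lemma step_image b i T T' pi : ext_sol i.+1 T -> ext_sol i T' -> step_rel b i T T' pi ->
  off_discrete setT (fun p => loop_image (ploop i (T' ^~ p)) Hplus =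
    match b with
    | Uhlenbeck => uhlenbeck_step (loop_image (ploop i.+1 (T ^~ p)) Hplus)
    | Segal => segal_step i.+1 (loop_image (ploop i.+1 (T ^~ p)) Hplus)
    end).
Proof.
move=> [_ _ uT _ _] [_ _ uT' _ _] [hpi _ fac gpi].
apply: off_discreteS gpi => p; case: b => E.
  apply: (@uhlenbeck_image _ _ i.+1 _ _ (pi p)); [exact: uT'|exact: hpi| |exact: fac|by rewrite E].
  by move=> f; exact: Hplus_ploop.
apply: (@segal_image _ _ i _ _ (pi p)); [exact: uT'|exact: uT|exact: hpi| |exact: fac|by rewrite E].
move=> f Hf; apply: Hplus_ext (Hplus_ploop i (rev_adj i (T' ^~ p)) Hf) => l.
by rewrite ploop_rev scalemxAl.
Qed.

Lemma real_two_steps b i T2 T1 T0 pi2 pi1 : ext_sol i.+2 T2 -> ext_sol i.+1 T1 -> ext_sol i T0 ->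
  sharp i.+2 T2 = T2 -> step_rel b i.+1 T2 T1 pi2 -> step_rel (other_step b) i T1 T0 pi1 ->
  sharp i T0 = T0.
Proof.
move=> e2 e1 e0 r2 s2 s1.
have e1' := ext_sol_sharp e1; have e0' := ext_sol_sharp e0.
have := step_rel_sharp s2; rewrite r2 => s2'; have s1' := step_rel_sharp s1.
have W1 := step_image e2 e1 s2; have W0 := step_image e1 e0 s1.
have W1' := step_image e2 e1' s2'; have W0' := step_image e1' e0' s1'.
(* Equality of the spaces is available only off a discrete set; it is converted there into equality
   of coefficients, which extends by smoothness. *)
have E : off_discrete setT (fun p => forall k, (k <= i)%N -> sharp i T0 k p = T0 k p).
  apply: off_discreteS (off_discrete_and (off_discrete_and W1 W0) (off_discrete_and W1' W0')) => p.
  move=> [[w1 w0] [w1' w0']]; apply: ploop_inj => l.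
  have [_ _ u0 o0 _] := e0; have [_ _ u0' o0' _] := e0'.
  apply: loop_image_inj; [exact: u0'|exact: u0|exact: o0'|exact: o0|].
  rewrite w0 w0' w1 w1'; case: (b) => /=; first by rewrite segal_uhlenbeck.
  by rewrite segal_uhlenbeck.
have [_ sT _ _ _] := e0; have [_ sT' _ _ _] := e0'; have [T0i _ _ _ _] := e0.
apply/funext => k; apply/funext => p; have [ki|ik] := leqP k i; last first.
  by rewrite T0i // /sharp leqNgt ik.
apply/eqP; rewrite -subr_eq0; apply/eqP.
apply: (@smoothM_eq0 _ _ _ _ (fun p => sharp i T0 k p - T0 k p)).
  by apply: smoothM_add; [exact: sT'|apply: smoothM_opp; exact: sT].
by apply: off_discreteS E => q ->; rewrite ?subrr.
Qed.

End Reality.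

(** * From loop-valued maps to families of coefficients and back *)

Section AffineComp.
Context {R : realType} {E E' : normedModType R}.

Lemma Ck_comp_affine (g L : E' -> E) k (U : set E) (f : E -> R) : continuous g ->
  (forall x v (h : R), g (h *: v + x) = h *: L v + g x) ->
  Ck k U f -> Ck k (g @^-1` U) (f \o g).
Proof.
move=> cg gL; elim: k f => [|k IH] f [cf df].
  by split=> // x Ux; apply: continuous_comp (cg x) (cf _ Ux).
split=> [x Ux|v]; first by apply: continuous_comp (cg x) (cf _ Ux).
have E0 x : (fun h : R => h^-1 *: ((f \o g \o shift x) (h *: v) - (f \o g) x)) =
    (fun h : R => h^-1 *: ((f \o shift (g x)) (h *: L v) - f (g x))).
  by apply/funext => h; rewrite /= gL.
have [dfv Cf] := df (L v); split; first by move=> x Ux; rewrite /derivable E0; exact: dfv.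
have -> : 'D_v (f \o g) = 'D_(L v) f \o g by apply/funext => x; rewrite /derive E0.
exact: IH.
Qed.

(** For restricting a map on a product to a slice, and for pulling back a map from one factor to the
    product. *)
Lemma smooth_comp_affine (g L : E' -> E) (U : set E) (f : E -> Cplx R) : continuous g ->
  (forall x v (h : R), g (h *: v + x) = h *: L v + g x) ->
  smooth_on U f -> smooth_on (g @^-1` U) (fun x => f (g x)).
Proof.
move=> cg gL sf k; have [a b] := sf k.
by split; [exact: (Ck_comp_affine cg gL a)|exact: (Ck_comp_affine cg gL b)].
Qed.

End AffineComp.

Section CircleSmooth.
Context {R : realType}.
Local Notation C := (Cplx R).

Lemma Ck_cos_sin k : Ck k (setT : set R) (@cos R) /\ Ck k (setT : set R) (@sin R).
Proof.
have D (f g : R -> R) v x : is_derive x (1 : R) f (g x) -> derivable f x v /\ 'D_v f x = v * g x.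
  move=> fg; have df : differentiable f x by apply/derivable1_diffP.
  split; first exact: diff_derivable.
  rewrite deriveE // -[v in LHS]mulr1 -[v * 1]/(v *: (1 : R)) linearZ /= -deriveE //.
  by rewrite derive_val.
elim: k => [|k [IHc IHs]].
  by split; split=> // x _; [exact: continuous_cos|exact: continuous_sin].
split; split=> [x _|v]; [exact: continuous_cos| |exact: continuous_sin|].
  split; first by move=> x _; have [] := D (@cos R) (fun x => - sin x) v x (is_derive_cos x).
  have -> : 'D_v (@cos R) = fun x => v * - sin x.
    by apply/funext => x; have [] := D (@cos R) (fun x => - sin x) v x (is_derive_cos x).
  by apply: Ck_mul; [exact: openT|exact: Ck_cst|apply: Ck_opp => //; exact: openT].
split; first by move=> x _; have [] := D (@sin R) (@cos R) v x (is_derive_sin x).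
have -> : 'D_v (@sin R) = fun x => v * cos x.
  by apply/funext => x; have [] := D (@sin R) (@cos R) v x (is_derive_sin x).
by apply: Ck_mul; [exact: openT|exact: Ck_cst|].
Qed.

Lemma smooth_cisX k : smooth_on (setT : set R) (fun t => val (cis t) ^+ k : C).
Proof.
elim: k => [|k IH]; first by apply: smooth_eq (smooth_cst _ 1) => t; rewrite expr0.
have s1 : smooth_on (setT : set R) (fun t => val (cis t) : C).
  by move=> j; exact: Ck_cos_sin.
by apply: smooth_eq (smooth_mul openT s1 IH) => t; rewrite exprS.
Qed.

Lemma ploop_OmegaPoly n i (T : nat -> 'M[C]_n) : unitary_loop (ploop i T) ->
  ploop i T (@circle1 R) = 1%:M -> OmegaPoly i (ploop i T).
Proof.
move=> uT T1; split; last by exists T.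
split=> [a b|l|//].
  apply: (smooth_eq (f := fun t => \sum_(k < i.+1) val (cis t) ^+ k * T k a b)).
    by move=> t; rewrite summxE; apply: eq_bigr => k _; rewrite mxE.
  apply: smooth_sum => [|k _]; first exact: openT.
  by apply: smooth_mul; [exact: openT|exact: smooth_cisX|exact: smooth_cst].
by apply/unitarymxP; exact: unitary_loopV.
Qed.

(** Interpolation at [r.+1] points of the circle: a coefficient of a loop of degree [r] is a fixed
    combination of values of the loop, hence as smooth in a parameter as these values. *)
Lemma vandermonde_coefs r : exists c : nat -> 'I_r.+1 -> C, forall q k, (q < r.+1)%N -> (k < r.+1)%N ->
  \sum_j c k j * val (circle_pt j : circle R) ^+ q = (q == k)%:R.
Proof.
pose a : 'rV[C]_r.+1 := \row_j val (circle_pt j : circle R).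
have uV : Vandermonde r.+1 a \in unitmx.
  rewrite unitmxE det_Vandermonde unitfE prodf_seq_neq0; apply/allP => i _ /=.
  rewrite prodf_seq_neq0; apply/allP => j _ /=; apply/implyP => ij.
  rewrite !mxE subr_eq0; apply/eqP => /circle_pt_inj /= e.
  by rewrite e ltnn in ij.
exists (fun k j => invmx (Vandermonde r.+1 a) j (inord k)) => q k qr kr.
have /matrixP/(_ (inord q) (inord k)) := mulmxV uV; rewrite !mxE -val_eqE /= !inordK // => <-.
by apply: eq_bigr => j _; rewrite !mxE inordK // mulrC.
Qed.

End CircleSmooth.

Section Conversion.
Context {R : realType} {M : riemannSurface R} {n : nat}.
Local Notation C := (Cplx R).
Local Notation P := (R * R)%type.
Implicit Types (T : nat -> M -> 'M[C]_n) (l : circle R).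

Lemma ext_sol_of r (Phi : M -> loop R n) : extended_solution Phi -> (forall p, OmegaPoly r (Phi p)) ->
  exists T, ext_sol r T /\ forall p l, Phi p l = ploop r (T ^~ p) l.
Proof.
move=> [OU sPhi ePhi] poly.
have H p : exists T0 : nat -> 'M[C]_n, forall l, Phi p l = ploop r T0 l.
  by have [_ [T0 H]] := poly p; exists T0.
have [T0 T0E] := choice H.
pose T k p := if (k <= r)%N then T0 p k else 0.
have TE p l : Phi p l = ploop r (T ^~ p) l.
  by rewrite T0E; apply: eq_bigr => k _; rewrite /T -ltnS ltn_ord.
have sl l t : l = cis t -> smoothM (fun p => Phi p l).
  move=> -> c cc a b.
  have cg : continuous (fun y : P => (y, t)).
    move=> y; have h1 : {for y, continuous (fun z : P => z)} by exact: cvg_id.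
    have h2 : {for y, continuous (fun _ : P => t)} by exact: cvg_cst.
    exact: cvg_pair h1 h2.
  have := smooth_comp_affine (L := fun v : P => (v, 0 : R)) cg _ (sPhi c cc a b); apply.
  by move=> x v h; congr pair; rewrite /= scaler0 add0r.
have [co coE] := @vandermonde_coefs R r.
have sT k : smoothM (T k).
  have [kr|rk] := leqP k r; last first.
    have -> : T k = fun=> 0 by apply/funext => p; rewrite /T leqNgt rk.
    exact: smoothM_cst.
  have -> : T k = fun p => \sum_j co k j *: Phi p (circle_pt j).
    apply/funext => p; under eq_bigr => j _ do rewrite TE /ploop scaler_sumr.
    rewrite exchange_big /=.
    rewrite (eq_bigr (fun q : 'I_r.+1 => (val q == k)%:R *: T q p)) => [|q _].
      rewrite (bigD1 (Ordinal (kr : (k < r.+1)%N))) //= eqxx scale1r big1 ?addr0 // => q.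
      by rewrite -val_eqE /= => /negPf ->; rewrite scale0r.
    rewrite -(coE q k) // scaler_suml; apply: eq_bigr => j _.
    by rewrite scalerA.
  apply: smoothM_sum => j; apply: smoothM_scale.
  exact: (sl _ (j.+1%:R)^-1 erefl).
have uT p l : (ploop r (T ^~ p) l) ^t* *m ploop r (T ^~ p) l = 1%:M.
  by rewrite -TE; apply: mulmx1C; have [_ /(_ l)/unitarymxP] := OU p.
exists T; split; last exact: TE.
split; [|exact: sT|exact: uT| |].
- by move=> k p rk; rewrite /T leqNgt rk.
- by move=> p; rewrite -TE; have [] := OU p.
move=> c cc x rx; have [A AE] := ePhi c cc; have [dx xE] := rinvP cc rx.
(* The factor 2 makes up for the one half that [mx_dz] has and [del] has not. *)
exists (2 *: A (rinv c x)) => l; have := AE _ dx l; rewrite mx_dzE xE.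
set F := fun y => Phi (rinv c y) l.
have -> : del (fun y => ploop r (T ^~ (rinv c y)) l) x = del F x by apply: eq_del => y; rewrite -TE.
move=> /(congr1 (mulmx (Phi (rinv c x) l))); rewrite mulmxA mulmxV ?mul1mx; last first.
  by have [_ uP _] := OU (rinv c x); exact: unitarymx_unit (uP l).
rewrite -/(del F x) => /(congr1 (fun B => 2 *: B)); rewrite scalerA mulfV ?pnatr_eq0 // scale1r => ->.
by rewrite TE -!scalemxAr !scalerA mulrC.
Qed.

Lemma ext_sol_extended i T : ext_sol i T -> extended_solution (fun p => ploop i (T ^~ p)).
Proof.
move=> esT; have [Ti sT uT T1 eT] := esT; split.
- by move=> p; have [] := ploop_OmegaPoly (uT p) (T1 p).
- move=> c cc a b.
  have cf : continuous (@fst P R) by move=> x; exact: cvg_fst.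
  have cs : continuous (@snd P R) by move=> x; exact: cvg_snd.
  have oU : open ((@fst P R) @^-1` rim c).
    by apply: (open_comp (f := @fst P R)) (rim_open cc) => x _; exact: cf.
  apply: (smooth_eq (f := fun x : P * R => \sum_(k < i.+1) val (cis x.2) ^+ k * T k (rinv c x.1) a b)).
    by move=> t; rewrite summxE; apply: eq_bigr => k _; rewrite mxE.
  apply: smooth_sum => // k _; apply: smooth_mul => //.
    have := smooth_comp_affine (L := @snd P R) cs _ (@smooth_cisX R k) => /(_ (fun _ _ _ => erefl)).
    exact: smooth_sub.
  exact: (smooth_comp_affine (L := @fst P R) cf (fun _ _ _ => erefl) (sT k c cc a b)).
move=> c cc; have [A0 A0P] : exists A0 : P -> 'M[C]_n, forall x, rim c x -> forall l,
    del (fun y => ploop i (T ^~ (rinv c y)) l) x =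
    (1 - (val l)^-1) *: (ploop i (T ^~ (rinv c x)) l *m A0 x).
  have H x : exists A, rim c x -> forall l, del (fun y => ploop i (T ^~ (rinv c y)) l) x =
    (1 - (val l)^-1) *: (ploop i (T ^~ (rinv c x)) l *m A).
    have [rx|rx] := pselect (rim c x); last by exists 0.
    by have [A AP] := eT c cc x rx; exists A.
  by have [A0 A0P] := choice H; exists A0.
exists (fun p => 2^-1 *: A0 (rmap c p)) => p cp l; rewrite mx_dzE.
have rp := rmap_rim cp; have := A0P _ rp l; rewrite {1}/del => ->; rewrite rmapK //.
rewrite -scalemxAr -scalemxAr mulmxA mulVmx; last first.
  by rewrite -row_free_unit; apply/row_freeP; exists ((ploop i (T ^~ p) l) ^t* ); exact: unitary_loopV.
by rewrite mul1mx !scalerA mulrC.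
Qed.

Lemma smooth_near_row_free m (F : M -> 'M[C]_(m, n)) p : smoothM F -> row_free (F p) ->
  \forall q \near p, row_free (F q).
Proof.
move=> sF fp; have [c cc cp] := coordinate_cover p.
have := @row_free_near R m n (rim c) (fun x => F (rinv c x)) (rmap c p) (rim_open cc) (rmap_rim cp) (sF c cc).
rewrite rmapK // => /(_ fp) /(near_rmap cc cp).
by apply: filterS => q [cq]; rewrite rmapK.
Qed.

Lemma herm_proj_rankC (A : 'M[C]_n) : herm_proj A -> (\rank A + \rank (1%:M - A)%R)%N = n.
Proof.
move=> /herm_projM[e1 e2 e3 e4]; apply/eqP; rewrite eqn_leq; apply/andP; split.
  have : (1%:M - A <= kermx A)%MS by apply/sub_kermxP.
  move=> /mxrankS; rewrite mxrank_ker => h; have := rank_leq_row A; lia.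
have := mxrank_add A (1%:M - A); rewrite addrCA subrr addr0 mxrank1.
exact.
Qed.

Lemma pspanP (A : 'M[C]_n) v : herm_proj A -> pspan A v <-> A *m v = v.
Proof. by move=> [_ AA]; split=> [[w _ <-]|<-]; [rewrite mulmxA AA|exists v]. Qed.

Lemma pspan_lin_span m (A : 'M[C]_n) (w : 'I_m -> 'cV[C]_n) : herm_proj A ->
  (forall j, pspan A (w j)) -> forall v, lin_span (range w) v -> pspan A v.
Proof.
move=> hA Aw; apply: lin_span_ind; first by exists 0; rewrite ?mulmx0.
move=> a _ v [j _ <-] /(pspanP _ hA) e; apply/(pspanP _ hA).
have /(pspanP _ hA) ej := Aw j.
by rewrite mulmxDr -scalemxAr ej e.
Qed.

(** A basis at [p], projected by [pi q], stays independent nearby. It also spans: the ranks of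
    [pi q] and of its complement cannot drop near [p] and add up to [n], so neither can grow. *)
Lemma smooth_subbundle_pspan (pi : M -> 'M[C]_n) : (forall p, herm_proj (pi p)) -> smoothM pi ->
  smooth_subbundle (fun p => pspan (pi p)).
Proof.
move=> hpi spi p; pose d := \rank (pi p).
pose B := row_base (pi p); pose B' := row_base (1%:M - pi p).
have Bp : B *m pi p = B by apply/herm_proj_sub => //; rewrite eq_row_base.
have Bp' : B' *m (1%:M - pi p) = B' by apply/herm_proj_sub; [exact: herm_projC|rewrite eq_row_base].
have n1 : \forall q \near p, row_free (B *m pi q).
  apply: (smooth_near_row_free (F := fun q => B *m pi q)); last by rewrite Bp row_base_free.
  by apply: smoothM_mul => //; exact: smoothM_cst.
have n2 : \forall q \near p, row_free (B' *m (1%:M - pi q)).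
  apply: (smooth_near_row_free (F := fun q => B' *m (1%:M - pi q))); last by rewrite Bp' row_base_free.
  apply: smoothM_mul; first exact: smoothM_cst.
  by apply: smoothM_add; [exact: smoothM_cst|exact: smoothM_opp].
have [U [oU Up UP]] := near_open (near_and n1 n2).
exists U, d, (fun j q => pi q *m col j (B ^t* )); split => //.
  move=> j a b c cc.
  have s0 : smoothM (fun q => pi q *m col j (B ^t* )) by apply: smoothM_mul => //; exact: smoothM_cst.
  apply: smooth_sub (s0 c cc a b) => x [q [cq _] qx]; exists q => //.
move=> q /UP[f1 f2]; have hq := hpi q.
have E : (B *m pi q :=: pi q)%MS.
  apply/eqmxP; rewrite -(geq_leqif (mxrank_leqif_eq (submxMl B (pi q)))) (eqP f1 : \rank _ = d).
  have := herm_proj_rankC hq; have := herm_proj_rankC (hpi p).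
  have : (\rank (1%:M - pi p)%R <= \rank (1%:M - pi q)%R)%N.
    by rewrite -[X in (X <= _)%N](eqP f2); exact: mxrankS (submxMl _ _).
  by rewrite -/d; lia.
have sumE (a : 'I_d -> C) : \sum_j a j *: (pi q *m col j (B ^t* )) = pi q *m B ^t* *m \col_j a j.
  apply/matrixP => i b; rewrite summxE mxE; apply: eq_bigr => j _.
  by rewrite !mxE mulrC; congr (_ * _); apply: eq_bigr => k _; rewrite !mxE.
split.
  move=> a; rewrite sumE => /(congr1 (fun A : 'M[C]_(_, _) => A ^t* )) e0 j.
  have e : (\col_j a j) ^t* = 0.
    apply: (row_free_inj f1); rewrite mul0mx; move: e0.
    by rewrite adjmx0 2!adjmxM adjmxK (proj1 hq).
  have /matrixP/(_ 0 j) := e; rewrite !mxE => /eqP; rewrite conjC_eq0 => /eqP.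
  by [].
apply/seteqP; split; last first.
  by apply: pspan_lin_span => // j; exists (col j (B ^t* )).
move=> v /(pspanP _ hq) <-; have /submxP[D DE] : (pi q <= B *m pi q)%MS by rewrite E.
have -> : pi q *m v = pi q *m B ^t* *m (D ^t* *m v).
  by rewrite -{1}(proj1 hq) {1}DE 2!adjmxM (proj1 hq) !mulmxA.
exists d, (fun j => (D ^t* *m v) j 0), (fun j => pi q *m col j (B ^t* )); split; first by move=> j; exists j.
by rewrite sumE; congr (_ *m _); apply/matrixP => i b; rewrite (ord1 b) [RHS]mxE.
Qed.

Lemma uniton_factor_pspan (A : 'M[C]_n) l : herm_proj A -> uniton_factor (pspan A) l = pfac A l.
Proof. by move=> hA; rewrite /uniton_factor orthproj_pspan. Qed.

End Conversion.

(** * Power expansions in the Hardy space *)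

Section FourierCoefs.
Context {R : realType} {n : nat}.
Local Notation C := (Cplx R).
Implicit Types (f g h y Y : circle_fun R n) (l : circle R) (T : nat -> 'M[C]_n) (c : nat -> 'cV[C]_n).

(** An expansion to every finite order, with remainders in the Hardy space, stands for the Fourier
    series; neither convergence nor integrals are involved. *)
Definition has_coefs f c := forall N, exists2 h, Hplus h &
  forall l, f l = \sum_(s < N) val l ^+ s *: c s + val l ^+ N *: h l.

Lemma has_coefs_Hplus f c : has_coefs f c -> Hplus f.
Proof.
by move=> /(_ 0%N)[h Hh E]; apply: Hplus_ext Hh => l; rewrite E big_ord0 add0r expr0 scale1r.
Qed.

Lemma has_coefs_exists f : Hplus f -> exists c, has_coefs f c.
Proof.
move=> Hf; have H (g : {g : circle_fun R n | Hplus g}) : exists vg : 'cV[C]_n * {g : circle_fun R n | Hplus g},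
    forall l, sval g l = vg.1 + val l *: sval vg.2 l.
  have [v [g' [Hg' E]]] := Hplus_uncons (svalP g).
  by exists (v, exist _ g' Hg').
have [nx nxE] := choice H.
pose t k := iter k (fun q => (nx q).2) (exist _ f Hf).
exists (fun k => (nx (t k)).1) => N; exists (sval (t N)); first exact: svalP.
elim: N => [|N IH] l; first by rewrite big_ord0 add0r expr0 scale1r.
by rewrite IH big_ord_recr /= -addrA; congr (_ + _); rewrite nxE scalerDr scalerA -exprSr.
Qed.

Lemma has_coefs_uniq f c c' : has_coefs f c -> has_coefs f c' -> c =1 c'.
Proof.
move=> hc hc'; suff H N s : (s < N)%N -> c s = c' s by move=> s; exact: (H s.+1).
elim: N s => [//|N IH] s; rewrite ltnS leq_eqVlt => /orP[/eqP ->|]; last exact: IH.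
have [h Hh E] := hc N.+1; have [h' Hh' E'] := hc' N.+1.
apply/eqP; rewrite -subr_eq0; apply/eqP/Hplus_cst0.
apply: (Hplus_ext _ (Hplus_sub Hh' Hh)) => l; apply: (scalerI (expf_neq0 N.+1 (circle_neq0 l))).
rewrite scalerA [X in X * _]exprSr mulfK ?circle_neq0 // !scalerBr.
have := E l; rewrite E' !big_ord_recr /= (eq_bigr (fun s : 'I_N => val l ^+ s *: c s)); last first.
  by move=> i _; rewrite IH.
rewrite -!addrA => /addrI e; apply/eqP.
by rewrite subr_eq addrAC eq_sym subr_eq -e addrC.
Qed.

Lemma has_coefs_lin a f g c c' : has_coefs f c -> has_coefs g c' ->
  has_coefs (fun l => a *: f l + g l) (fun s => a *: c s + c' s).
Proof.
move=> hc hc' N; have [h Hh E] := hc N; have [h' Hh' E'] := hc' N.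
exists (fun l => a *: h l + h' l); first by apply: Hplus_add => //; exact: Hplus_scale.
move=> l; rewrite E E' scalerDr scaler_sumr !scalerDr addrACA; congr (_ + (_ + _)).
  by rewrite -big_split; apply: eq_bigr => s _; rewrite scalerDr !scalerA mulrC.
by rewrite !scalerA mulrC.
Qed.

Lemma has_coefs_ext f g c c' : f =1 g -> c =1 c' -> has_coefs f c -> has_coefs g c'.
Proof. by move=> /funext -> /funext ->. Qed.

Lemma has_coefs0 : has_coefs (fun=> 0) (fun=> 0).
Proof.
move=> N; exists (fun=> 0); first exact: Hplus_cst.
by move=> l; rewrite scaler0 addr0 big1 // => s _; rewrite scaler0.
Qed.

Lemma has_coefs_lam e f c : has_coefs f c ->
  has_coefs (fun l => val l ^+ e *: f l) (fun s => if (s < e)%N then 0 else c (s - e)%N).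
Proof.
move=> hc N; have [Ne|eN] := leqP N e.
  exists (fun l => val l ^+ (e - N) *: f l); first by apply: Hplus_lamX; exact: has_coefs_Hplus hc.
  move=> l; rewrite scalerA -exprD subnKC // big1 ?add0r // => s _.
  by rewrite (leq_trans (ltn_ord s) Ne) scaler0.
have [m {eN}->] : exists m, N = (e + m)%N by exists (N - e)%N; rewrite subnKC // ltnW.
have [h Hh E] := hc m; exists h => // l; rewrite E scalerDr scalerA -exprD.
congr (_ + _); rewrite [RHS]big_split_ord /= [X in _ = X + _]big1 ?add0r.
  rewrite scaler_sumr; apply: eq_bigr => s _.
  by rewrite ltnNge leq_addr /= addKn scalerA -exprD.
by move=> s _; rewrite ltn_ord scaler0.
Qed.

Lemma has_coefs_lam_inv u f c : has_coefs f c -> (forall s, (s < u)%N -> c s = 0) ->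
  exists2 a, has_coefs a (fun s => c (s + u)%N) & forall l, f l = val l ^+ u *: a l.
Proof.
move=> hc c0; have [a Ha E] := hc u.
have {}E l : f l = val l ^+ u *: a l.
  by rewrite E big1 ?add0r // => s _; rewrite c0 ?ltn_ord // scaler0.
exists a => //; have [c' hc'] := has_coefs_exists Ha.
apply: (has_coefs_ext (fun _ => erefl) _ hc') => s.
have /(has_coefs_uniq hc)/(_ (s + u)%N) := has_coefs_ext (fun l => esym (E l)) (fun _ => erefl) (has_coefs_lam u hc').
by move=> ->; rewrite ltnNge leq_addl /= addnK.
Qed.

Lemma coefL_ord r (A : 'M[C]_(n, r)) (i : 'I_r) : coefL A (i : nat)%:Z = col i A.
Proof. by rewrite /coefL (big_pred1 i) // => k; rewrite /= eqz_nat. Qed.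

Lemma coefL_out r (A : 'M[C]_(n, r)) (t : int) : (forall i : 'I_r, (i : nat)%:Z != t) -> coefL A t = 0.
Proof. by move=> H; rewrite /coefL big_pred0 // => k; exact: negbTE (H k). Qed.

Lemma has_coefs_poly_rep r (A : 'M[C]_(n, r)) : has_coefs (poly_rep A) (fun s => coefL A s%:Z).
Proof.
move=> N; have E0 s : (r <= s)%N -> coefL A s%:Z = 0.
  by move=> rs; apply: coefL_out => i; rewrite eqz_nat ltn_eqF // (leq_trans (ltn_ord i)).
have E l : poly_rep A l = \sum_(s < r + N) val l ^+ s *: coefL A s%:Z.
  rewrite big_split_ord /= [X in _ + X]big1 ?addr0 => [|s _]; last by rewrite E0 ?leq_addr ?scaler0.
  by apply: eq_bigr => i _; rewrite coefL_ord.
exists (fun l => \sum_(s < r) val l ^+ s *: coefL A (N + s)%N%:Z).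
  by apply: Hplus_sum => s; apply: Hplus_lamX; exact: Hplus_cst.
move=> l; rewrite E addnC big_split_ord /=; congr (_ + _).
by rewrite scaler_sumr; apply: eq_bigr => s _; rewrite scalerA -exprD.
Qed.

(** The adjoint loop has powers from [lambda^-j] to 1, so the constant term involves [c 0] to [c j];
    the negative powers vanish by [laurent_Hplus]. *)
Lemma has_coefs_adj j T y c : has_coefs y c -> Hplus (fun l => (ploop j T l) ^t* *m y l) ->
  exists2 g, Hplus g & forall l,
    (ploop j T l) ^t* *m y l = \sum_(q < j.+1) (T q) ^t* *m c q + val l *: g l.
Proof.
move=> hc HG; have [h Hh E] := hc j.+1.
pose U q := \sum_(a < j.+1) \sum_(b < j.+1 | (a + b == q)%N) rev_adj j T a *m c b.
pose h2 l := ploop j (rev_adj j T) l *m h l.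
have Hh2 : Hplus h2 by exact: Hplus_ploop.
have lG l : (ploop j T l) ^t* *m y l = val l ^- j *: \sum_(q < (j + j).+1) val l ^+ q *: U q + val l *: h2 l.
  apply: (scalerI (expf_neq0 j (circle_neq0 l))); rewrite scalerDr !scalerA mulfV ?expf_neq0 ?circle_neq0 //.
  rewrite scale1r -exprSr scalemxAl -ploop_rev E mulmxDr -scalemxAr; congr (_ + _).
  exact: poly_mul.
have HU : Hplus (fun l => val l ^- j *: \sum_(q < (j + j).+1) val l ^+ q *: U q).
  by apply: (Hplus_ext _ (Hplus_sub HG (Hplus_lam Hh2))) => l; rewrite lG addrK.
have U0 := laurent_Hplus HU.
have Uj : U j = \sum_(q < j.+1) (T q) ^t* *m c q.
  rewrite /U (exchange_big_dep xpredT) //=; apply: eq_bigr => b _.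
  have bj : (j - b < j.+1)%N by rewrite ltnS leq_subr.
  rewrite (big_pred1 (Ordinal bj)) => [|a]; last first.
    apply/eqP/eqP => [e|->]; last by rewrite /= subnK // -ltnS.
    by apply: val_inj; have := congr1 (subn^~ b) e; rewrite /= addnK.
  by rewrite /rev_adj /= subKn // -ltnS.
exists (fun l => \sum_(q < j) val l ^+ q *: U (j.+1 + q)%N + h2 l).
  by apply: Hplus_add => //; apply: Hplus_sum => q; apply: Hplus_lamX; exact: Hplus_cst.
move=> l; rewrite lG -Uj scalerDr addrA; congr (_ + _).
have -> : \sum_(q < (j + j).+1) val l ^+ q *: U q = val l ^+ j *: U j + \sum_(q < j) val l ^+ (j.+1 + q) *: U (j.+1 + q)%N.
  rewrite -addSn big_split_ord /= big_ord_recr /= big1 ?add0r // => q _.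
  by rewrite U0 ?scaler0 //; have := ltn_ord q; lia.
rewrite scalerDr scalerA mulVf ?expf_neq0 ?circle_neq0 // scale1r; congr (_ + _).
rewrite !scaler_sumr; apply: eq_bigr => q _; rewrite !scalerA addSnnS exprD mulKf ?expf_neq0 ?circle_neq0 //.
by rewrite exprS.
Qed.

End FourierCoefs.

(** * The spaces of the alternating filtration *)

Section AlternatingSpaces.
Context {R : realType} {n : nat}.
Local Notation C := (Cplx R).
Implicit Types (f g h y Y : circle_fun R n) (l : circle R) (T : nat -> 'M[C]_n) (c : nat -> 'cV[C]_n).

(** Identifies [num_uhlenbeck b r i] as the number of Uhlenbeck steps on the way from [r] down to
    [i]. *)
Lemma num_uhlenbeck_step b r i : (i < r)%N ->
  num_uhlenbeck b r i = (num_uhlenbeck b r i.+1 + (if step_at b r i.+1 is Uhlenbeck then 1 else 0))%N.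
Proof.
move=> ir; have e : (r - i = (r - i.+1).+1)%N by rewrite subnSK.
rewrite /step_at /num_uhlenbeck e; case: b; case: ifP => o /=; lia.
Qed.

Lemma num_uhlenbeck_le b r i : (i <= r)%N -> (num_uhlenbeck b r i + i <= r)%N.
Proof. by move=> ir; rewrite /num_uhlenbeck; case: b; lia. Qed.

(** An Uhlenbeck step divides both summands by lambda, which puts one more factor lambda into the
    condition on [a]. A Segal step keeps that condition and enlarges the second summand from
    [lambda^(i.+1)] to [lambda^i] times the Hardy space. *)
Lemma alternating_space b r (W : nat -> set (circle_fun R n)) :
  (forall i, (i < r)%N -> W i = match step_at b r i.+1 with
     | Uhlenbeck => uhlenbeck_step (W i.+1)
     | Segal => segal_step i.+1 (W i.+1) end) ->
  (forall y h, W r y -> Hplus h -> W r (fun l => y l + val l ^+ r *: h l)) ->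
  (forall y, W r y -> Hplus y) ->
  forall i, (i <= r)%N -> forall y, W i y <-> exists a h, [/\ Hplus a,
    W r (fun l => val l ^+ num_uhlenbeck b r i *: a l), Hplus h &
    forall l, y l = a l + val l ^+ i *: h l].
Proof.
move=> Wstep Wr WH i ir; rewrite -(subKn ir); have := leq_subr i r; move: (r - i)%N => {ir} k; move: {i} k.
have H0 : Hplus (fun=> 0 : 'cV[C]_n) by exact: Hplus_cst.
have lamE j l : (val l ^ (j.+1%:Z - 1))%R = val l ^+ j by rewrite intS addrC addKr.
have lamN l : (val l ^ (-1))%R = (val l)^-1 by rewrite exprN1.
elim=> [_|k IH kr] y.
  rewrite subn0; have u0 : num_uhlenbeck b r r = 0%N by have := num_uhlenbeck_le b (leqnn r); lia.
  rewrite u0; have E a : (fun l => val l ^+ 0 *: a l) = a :> circle_fun R n.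
    by apply/funext => l; rewrite expr0 scale1r.
  split=> [Wy|[a [h [_ Wa Hh yE]]]]; last first.
    rewrite (_ : y = fun l => a l + val l ^+ r *: h l); last by apply/funext.
    by apply: Wr => //; rewrite -[a]E.
  exists y, (fun=> 0); split; [exact: WH|by rewrite E|exact: H0|].
  by move=> l; rewrite scaler0 addr0.
have ir : (r - k.+1 < r)%N by lia.
have {IH} := IH (ltnW kr); rewrite -(subnSK kr); move: (r - k.+1)%N ir => i ir IH.
rewrite Wstep // (num_uhlenbeck_step b ir); case: step_at.
  have lu u (a : circle_fun R n) : (fun l => val l ^+ (u + 1) *: a l) = fun l => val l ^+ u *: (val l *: a l).
    by apply/funext => l; rewrite scalerA addn1 exprSr.
  split=> [[[w /IH[a [h [Ha Wa Hh wE]]] yE] Hy]|[a [h [Ha Wa Hh yE]]]].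
    have lh := Hplus_lamX i Hh.
    have aE l : y l - val l ^+ i *: h l = (val l)^-1 *: a l.
      by rewrite -yE /lam_mul lamN wE scalerDr scalerA exprS mulrA mulVf ?circle_neq0 // mul1r addrK.
    exists (fun l => y l - val l ^+ i *: h l), h; split; [exact: Hplus_sub| |exact: Hh|by move=> l; rewrite subrK].
    rewrite lu; move: Wa; congr (W r _); apply/funext => l.
    by rewrite aE [val l *: _]scalerA mulfV ?circle_neq0 // scale1r.
  split; last first.
    by apply: (Hplus_ext _ (Hplus_add Ha (Hplus_lamX i Hh))) => l; rewrite yE.
  exists (fun l => val l *: y l); last first.
    by apply/funext => l; rewrite /lam_mul lamN scalerA mulVf ?circle_neq0 // scale1r.
  apply/IH; exists (fun l => val l *: a l), h; split; [exact: Hplus_lam|by rewrite -lu|exact: Hh|].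
  by move=> l; rewrite yE scalerDr scalerA exprS.
rewrite addn0; split=> [[w /IH[a [h [Ha Wa Hh wE]]] [_ [h' Hh' <-] yE]]|[a [h [Ha Wa Hh yE]]]].
  exists a, (fun l => val l *: h l + h' l); split; [exact: Ha|exact: Wa| |].
    by apply: Hplus_add => //; exact: Hplus_lam.
  move=> l; rewrite -yE circle_funD wE /lam_mul lamE scalerDr scalerA -exprSr addrA.
  by [].
exists a; first by apply/IH; exists a, (fun=> 0); split=> // l; rewrite scaler0 addr0.
exists (lam_mul (i.+1%:Z - 1) h); first by exists h.
by apply/funext => l; rewrite circle_funD yE /lam_mul lamE.
Qed.

End AlternatingSpaces.

(** * The uniton as a space of constant terms *)

Section UnitonCoefs.
Context {R : realType} {n : nat}.
Local Notation C := (Cplx R).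
Implicit Types (f g h y Y : circle_fun R n) (l : circle R) (c d : nat -> 'cV[C]_n).
Variables (i u : nat) (T T' : nat -> 'M[C]_n) (P : 'M[C]_n) (W : set (circle_fun R n)).
Hypotheses (uT' : unitary_loop (ploop i T')) (hP : herm_proj P).
Hypothesis fac : forall l, ploop i.+1 T l = ploop i T' l *m pfac P l.
Hypothesis WP : forall y, loop_image (ploop i.+1 T) Hplus y <-> exists a h, [/\ Hplus a,
    W (fun l => val l ^+ u *: a l), Hplus h & forall l, y l = a l + val l ^+ i.+1 *: h l].

Let cst_lam v g : Hplus g -> (forall l, v + val l *: g l = 0) -> v = 0.
Proof.
move=> Hg e; apply: Hplus_cst0; apply: (Hplus_ext _ (Hplus_scale (-1) Hg)) => l.
apply: (scalerI (circle_neq0 l)); rewrite scaleN1r scalerN scalerA mulfV ?circle_neq0 // scale1r.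
by have /eqP := e l; rewrite addr_eq0 => /eqP ->.
Qed.

Let shifted Y c : W Y -> has_coefs Y c -> (forall s, (s < u)%N -> c s = 0) ->
  exists a f, [/\ has_coefs a (fun s => c (s + u)%N), Hplus f,
    forall l, Y l = val l ^+ u *: a l & forall l, (ploop i T' l) ^t* *m a l = pfac P l *m f l].
Proof.
move=> WY hc c0; have [a ha YE] := has_coefs_lam_inv hc c0.
have /WP : exists a0 h, [/\ Hplus a0, W (fun l => val l ^+ u *: a0 l), Hplus h &
    forall l, a l = a0 l + val l ^+ i.+1 *: h l].
  exists a, (fun=> 0); split; [exact: has_coefs_Hplus ha| |exact: Hplus_cst|].
    by move: WY; congr W; apply/funext.
  by move=> l; rewrite scaler0 addr0.
move=> [f Hf fE]; exists a, f; split=> // l.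
by rewrite -fE fac !mulmxA uT' mul1mx.
Qed.

(** The shift by [u] divides [Y] by [lambda^u]. The quotient lies in the space of level [i.+1]; the
    adjoint of the loop of level [i] takes it to [pfac P] applied to some [f], whose constant term
    is [P] applied to that of [f]. *)
Lemma uniton_coefs_sub Y c : W Y -> has_coefs Y c -> (forall s, (s < u)%N -> c s = 0) ->
  pspan P (\sum_(q < i.+1) (T' q) ^t* *m c (q + u)%N).
Proof.
move=> WY hc c0; have [a [f [ha Hf YE aE]]] := shifted WY hc c0.
have [|g Hg gE] := has_coefs_adj (T := T') (j := i) ha.
  by apply: Hplus_ext (pfac_Hplus P Hf) => l; rewrite aE.
have [f0 [f1 [Hf1 fE]]] := Hplus_uncons Hf.
apply/(pspanP _ hP); set v := \sum_(q < _) _ in gE *.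
have [e1 _ _ _] := herm_projM hP.
suff -> : v = P *m f0 by rewrite mulmxA e1.
apply/eqP; rewrite -subr_eq0; apply/eqP.
apply: (@cst_lam _ (fun l => g l - (P *m f1 l + (1%:M - P) *m f l))).
  by apply: Hplus_sub => //; apply: Hplus_add; exact: Hplus_mx.
move=> l; rewrite scalerBr addrACA -opprD -gE aE pfac_mul scalerDr addrA.
by rewrite {1}fE mulmxDr -scalemxAr subrr.
Qed.

(** Only the class modulo lambda counts for a constant term, so lambda times an element already of
    order at least [u] contributes nothing. *)
Lemma uniton_coefs_lam Y c d : W Y -> has_coefs Y c -> (forall s, (s < u)%N -> c s = 0) ->
  has_coefs (fun l => val l *: Y l) d -> \sum_(q < i.+1) (T' q) ^t* *m d (q + u)%N = 0.
Proof.
move=> WY hc c0 hd; have [a [f [ha Hf YE aE]]] := shifted WY hc c0.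
have dE := has_coefs_uniq hd (has_coefs_lam 1 hc).
have d0 s : (s < u)%N -> d s = 0.
  move=> su; have -> : d s = if (s < 1)%N then 0 else c (s - 1)%N by exact: dE.
  by case: ifP => // _; apply: c0; lia.
have [a' ha' aE'] := has_coefs_lam_inv hd d0.
have a'E l : a' l = val l *: a l.
  apply: (scalerI (expf_neq0 u (circle_neq0 l))).
  by rewrite -aE' YE !scalerA mulrC.
have [|g Hg gE] := has_coefs_adj (T := T') (j := i) ha'.
  apply: (Hplus_ext _ (Hplus_lam (pfac_Hplus P Hf))) => l.
  by rewrite a'E -aE scalemxAr.
apply: (@cst_lam _ (fun l => g l - pfac P l *m f l)); first by apply: Hplus_sub => //; exact: pfac_Hplus.
by move=> l; rewrite scalerBr addrA -gE a'E -aE -scalemxAr subrr.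
Qed.

(** The element to decompose is the loop of level [i.+1] applied to [v]: the adjoint of the loop of
    level [i] takes it to the constant [v]. The second summand provided by [WP] starts at degree
    [i.+1], beyond the coefficients used. *)
Lemma uniton_coefs_sup v : pspan P v -> exists Y c, [/\ W Y, has_coefs Y c,
  forall s, (s < u)%N -> c s = 0 & v = \sum_(q < i.+1) (T' q) ^t* *m c (q + u)%N].
Proof.
move=> /(pspanP _ hP) Pv.
have : loop_image (ploop i.+1 T) Hplus (fun l => ploop i.+1 T l *m v) by exists (fun=> v) => //; exact: Hplus_cst.
move=> /WP[a [h [Ha Wa Hh yE]]]; have [ca hca] := has_coefs_exists Ha; have [ch hch] := has_coefs_exists Hh.
have hy : has_coefs (fun l => ploop i.+1 T l *m v)
    (fun s => 1 *: (if (s < i.+1)%N then 0 else ch (s - i.+1)%N) + ca s).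
  apply: has_coefs_ext (has_coefs_lin 1 (has_coefs_lam i.+1 hch) hca) => // l.
  by rewrite yE scale1r addrC.
have Gy l : (ploop i T' l) ^t* *m (ploop i.+1 T l *m v) = v.
  by rewrite fac !mulmxA uT' mul1mx pfac_mul mulmxBl mul1mx Pv subrr scaler0 addr0.
have [|g Hg gE] := has_coefs_adj (T := T') (j := i) hy.
  by apply: Hplus_ext (Hplus_cst v) => l; rewrite Gy.
exists (fun l => val l ^+ u *: a l), (fun s => if (s < u)%N then 0 else ca (s - u)%N).
split; [exact: Wa|exact: has_coefs_lam|by move=> s ->|].
have -> : \sum_(q < i.+1) (T' q) ^t* *m (if (q + u < u)%N then 0 else ca (q + u - u)%N) =
    \sum_(q < i.+1) (T' q) ^t* *m (1 *: (if (q < i.+1)%N then 0 else ch (q - i.+1)%N) + ca q).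
  apply: eq_bigr => q _; rewrite ltn_ord scaler0 add0r addnK.
  by rewrite ltnNge leq_addl.
apply/eqP; rewrite -subr_eq0; apply/eqP.
apply: (@cst_lam _ (fun l => -1 *: g l)); first exact: Hplus_scale.
move=> l; have := gE l; rewrite Gy scaleN1r scalerN.
by set S := \sum_(q < i.+1) _; move=> e; rewrite {1}e [S + _]addrC addrK subrr.
Qed.

End UnitonCoefs.

(** * Meromorphic sections and derivatives in a coordinate *)

Section HoloGeneric.
Context {R : realType} {M : riemannSurface R}.
Local Notation C := (Cplx R).

Lemma derive1n_near0 k (f : C -> C^o) (z0 : C) : (\forall z \near z0, f z = 0) ->
  \forall z \near z0, derive1n k f z = 0.
Proof.
move=> f0; elim: k => [|k IH]; first exact: f0.
have [V [oV Vz VE]] := near_open IH.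
apply: filterS (open_near oV Vz) => z Vz'; rewrite derive1nS derive1E.
have E : 'D_1 (derive1n k f) z = 'D_1 (cst 0 : C -> C^o) z.
  by apply: near_eq_derive; apply: filterS (open_near oV Vz') => w /VE.
by rewrite E; exact: derive_cst.
Qed.

Section Chart.
Variable c : chart R M.
Hypothesis cc : coordinate c.

Lemma near_chart_inv p (Q : set M) : chart_dom c p -> (\forall q \near p, Q q) ->
  \forall z \near chart_map c p, Q (chart_inv c z).
Proof.
move=> cp H; have [[_ _ cK _ ci] _] := cc.
have im : chart_im c setT (chart_map c p) by exists p.
by have := ci _ im; rewrite /prop_for /continuous_at cK // => /(_ _ H).
Qed.

Lemma mx_deriv_near0 m k d (F : M -> 'M[C]_(m, k)) p : chart_dom c p ->
  (\forall q \near p, F q = 0) -> mx_deriv c d F p = 0.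
Proof.
move=> cp F0; apply/matrixP => a b; rewrite !mxE.
apply: (nbhs_singleton (derive1n_near0 d (f := fun z => F (chart_inv c z) a b) _)).
by apply: filterS (near_chart_inv cp F0) => z ->; rewrite mxE.
Qed.

Lemma mx_deriv_coefL n r d (L : M -> 'M[C]_(n, r)) t p :
  mx_deriv c d (fun x => coefL (L x) t) p = coefL (mx_deriv c d L p) t.
Proof.
have [[i it]|no] := pselect (exists i : 'I_r, (i : nat)%:Z = t).
  rewrite -it coefL_ord; apply/matrixP => a b; rewrite !mxE.
  by congr (derive1n d _ _); apply/funext => z; rewrite coefL_ord mxE.
have nt (i : 'I_r) : (i : nat)%:Z != t by apply/eqP => e; apply: no; exists i.
rewrite (coefL_out _ nt); apply/matrixP => a b; rewrite !mxE.
rewrite (_ : (fun z => _) = cst 0); last by apply/funext => z; rewrite coefL_out // mxE.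
exact: (nbhs_singleton (derive1n_near0 d (f := cst 0) (filterE _ (fun=> erefl)))).
Qed.

End Chart.

(** Coordinates are only assumed compatible with the atlas, so the change between two of them is
    factored through a chart of the atlas. *)
Lemma transition_derivable (c c' : chart R M) q : coordinate c -> coordinate c' ->
  chart_dom c q -> chart_dom c' q ->
  derivable (fun z => chart_map c' (chart_inv c z)) (chart_map c q) 1.
Proof.
move=> cc cc' cq cq'; have [a aa aq] := rs_cover q; have ca := atlas_coordinate aa.
have [[_ _ cK _ _] ct] := cc; have [[_ _ aK _ _] _] := ca; have [_ ct'] := cc'.
have [h1 _] := ct a aa; have [_ h2] := ct' a aa.
have d1 : derivable (fun z => chart_map a (chart_inv c z)) (chart_map c q) 1.
  by apply: h1; exists q.
have d2 : derivable (fun z => chart_map c' (chart_inv a z)) (chart_map a q) 1.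
  by apply: h2; exists q.
apply: (@near_eq_derivable _ _ _ ((fun z => chart_map c' (chart_inv a z)) \o (fun z => chart_map a (chart_inv c z)))).
  apply: filterS (near_chart_inv cc cq (open_near (chart_dom_open ca) aq)) => z az.
  by rewrite /= aK.
have d2' : derivable (fun z => chart_map c' (chart_inv a z)) (chart_map a (chart_inv c (chart_map c q))) 1.
  by rewrite (cK _ cq).
have D1 := (derivable1_diffP _ _).1 d1; have D2 := (derivable1_diffP _ _).1 d2'.
exact: (derivable1_diffP _ _).2 (differentiable_comp D1 D2).
Qed.

(** Off [p] the function is [g] divided by a power of the coordinate. Derivability is required in
    every coordinate, whereas the pole is described in one; the transition maps link the two. *)
Lemma holo_fun_near (f : M -> C) p : meromorphic f ->
  \forall q \near p^', exists U, [/\ open U, U q & holo_fun U f].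
Proof.
move=> /(_ p)[c [U [m [g [cc cp [oU Up] hg fE]]]]].
have H := near_and (open_near oU Up) (open_near (chart_dom_open cc) cp).
apply: filterS H => q [Uq cq] qp.
have op : open (~` [set p]).
  by apply: closed_openC; apply: compact_closed; [exact: rs_hausdorff|exact: compact_set1].
pose U' := U `&` chart_dom c `&` ~` [set p].
have oU' : open U' by apply: openI => //; apply: openI => //; exact: chart_dom_open.
exists U'; split => //; first by split => //; exact/eqP.
move=> c' cc' z [q' [cq' [[Uq' dq'] /= pq']] <-].
have [[_ _ cK' _ _] _] := cc'; have [[_ _ cK _ _] _] := cc.
have Uq'' : U' q' by [].
have Dphi : derivable (fun z => chart_map c (chart_inv c' z) - chart_map c p) (chart_map c' q') 1.
  by apply: derivableB; [exact: transition_derivable|exact: derivable_cst].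
have nz : chart_map c (chart_inv c' (chart_map c' q')) - chart_map c p != 0.
  rewrite cK' // subr_eq0; apply/eqP => e; apply: pq'.
  by rewrite -(cK _ dq') e cK.
have DX k : derivable (fun z => (chart_map c (chart_inv c' z) - chart_map c p) ^+ k) (chart_map c' q') 1.
  elim: k => [|k IH]; first exact: (derivable_cst (1 : C)).
  have D := derivableM Dphi IH.
  apply: near_eq_derivable D; apply: (@filterE _ (nbhs (chart_map c' q'))) => w.
  by rewrite exprS.
have Dg : derivable (fun z => g (chart_inv c' z)) (chart_map c' q') 1.
  by apply: (hg c' cc'); exists q'.
have D1 := derivableV (f := fun z => (chart_map c (chart_inv c' z) - chart_map c p) ^+ m)
  (expf_neq0 m nz) (DX m).
have D2 := derivableM D1 Dg.
apply: near_eq_derivable D2.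
have N := near_chart_inv cc' cq' (open_near oU' Uq'').
apply: filterS N => w [[Uw dw] /= pw].
have nw : (chart_map c (chart_inv c' w) - chart_map c p) ^+ m != 0.
  rewrite expf_neq0 // subr_eq0; apply/eqP => e; apply: pw.
  by rewrite -(cK _ dw) e cK.
by have := mulKf nw (f (chart_inv c' w)); rewrite (fE _ dw Uw pw); exact.
Qed.

End HoloGeneric.

(** * The formula for the unitons *)

Section Formula.
Context {R : realType} {M : riemannSurface R} {n : nat}.
Local Notation C := (Cplx R).
Implicit Types (l : circle R).

Lemma has_coefs_lam_poly r e (A : 'M[C]_(n, r)) :
  has_coefs (fun l => val l ^+ e *: poly_rep A l) (fun s => coefL A (s%:Z - e%:Z)).
Proof.
apply: (has_coefs_ext (fun _ => erefl) _ (has_coefs_lam e (has_coefs_poly_rep A))) => s.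
case: ltnP => se; last by rewrite subzn.
by rewrite coefL_out // => i; apply/eqP; lia.
Qed.

Lemma off_discrete_dom (c : chart R M) : coordinate c -> off_discrete (chart_dom c) (chart_dom c).
Proof. by move=> cc p cp; apply: filterS (open_near (chart_dom_open cc) cp) => q cq _. Qed.

(** For [k < r] this is the generation hypothesis, used where the spanning set is holomorphic and
    spans on a neighbourhood; for [r <= k] the function already lies in [lambda^r] times the Hardy
    space. *)
Lemma generators_in_image r d (X : M -> set 'M[C]_(n, r)) (L : 'I_d -> M -> 'M[C]_(n, r))
    (W : M -> set (circle_fun R n)) (c : chart R M) : coordinate c ->
  generates X W -> mero_spanning_set X L ->
  (forall p h, Hplus h -> W p (fun l => val l ^+ r *: h l)) ->
  off_discrete (chart_dom c) (fun p => forall j k,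
    W p (fun l => val l ^+ k *: poly_rep (mx_deriv c k (L j) p) l)).
Proof.
move=> cc gX [mL sL] Wr.
have H3 : off_discrete setT (fun q => forall jab : 'I_d * 'I_n * 'I_r,
    exists U, [/\ open U, U q & holo_fun U (fun x => L jab.1.1 x jab.1.2 jab.2)]).
  by apply: off_discrete_all => jab p _; exact: holo_fun_near.
have sN := off_discrete_near openT sL.
have sT : chart_dom c `<=` setT by [].
have N := off_discrete_and (off_discrete_and (off_discrete_sub sT gX) (off_discrete_sub sT sN))
  (off_discrete_and (off_discrete_sub sT H3) (off_discrete_dom cc)).
apply: off_discreteS N => q [[Wq [_ Xq]] [hq cq]] j k.
have [rk|kr] := leqP r k.
  rewrite (_ : (fun l => _) = fun l => val l ^+ r *: (val l ^+ (k - r) *: poly_rep (mx_deriv c k (L j) q) l)).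
    by apply: Wr; apply: Hplus_lamX; exact: has_coefs_Hplus (has_coefs_poly_rep _).
  by apply/funext => l; rewrite scalerA -exprD subnKC.
rewrite Wq; exists (lam_mul k%:Z (poly_rep (mx_deriv c k (L j) q))); last first.
  exists (fun=> 0); last by apply/funext => l; rewrite circle_funD addr0.
  by exists (fun=> 0); [exact: Hplus_cst|apply/funext => l; rewrite /lam_mul scaler0].
apply: lin_span_gen; exists k, (mx_deriv c k (L j) q); split => //.
have [U UP] := choice (fun ab : 'I_n * 'I_r => hq (j, ab.1, ab.2)).
have NU : \forall q' \near q, forall ab, U ab q'.
  by apply: near_forall => ab; have [oU Uq _] := UP ab; exact: open_near oU Uq.
have [V [oV Vq VP]] := near_open (near_and NU Xq).
apply: lin_span_gen; exists c, V, (L j), k; split => //.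
split=> [a b c' cc' z|q' /VP[_ ->]]; last by apply: lin_span_gen; exists j.
move=> [q' [cq' Vq'] <-]; have [_ _ hU] := UP (a, b); apply: (hU c' cc').
by exists q' => //; split => //; have [H _] := VP _ Vq'; exact: H.
Qed.

Section AtPoint.
Variables (r d i u : nat) (S : nat -> nat -> M -> 'M[C]_n) (L : 'I_d -> M -> 'M[C]_(n, r)).
Variables (o : 'I_d -> nat) (c : chart R M) (p : M) (P : 'M[C]_n) (W : set (circle_fun R n)).
Hypotheses (hP : herm_proj P) (ur : (u + i.+1 <= r)%N).
Let sg (e : nat -> 'cV[C]_n) : 'cV[C]_n := \sum_(q < i.+1) S i q p *m e (q + u)%N.
Let D j k := mx_deriv c k (L j) p.
Hypothesis sub : forall Y e, W Y -> has_coefs Y e -> (forall s, (s < u)%N -> e s = 0) -> pspan P (sg e).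
Hypothesis lam : forall Y e e', W Y -> has_coefs Y e -> (forall s, (s < u)%N -> e s = 0) ->
  has_coefs (fun l => val l *: Y l) e' -> sg e' = 0.
Hypothesis sup : forall v, pspan P v -> exists Y e, [/\ W Y, has_coefs Y e,
  forall s, (s < u)%N -> e s = 0 & v = sg e].
Hypothesis Wlam : forall k Y, W Y -> W (fun l => val l ^+ k *: Y l).
Hypothesis WL : forall j k, W (fun l => val l ^+ k *: poly_rep (D j k) l).
Hypothesis D0 : forall j k t, t < (o j)%:Z -> coefL (D j k) t = 0.
Hypothesis adapted : W `&` lam_image u%:Z Hplus `<=`
    set_add
      (lin_span [set f | exists (j : 'I_d) (k l : nat),
         (u <= o j + k + l)%N /\
         f = lam_mul (k + l)%N%:Z (poly_rep (D j k))])
      (lam_image r%:Z Hplus).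

Let WLm j k m : W (fun l => val l ^+ (k + m) *: poly_rep (D j k) l).
Proof.
rewrite (_ : (fun l => _) = fun l => val l ^+ m *: (val l ^+ k *: poly_rep (D j k) l)).
  exact: Wlam.
by apply/funext => l; rewrite scalerA -exprD addnC.
Qed.

Let sg_lin a e e' : sg (fun s => a *: e s + e' s) = a *: sg e + sg e'.
Proof.
rewrite /sg scaler_sumr -big_split; apply: eq_bigr => q _.
by rewrite mulmxDr scalemxAr.
Qed.

Let coef_order j k e s : (s < o j + e)%N -> coefL (D j k) (s%:Z - e%:Z) = 0.
Proof. by move=> se; apply: D0; lia. Qed.

Let target := set_add (lin_span (alpha_gen S L o i.+1 u c p)) (lin_span (alpha_gen_hat S L o i.+1 u c p)).

Let target0 : target 0.
Proof. by exists 0; [exact: lin_span0|exists 0; [exact: lin_span0|rewrite addr0]]. Qed.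

Let target_lin a v w : target v -> target w -> target (a *: v + w).
Proof.
move=> [v1 V1 [v2 V2 <-]] [w1 W1 [w2 W2 <-]].
exists (a *: v1 + w1); first by apply: lin_span_add => //; exact: lin_span_scale.
exists (a *: v2 + w2); first by apply: lin_span_add => //; exact: lin_span_scale.
by rewrite scalerDr addrACA.
Qed.

(** For [m = 0] the function yields a generator of [alpha_gen], or 0 if its order exceeds [u + i].
    For positive [m] either [o j + k + m = u], and it yields a generator of [alpha_gen_hat], or it
    is lambda times an element of order at least [u] and yields 0. *)
Let target_gen j k m : (u <= o j + k + m)%N ->
  target (sg (fun s => coefL (D j k) (s%:Z - (k + m)%N%:Z))).
Proof.
case: m => [|m].
  rewrite !addn0 => uo; have [ok|ok] := leqP (o j + k) (u + i).
    set v := sg _; exists v; last by exists 0; [exact: lin_span0|rewrite addr0].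
    apply: lin_span_gen; exists j, k; split; first by lia.
    apply: eq_bigr => q _; rewrite mx_deriv_coefL; congr (_ *m coefL _ _); lia.
  rewrite (_ : sg _ = 0) //; rewrite /sg big1 // => q _.
  by rewrite coef_order ?mulmx0 //; have := ltn_ord q; lia.
rewrite leq_eqVlt => /orP[/eqP uo|uo].
  set v := sg _; exists 0; first exact: lin_span0.
  exists v; last by rewrite add0r.
  apply: lin_span_gen; exists j, k; split; first by lia.
  apply: eq_bigr => q _; rewrite mx_deriv_coefL; congr (_ *m coefL _ _); lia.
rewrite (_ : sg _ = 0) //; apply: (lam (WLm j k m) (has_coefs_lam_poly _ _)).
  by move=> s su; apply: coef_order; lia.
apply: (has_coefs_ext _ (fun _ => erefl) (has_coefs_lam_poly (k + m.+1) (D j k))) => l.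
by rewrite scalerA -exprS addnS.
Qed.

Lemma pspan_formula : pspan P = target.
Proof.
apply/seteqP; split=> [v /sup[Y [e [WY he e0 ->]]]|_ [v Av [w Bw <-]]]; last first.
  have [_ PP] := hP.
  have /(pspanP _ hP) Pv : pspan P v.
    move: v Av; apply: lin_span_ind; first by exists 0; rewrite ?mulmx0.
    move=> a _ v [j [k [ok ->]]] /(pspanP _ hP) Pv; apply/(pspanP _ hP).
    rewrite mulmxDr -scalemxAr Pv; congr (_ *: _ + _); apply/(pspanP _ hP).
    have H : pspan P (sg (fun s => coefL (D j k) (s%:Z - (k + 0)%N%:Z))).
      by apply: (sub (WLm j k 0) (has_coefs_lam_poly (k + 0) (D j k))) => s su; apply: coef_order; lia.
    move: H; rewrite /sg; congr (pspan P _); apply: eq_bigr => q _.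
    by rewrite mx_deriv_coefL; congr (_ *m coefL _ _); lia.
  have /(pspanP _ hP) Pw : pspan P w.
    move: w Bw; apply: lin_span_ind; first by exists 0; rewrite ?mulmx0.
    move=> a _ w [j [k [ok ->]]] /(pspanP _ hP) Pw; apply/(pspanP _ hP).
    rewrite mulmxDr -scalemxAr Pw; congr (_ *: _ + _); apply/(pspanP _ hP).
    (* [m] is the power of lambda missing for the order [u]. *)
    have [m uE] : exists m, u = (o j + (k + m))%N by exists (u - o j - k)%N; lia.
    have H : pspan P (sg (fun s => coefL (D j k) (s%:Z - (k + m)%N%:Z))).
      by apply: (sub (WLm j k m) (has_coefs_lam_poly (k + m) (D j k))) => s su; apply: coef_order; lia.
    move: H; rewrite /sg; congr (pspan P _); apply: eq_bigr => q _.
    by rewrite mx_deriv_coefL; congr (_ *m coefL _ _); lia.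
  by apply/(pspanP _ hP); rewrite mulmxDr Pv Pw.
have [a ha YE] := has_coefs_lam_inv he e0.
have AY : (W `&` lam_image u%:Z Hplus) Y.
  by split=> //; exists a; [exact: has_coefs_Hplus ha|apply/funext => l; rewrite YE].
have [Y1 GY1 [_ [h Hh <-] YE1]] := adapted AY.
have [e1 [he1 te1]] : exists e1, has_coefs Y1 e1 /\ target (sg e1).
  move: Y1 GY1 {YE1}; apply: lin_span_ind.
    exists (fun=> 0); split; first exact: has_coefs0.
    by rewrite /sg big1 // => q _; rewrite mulmx0.
  move=> b _ Y2 [j [k [m [uo ->]]]] [e2 [he2 te2]].
  exists (fun s => b *: coefL (D j k) (s%:Z - (k + m)%N%:Z) + e2 s); split.
    exact: (has_coefs_lin b (has_coefs_lam_poly (k + m) (D j k)) he2).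
  by rewrite sg_lin; apply: target_lin => //; exact: target_gen.
have [eh heh] := has_coefs_exists Hh.
have hY := has_coefs_lin 1 (has_coefs_lam r heh) he1.
have eE : e =1 fun s => 1 *: (if (s < r)%N then 0 else eh (s - r)%N) + e1 s.
  apply: has_coefs_uniq he (has_coefs_ext _ (fun _ => erefl) hY) => l.
  by rewrite -YE1 circle_funD scale1r addrC.
(* As [q + u < r], the summand in [lambda^r] does not reach the coefficients used. *)
rewrite (_ : sg e = sg e1) //; apply: eq_bigr => q _; rewrite eE.
have -> : (q + u < r)%N by have := ltn_ord q; lia.
by rewrite scaler0 add0r.
Qed.

End AtPoint.
End Formula.

(** * Assembly of the factorization *)

Section Assembly.
Context {R : realType} {M : riemannSurface R} {n : nat}.
Local Notation C := (Cplx R).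
Implicit Types (l : circle R).

Lemma big_mulmx_rcons (I : Type) (s : seq I) x (G : I -> 'M[C]_n) :
  \big[mulmx/1%:M]_(i <- rcons s x) G i = (\big[mulmx/1%:M]_(i <- s) G i) *m G x.
Proof.
elim: s => [|y s IH] /=; first by rewrite big_cons !big_nil mulmx1 mul1mx.
by rewrite !big_cons IH mulmxA.
Qed.

Lemma unitary_mul (A B : 'M[C]_n) : A ^t* *m A = 1%:M -> B ^t* *m B = 1%:M ->
  (A *m B) ^t* *m (A *m B) = 1%:M.
Proof. by move=> a b'; rewrite adjmxM -mulmxA [A ^t* *m _]mulmxA a mul1mx b'. Qed.

Lemma pfac_unitary (P : 'M[C]_n) l : herm_proj P -> (pfac P l) ^t* *m pfac P l = 1%:M.
Proof. by move=> hP; rewrite pfac_adj // pfacVK. Qed.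

Lemma pfac1 (P : 'M[C]_n) : pfac P (@circle1 R) = 1%:M.
Proof. by rewrite /pfac /= scale1r addrCA subrr addr0. Qed.

Lemma big_mulmx2 (I : Type) (x y : I) (G : I -> 'M[C]_n) :
  \big[mulmx/1%:M]_(i <- [:: x; y]) G i = G x *m G y.
Proof. by rewrite !big_cons big_nil mulmx1. Qed.

Section Data.
Variables (b : step) (r : nat) (pi : nat -> M -> 'M[C]_n) (F : nat -> nat -> M -> 'M[C]_n).
Hypothesis data : alternating_data b r pi F.

Let alpha i p := pspan (pi i p).
Let eF i : (i <= r)%N -> ext_sol i (F i). Proof. exact: (proj1 data). Qed.
Let sF i : (i < r)%N -> step_rel (step_at b r i.+1) i (F i.+1) (F i) (pi i.+1).
Proof. exact: (proj2 data). Qed.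
Let uF i p : (i <= r)%N -> unitary_loop (ploop i (F i ^~ p)).
Proof. by move=> /eF[_ _ H _ _]; exact: H. Qed.
Let oF i p : (i <= r)%N -> ploop i (F i ^~ p) (@circle1 R) = 1%:M.
Proof. by move=> /eF[_ _ _ H _]; exact: H. Qed.

Lemma partial_prodE i p : (i <= r)%N -> partial_prod alpha i p = ploop i (F i ^~ p).
Proof.
move=> ir; apply/funext => l; elim: i ir => [|i IH] ir.
  rewrite /partial_prod /factor_prod big_geq // -(oF p ir).
  by rewrite /ploop !big_ord1 !expr0.
rewrite /partial_prod /factor_prod.
have -> : index_iota 1 i.+2 = rcons (index_iota 1 i.+1) i.+1.
  by rewrite /index_iota !subSS !subn0 -[in LHS](addn1 i) iotaD cats1 add1n.
rewrite big_mulmx_rcons -/(factor_prod alpha 1 i p l).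
have -> : factor_prod alpha 1 i p l = ploop i (F i ^~ p) l by exact: IH (ltnW ir).
have [hpi _ fac _] := sF ir.
by rewrite uniton_factor_pspan ?fac //; exact: hpi.
Qed.

Lemma alternating_uniton i : (1 <= i <= r)%N -> uniton (partial_prod alpha i.-1) (alpha i).
Proof.
case: i => [//|i] /andP[_ ir]; have [hpi spi fac _] := sF ir; split.
  exact: smooth_subbundle_pspan.
rewrite (_ : (fun p l => _) = fun p => ploop i.+1 (F i.+1 ^~ p)).
  by apply: ext_sol_extended; exact: eF.
apply/funext => p; apply/funext => l.
by rewrite /= (partial_prodE p (ltnW ir)) uniton_factor_pspan ?fac //; exact: hpi.
Qed.

Lemma alternating_alternates : alternating_factorization b r alpha.
Proof.
move=> [//|i] /andP[_ ir] p _.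
have := step_image (eF ir) (eF (ltnW ir)) (sF ir) (p := p) I.
by apply: filterS => q; rewrite /= (partial_prodE q (ltnW ir)) (partial_prodE q ir).
Qed.

(** Descending induction by pairs of steps. As [r] is even, each pair consists of [b] followed by
    the other step. *)
Lemma alternating_real s : r = (2 * s)%N -> sharp r (F r) = F r ->
  forall j, (j <= s)%N -> sharp (2 * j) (F (2 * j)%N) = F (2 * j)%N.
Proof.
move=> rs Fr j js; have [t ->] : exists t, j = (s - t)%N by exists (s - j)%N; rewrite subKn.
elim: t {j js} => [|t IH]; first by rewrite subn0 -rs.
have [st|ts] := leqP s t.
  by have -> : (s - t.+1 = s - t)%N by lia.
have [i [iE1 iE2 ir]] : exists i, [/\ (s - t.+1)%N = i, (s - t)%N = i.+1 & (2 * i).+1 < r]%N.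
  by exists (s - t.+1)%N; split=> //; lia.
move: IH; rewrite iE1 iE2 (_ : (2 * i.+1)%N = (2 * i).+2); last by lia.
move=> real2; have i1 := ltnW ir.
have sU : step_at b r (2 * i).+2 = b by rewrite /step_at (_ : odd _ = false) //; lia.
have sS : step_at b r (2 * i).+1 = other_step b by rewrite /step_at (_ : odd _ = true) //; lia.
have := sF ir; rewrite sU => s2; have := sF i1; rewrite sS => s1.
exact: (real_two_steps (eF ir) (eF i1) (eF (ltnW i1)) real2 s2 s1).
Qed.

Lemma real_conj i p l : sharp i (F i) = F i ->
  map_mx Num.conj (ploop i (F i ^~ p) l) = val l ^- i *: ploop i (F i ^~ p) l.
Proof.
move=> e; rewrite -{2}e ploop_sharp scalerA mulVf ?scale1r //.
by rewrite expf_neq0 // circle_neq0.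
Qed.

Lemma partial_prod_real i p : (i <= r)%N -> sharp i (F i) = F i ->
  OmegaReal i (partial_prod alpha i p).
Proof.
move=> ir e; rewrite partial_prodE //; split; last by move=> l; exact: real_conj.
by apply: ploop_OmegaPoly; [exact: uF|exact: oF].
Qed.

Lemma pfac_ploop (P : 'M[C]_n) l : pfac P l = ploop 1 (fun k => if k == 0%N then P else 1%:M - P) l.
Proof. by rewrite /ploop big_ord_recl big_ord1 expr0 scale1r expr1. Qed.

(** The pair of factors is the quotient of two real partial products, and the powers [lambda^-i] and
    [lambda^-(i + 2)] of their reality conditions leave [lambda^-2]. *)
Lemma quadratic_real i p : (i.+2 <= r)%N -> sharp i (F i) = F i -> sharp i.+2 (F i.+2) = F i.+2 ->
  OmegaReal 2 (factor_prod alpha i.+1 i.+2 p).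
Proof.
move=> ir e0 e2; have [h1 _ f1 _] := sF (ltnW ir); have [h2 _ f2 _] := sF ir.
pose G l := pfac (pi i.+1 p) l *m pfac (pi i.+2 p) l.
have GE : factor_prod alpha i.+1 i.+2 p = G.
  apply/funext => l; rewrite /factor_prod.
  have -> : index_iota i.+1 i.+3 = [:: i.+1; i.+2].
    by rewrite /index_iota (_ : (i.+3 - i.+1)%N = 2) //; lia.
  rewrite big_mulmx2 (uniton_factor_pspan l (h1 p)) (uniton_factor_pspan l (h2 p)).
  exact: erefl.
have [U UE] := ploop_mul 1 1 (fun k => if k == 0%N then pi i.+1 p else 1%:M - pi i.+1 p)
  (fun k => if k == 0%N then pi i.+2 p else 1%:M - pi i.+2 p).
have GU : G = ploop 2 U by apply/funext => l; rewrite /G !pfac_ploop UE.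
have FG l : ploop i.+2 (F i.+2 ^~ p) l = ploop i (F i ^~ p) l *m G l.
  by rewrite f2 f1 mulmxA.
rewrite GE; split.
  rewrite GU; apply: ploop_OmegaPoly; rewrite -GU.
    by move=> l; apply: unitary_mul; apply: pfac_unitary; [exact: h1|exact: h2].
  by rewrite /G !pfac1 mul1mx.
move=> l; have := real_conj p l e2; rewrite FG map_mxM (real_conj p l e0).
rewrite -[_ *m map_mx _ _]scalemxAl => /(congr1 (fun A : 'M[C]_n => val l ^+ i *: A)).
rewrite !scalerA mulfV ?expf_neq0 ?circle_neq0 // scale1r.
have -> : val l ^+ i * val l ^- i.+2 = val l ^- 2.
  by rewrite -addn2 exprD invfM mulrA mulfV ?mul1r // expf_neq0 // circle_neq0.
rewrite scalemxAr => /(congr1 (mulmx ((ploop i (F i ^~ p) l) ^t* ))).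
by rewrite !mulmxA (uF p (ltnW (ltnW ir))) !mul1mx.
Qed.

(** The inverse of a unitary loop is its adjoint, whose coefficients are the adjoints of those of
    the loop. *)
Lemma alternating_inverse_coefs : inverse_coefs r alpha (fun i q p => (F i q p) ^t* ).
Proof.
move=> i ir p l; rewrite (partial_prodE p (ltnW ir)) invmx_unitary ?ploop_adj //.
by apply/unitarymxP; apply: unitary_loopV; exact: uF (ltnW ir).
Qed.

Lemma alternating_formula (X : M -> set 'M[C]_(n, r)) d (L : 'I_d -> M -> 'M[C]_(n, r)) (o : 'I_d -> nat) :
  let W p := loop_image (ploop r (F r ^~ p)) Hplus in
  generates X W -> mero_spanning_set X L -> (forall j, has_order (L j) (o j)) ->
  forall i, (i < r)%N -> let u := num_uhlenbeck b r i.+1 in order_adapted W L o u ->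
  forall c : chart R M, coordinate c -> off_discrete (chart_dom c) (fun p =>
    alpha i.+1 p = set_add (lin_span (alpha_gen (fun i q p => (F i q p) ^t* ) L o i.+1 u c p))
      (lin_span (alpha_gen_hat (fun i q p => (F i q p) ^t* ) L o i.+1 u c p))).
Proof.
move=> W gX mL oL i ir u ad c cc.
have sT : chart_dom c `<=` setT by [].
have Wr p h : Hplus h -> W p (fun l => val l ^+ r *: h l).
  move=> Hh; apply/(loop_imageP _ (uF p (leqnn r))).
  apply: (Hplus_ext _ (Hplus_ploop r (rev_adj r (F r ^~ p)) Hh)) => l.
  by rewrite ploop_rev -scalemxAl -scalemxAr.
have Wadd p y h : W p y -> Hplus h -> W p (fun l => y l + val l ^+ r *: h l).
  move=> Wy /(Wr p) /(loop_imageP _ (uF p (leqnn r))) H2.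
  move/(loop_imageP _ (uF p (leqnn r))): Wy => H1; apply/(loop_imageP _ (uF p (leqnn r))).
  by apply: (Hplus_ext _ (Hplus_add H1 H2)) => l; rewrite mulmxDr.
have Wlam p k y : W p y -> W p (fun l => val l ^+ k *: y l).
  move=> /(loop_imageP _ (uF p (leqnn r))) H1; apply/(loop_imageP _ (uF p (leqnn r))).
  by apply: (Hplus_ext _ (Hplus_lamX k H1)) => l; rewrite scalemxAr.
have G1 : off_discrete setT (fun p => forall i0 : 'I_r, loop_image (ploop i0 (F i0 ^~ p)) Hplus =
    match step_at b r i0.+1 with
    | Uhlenbeck => uhlenbeck_step (loop_image (ploop i0.+1 (F i0.+1 ^~ p)) Hplus)
    | Segal => segal_step i0.+1 (loop_image (ploop i0.+1 (F i0.+1 ^~ p)) Hplus) end).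
  apply: off_discrete_all => i0; have i0r := ltn_ord i0.
  exact: (step_image (eF i0r) (eF (ltnW i0r)) (sF i0r)).
have G2 := generators_in_image cc gX mL Wr.
(* The vanishing of the coefficients below the order is recorded on neighbourhoods, because it is
   needed for their derivatives. It concerns finitely many coefficients, so the exceptional set
   remains discrete. *)
have G4 : off_discrete setT (fun p => forall j (t : 'I_(o j)),
    setT p /\ \forall q \near p, coefL (L j q) (t : nat)%:Z = 0).
  apply: off_discrete_all => j; apply: off_discrete_all => t.
  by apply: off_discrete_near openT _; have [_ H] := oL j; exact: H (ltn_ord t).
have N := off_discrete_and (off_discrete_and (off_discrete_and (off_discrete_sub sT G1) G2)
  (off_discrete_and (ad c cc) (off_discrete_sub sT G4))) (off_discrete_dom cc).
apply: off_discreteS N => p [[[st WL] [adp L0]] cp].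
have [hpi _ fac _] := sF ir.
have WP := alternating_space (W := fun k => loop_image (ploop k (F k ^~ p)) Hplus) (b := b) (r := r)
  (fun i0 i0r => st (Ordinal i0r)) (Wadd p).
have {}WP : forall y, loop_image (ploop i.+1 (F i.+1 ^~ p)) Hplus y <-> exists a h, [/\ Hplus a,
    W p (fun l => val l ^+ u *: a l), Hplus h & forall l, y l = a l + val l ^+ i.+1 *: h l].
  by apply: WP => // y [f Hf <-]; exact: Hplus_ploop.
have u1 := uF p (ltnW ir); have fp := fac p.
apply: (@pspan_formula _ _ _ r d i u (fun i q p => (F i q p) ^t* ) L o c p (pi i.+1 p) (W p)).
- exact: hpi.
- exact: num_uhlenbeck_le.
- by move=> Y e; exact: (uniton_coefs_sub u1 (hpi p) fp WP).
- by move=> Y e e'; exact: (uniton_coefs_lam u1 fp WP).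
- by move=> v; exact: (uniton_coefs_sup u1 (hpi p) fp WP).
- by move=> k Y; exact: Wlam.
- exact: WL.
- move=> j k t tj; rewrite -mx_deriv_coefL; apply: (mx_deriv_near0 cc) => //.
  case: t tj => t tj; last by apply: (@filterE _ (nbhs p)) => q; rewrite coefL_out.
  have tj' : (t < o j)%N by rewrite -ltz_nat.
  by have [_ H] := L0 j (Ordinal tj').
- exact: adp.
Qed.

End Data.
End Assembly.

Theorem theorem6p3 (R : realType) (M : riemannSurface R) (n r s : nat)
    (hr : r = (2 * s)%N) (Phi : M -> loop R n)
    (hPhi : extended_solution Phi)
    (hReal : forall p, OmegaReal r (Phi p)) (b : step) :
  exists (alpha : nat -> M -> set 'cV[Cplx R]_n)
         (S : nat -> nat -> M -> 'M[Cplx R]_n),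
    [/\ uniton_factorization r Phi alpha /\
       alternating_factorization b r alpha,
        forall l, (1 <= l <= s)%N ->
          forall p, OmegaReal 2 (factor_prod alpha (2 * l - 1) (2 * l) p),
        forall j, (1 <= j <= s)%N ->
          forall p, OmegaReal (2 * j) (partial_prod alpha (2 * j) p),
        inverse_coefs r alpha S &
        forall (X : M -> set 'M[Cplx R]_(n, r)) (d : nat)
               (L : 'I_d -> M -> 'M[Cplx R]_(n, r)) (o : 'I_d -> nat),
          let W p := loop_image (Phi p) Hplus in
          holo_subbundle X -> generates X W ->
          mero_spanning_set X L -> (forall j, has_order (L j) (o j)) ->
          forall i, (1 <= i <= r)%N ->
            let u := num_uhlenbeck b r i in
            order_adapted W L o u ->
            forall c : chart R M, coordinate c ->
              off_discrete (chart_dom c) (fun p =>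
                alpha i p = set_add (lin_span (alpha_gen S L o i u c p))
                                    (lin_span (alpha_gen_hat S L o i u c p)))].
Proof.
Proof.
have [T [esT TE]] := ext_sol_of hPhi (fun p => proj1 (hReal p)).
have [pi [F [Fr data]]] := alternating_exists b esT.
have PhiE p : Phi p = ploop r (F r ^~ p) by apply/funext => l; rewrite TE Fr.
(* The reality of [Phi p] equates two polynomial loops; uniqueness of coefficients makes it an
   equation between families. *)
have realT : sharp r (F r) = F r.
  have [Ti _ _ _ _] := esT; rewrite Fr; apply/funext => k; apply/funext => p.
  have [kr|rk] := leqP k r; last by rewrite Ti // /sharp leqNgt rk.
  suff H l : ploop r (sharp r T ^~ p) l = ploop r (T ^~ p) l by exact: (ploop_inj H kr).
  rewrite ploop_sharp -TE (proj2 (hReal p) l).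
  by rewrite scalerA mulfV ?scale1r // expf_neq0 // circle_neq0.
have real := alternating_real data hr realT.
exists (fun i p => pspan (pi i p)), (fun i q p => (F i q p) ^t* ); split.
- split; last exact: (alternating_alternates data).
  by split=> [p l|i]; [rewrite (partial_prodE data p (leqnn r)) PhiE|exact: (alternating_uniton data)].
- case=> [//|l] /andP[_ ls] p.
  have -> : (2 * l.+1 - 1)%N = (2 * l).+1 by lia.
  have e2 : (2 * l.+1)%N = (2 * l).+2 by lia.
  have := real l.+1 ls; rewrite e2 => r2; have r0 := real l (ltnW ls).
  by apply: (quadratic_real data) => //; lia.
- by move=> j /andP[_ js] p; apply: (partial_prod_real data); [lia|exact: real].
- exact: (alternating_inverse_coefs data).
move=> X d L o W _ gX mL oL [//|i] /andP[_ ir] u ad c cc.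
have WE : W = fun p => loop_image (ploop r (F r ^~ p)) Hplus by apply/funext => p; rewrite /W PhiE.
rewrite WE in gX ad; exact: (alternating_formula data gX mL oL ir ad cc).
Qed.
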